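(* Let $n,k\in\mathbb N$, $T\in(0,\infty)$, let $E=E(\mathbb R^n)$ be a rearrangement-invariant space, let $\Phi:(0,\infty)\to[0,\infty)$ be continuous, monotonically decreasing with $0<\int_0^\infty \Phi(z)z^{n-1}\,dz<\infty$, let $\varphi(\tau)=\Phi\big((\tau/V_n)^{1/n}\big)$, and assume $\varphi\in\widetilde E'(0,T)$. Assume that $\Phi\in C^k(0,\infty)$ and that for some positive $a_1,a_2,z_1,\delta_1$, with $\Phi_j(z)=\big(\frac1z\frac{d}{dz}\big)^j\Phi(z)$, $$\max_{1\le j\le k}\big(z^{2j}|\Phi_j(z)|\big)\le a_1\Phi(z)\ \text{ and }\ (-1)^kz^k\Phi^{(k)}(z)\ge\delta_1\Phi(z)\quad\text{for } z\in(0,z_1],$$ $$\max_{1\le j\le k}\big(z^{2j}|\Phi_j(z)|\big)\le a_2 z^k\Phi(z)\quad\text{for } z>z_1.$$ Let $X=X(0,T)$ be a generalized Banach function space. Then $$H^G_E(\mathbb R^n)\hookrightarrow\Lambda^k(C;X)$$ if, and only if, $K\mapsto X$. The norm of the embedding operator $H^G_E(\mathbb R^n)\hookrightarrow\Lambda^k(C;X)$ depends only on $k,n,T,a_1,a_2,z_1,\delta_1$, on the norm of the embedding operator in $\|u\|_C\le c\|u\|_{H^G_E}$, and on the norm (best constant $c_K$) of the embedding $K\mapsto X$.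
   Context: $V_n$ is the volume of the unit ball of $\mathbb R^n$; $\varphi$ is positive, continuous, decreasing on $(0,\infty)$ with $0<\int_0^\infty\varphi<\infty$. Rearrangement-invariant space (RIS) is in the Bennett–Sharpley sense; $f^*$ is the decreasing rearrangement. $\widetilde E(\mathbb R_+)$, $\mathbb R_+=(0,\infty)$, is the unique RIS with $\|f\|_{E(\mathbb R^n)}=\|f^*\|_{\widetilde E(\mathbb R_+)}$; $\widetilde E'(\mathbb R_+)$ is its associate space, $\|h\|_{\widetilde E'(\mathbb R_+)}=\sup\{\int_0^\infty h^*f^*\,dt:\|f\|_{\widetilde E(\mathbb R_+)}\le1\}$; $\widetilde E(0,T)$, $\widetilde E'(0,T)$ are the restrictions to $(0,T)$ (norm of the extension by zero). $G(x)=\Phi(|x|)$, $x\ne0$; $H^G_E(\mathbb R^n)=\{u=G*f: f\in E(\mathbb R^n)\}$, $\|u\|_{H^G_E}=\inf\{\|f\|_E: G*f=u\}$. $C(\mathbb R^n)$ is the space of complex-valued bounded uniformly continuous functions with sup-norm $\|\cdot\|_C$. $\omega_k(u;t)=\sup_{|h|\le t}\|\Delta_h^ku\|_C$, $(\Delta^k_hu)(x)=\sum_{j=0}^k\binom kj(-1)^{k-j}u(x+jh)$. The condition $\varphi\in\widetilde E'(0,T)$ implies $\|u\|_C\le c\|u\|_{H^G_E}$. $Y\hookrightarrow Z$ means $Y\subset Z$ with continuous natural embedding. Generalized Banach function space (GBFS) $X=X(0,T)$: a linear space of measurable functions on $(0,T)$ with norm $\|\cdot\|_X$ such that ($\mu$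 = Lebesgue measure): (P1) $\|f\|_X=0$ iff $f=0$ a.e.; (P2) $|f|\le g$, $g\in X$ imply $f\in X$, $\|f\|_X\le\|g\|_X$; (P3) $0\le f_m\in X$, $f_m\uparrow f$ imply $\|f_m\|_X\to\|f\|_X$ (finiteness of the limit being the criterion for $f\in X$); (P4) for every measurable $B\subset(0,T)$, $\mu(B)>0$, there are $h_B>0$ a.e. in $B$ and $c_B>0$ with $\int_Bh_B|f|\,d\mu\le c_B\|f\|_X$ for all $f\in X$; (P5) for every measurable $B\subset(0,T)$, $\mu(B)>0$, there is $f_B\in X$ with $f_B>0$ a.e. in $B$. Calderón space: $\Lambda^k(C;X)=\{u\in C(\mathbb R^n): \omega_k(u;t^{1/n})\in X(0,T)\}$, $\|u\|_{\Lambda^k(C;X)}=\|u\|_C+\|\omega_k(u;t^{1/n})\|_{X(0,T)}$. Cone $K$: with $\Omega_\varphi(t,\tau)=\varphi(\tau)/(1+(\tau/t)^{k/n})$ and $\widetilde E_0(0,T)$ the set of nonnegative decreasing $\sigma\in\widetilde E(0,T)$, $K$ consists of all $h\ge0$ on $(0,T)$ of the form $h(t)=\int_0^T\Omega_\varphi(t,\tau)\sigma(\tau)\,d\tau$, $\sigma\in\widetilde E_0(0,T)$, and $\varrho_K(h)$ is the infimum of $\|\sigma\|_{\widetilde E(0,T)}$ over all such representations. $K\mapsto X$ means $K\subset X$ and there is $c_K>0$ with $\|h\|_X\le c_K\varrho_K(h)$ for all $h\in K$.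
   Formalization: The last clause is false uniformly in Φ, so it is read as two upper bounds for the embedding norm: one by a function of the listed quantities and the norm of φ in Ẽ'(0,T); one by a function of the listed quantities and Φ itself, uniform in E and X. *)

(* Defs.v *)
From HB Require Import structures.
From mathcomp Require Import all_boot all_order all_algebra.
From mathcomp Require Import complex.
From mathcomp Require Import all_classical all_reals all_analysis.
From mathcomp Require Import measurable_realfun.

Set Implicit Arguments.
Unset Strict Implicit.
Unset Printing Implicit Defensive.

Import Order.TTheory GRing.Theory Num.Theory.
Import numFieldNormedType.Exports.

Local Open Scope classical_set_scope.
Local Open Scope ring_scope.

Fact rowvec_display : measure_display.
Proof. exact: default_measure_display. Qed.

(* R^n is 'rV[R]_n with the Borel sigma-algebra, generated by the coordinates.
   Spaces of measurable functions are formed from Borel functions and only see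
   them up to equality a.e., so they have the same a.e.-classes as the spaces
   built on Lebesgue measurable functions. *)

Section RowVectorMeasurable.
Context {R : realType}.
Variable n : nat.

Let coord : 'I_n -> 'rV[R]_n -> measurableTypeR R := fun i x => x ord0 i.

Let rv_set0 : g_sigma_preimage coord set0.
Proof. exact: sigma_algebra0. Qed.

Let rv_setC A : g_sigma_preimage coord A -> g_sigma_preimage coord (~` A).
Proof. exact: sigma_algebraC. Qed.

Let rv_bigcup (F : (set 'rV[R]_n)^nat) :
  (forall i, g_sigma_preimage coord (F i)) ->
  g_sigma_preimage coord (\bigcup_i (F i)).
Proof. exact: sigma_algebra_bigcup. Qed.

HB.instance Definition _ :=
  @isMeasurable.Build rowvec_display
    'rV[R]_n (g_sigma_preimage coord) rv_set0 rv_setC rv_bigcup.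

End RowVectorMeasurable.

Section RowVectorMeasurableFun.
Context {R : realType}.

Lemma measurable_rv_coord n (i : 'I_n) :
  measurable_fun setT (fun x : 'rV[R]_n => x ord0 i).
Proof.
move=> _ Y mY; rewrite setTI; apply: sub_sigma_algebra => /=.
rewrite -bigcup_seq/=; exists i => /=; first by rewrite mem_index_enum.
by exists Y => //; rewrite setTI.
Qed.

Lemma measurable_fun_rowvec d (S : measurableType d) n (f : S -> 'rV[R]_n) :
  (forall i, measurable_fun setT (fun s => f s ord0 i)) ->
  measurable_fun setT f.
Proof.
move=> mf; apply: (@measurability _ _ _ _ _ _
  (\big[setU/set0]_(i < n) preimage_set_system setT
     (fun x : 'rV[R]_n => (x ord0 i : measurableTypeR R)) measurable)) => //.
move=> _ [B + <-]; rewrite -bigcup_seq => -[i _ [A mA <-]].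
by rewrite !setTI -[X in measurable X]setTI; exact: (mf i).
Qed.

End RowVectorMeasurableFun.

Section LebesgueStep.
Context {R : realType}.
Variables (n : nat) (m : {sigma_finite_measure set 'rV[R]_n -> \bar R}).

Definition rv_cons (p : measurableTypeR R * 'rV[R]_n) : 'rV[R]_n.+1 :=
  row_mx (const_mx p.1 : 'rV[R]_1) p.2.

Let rv_uncons (x : 'rV[R]_n.+1) : measurableTypeR R * 'rV[R]_n :=
  (x ord0 ord0, rsubmx (x : 'rV[R]_(1 + n))).

Let measurable_rv_cons : measurable_fun setT rv_cons.
Proof.
apply: measurable_fun_rowvec => i.
case: (@split_ordP 1 n i) => j ->.
  apply: (eq_measurable_fun fst) => [p _|]; last exact: measurable_fst.
  by rewrite /rv_cons (row_mxEl (const_mx p.1 : 'rV[R]_1) p.2 ord0 j) mxE.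
apply: (eq_measurable_fun (fun p => (snd p : 'rV[R]_n) ord0 j)) => [p _|].
  by rewrite /rv_cons (row_mxEr (const_mx p.1 : 'rV[R]_1) p.2 ord0 j).
apply: (measurableT_comp (measurable_rv_coord j)); exact: measurable_snd.
Qed.

Let measurable_rv_uncons : measurable_fun setT rv_uncons.
Proof.
apply/measurable_fun_pair; first exact: measurable_rv_coord.
apply: measurable_fun_rowvec => i.
apply: (eq_measurable_fun (fun x : 'rV[R]_n.+1 => x ord0 (rshift 1 i))).
  by move=> x _; rewrite mxE.
exact: measurable_rv_coord.
Qed.

Let rv_consK : cancel rv_cons rv_uncons.
Proof.
move=> [a v]; rewrite /rv_uncons /rv_cons row_mxKr; congr pair.
have -> : (ord0 : 'I_n.+1) = lshift n (ord0 : 'I_1) by exact: val_inj.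
by rewrite (row_mxEl (const_mx a : 'rV[R]_1) v) mxE.
Qed.

Definition lebesgue_step : set 'rV[R]_n.+1 -> \bar R :=
  pushforward (@lebesgue_measure R \x m)%E rv_cons.

Let step0 : lebesgue_step set0 = 0%E.
Proof. by rewrite /lebesgue_step /pushforward preimage_set0 measure0. Qed.

Let step_ge0 A : (0 <= lebesgue_step A)%E.
Proof. exact: measure_ge0. Qed.

Let step_sigma_additive : semi_sigma_additive lebesgue_step.
Proof.
exact: (@measure_semi_sigma_additive _ _ _
  (measure_function_pushforward__canonical__measure_function_Measure
     (@lebesgue_measure R \x m)%E measurable_rv_cons)).
Qed.

HB.instance Definition _ :=
  isMeasure.Build _ _ _ lebesgue_step step0 step_ge0 step_sigma_additive.

Let sigma_finite_step : sigma_finite setT lebesgue_step.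
Proof.
have /sigma_finiteP[F [FT ndF mF]] := sigma_finiteT (@lebesgue_measure R).
have /sigma_finiteP[G [GT ndG mG]] := sigma_finiteT m.
exists (fun i => rv_uncons @^-1` (F i `*` G i)).
  rewrite -preimage_bigcup predeqE => x; split => // _ /=.
  have [i _ Fi] : (\bigcup_i F i) (rv_uncons x).1 by rewrite -FT.
  have [j _ Gj] : (\bigcup_i G i) (rv_uncons x).2 by rewrite -GT.
  exists (maxn i j) => //; split.
  - by move: Fi; exact/subsetPset/ndF/leq_maxl.
  - by move: Gj; exact/subsetPset/ndG/leq_maxr.
move=> i; have [mFi Fi] := mF i; have [mGi Gi] := mG i; split.
  rewrite -[X in measurable X]setTI; apply: measurable_rv_uncons => //.
  exact: measurableX.
rewrite /lebesgue_step /pushforward -comp_preimage.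
rewrite (_ : rv_uncons \o rv_cons = id); last first.
  by apply/funext => p; exact: rv_consK.
by rewrite preimage_id product_measure1E// lte_mul_pinfty// ge0_fin_numE.
Qed.

HB.instance Definition _ :=
  Measure_isSigmaFinite.Build _ _ _ lebesgue_step sigma_finite_step.

End LebesgueStep.

(* Lebesgue measure on R^n, as an iterated product measure. *)
Fixpoint lebesgue_rV {R : realType} (n : nat) :
    {sigma_finite_measure set 'rV[R]_n -> \bar R} :=
  if n is n'.+1 then lebesgue_step (lebesgue_rV n') else dirac (0 : 'rV[R]_0).

Section FunctionNorm.
Context d (T : measurableType d) (R : realType).
Variables (mu : {measure set T -> \bar R}) (D : set T).
Implicit Types f g : T -> \bar R.
Local Open Scope ereal_scope.

Definition Mplus : set (T -> \bar R) :=
  [set f | measurable_fun D f /\ forall x, D x -> 0 <= f x].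

(* Bennett-Sharpley, Definition I.1.1, over the measure space (D, mu): the
   values of functions outside D are irrelevant. *)
Record function_norm := FunctionNorm {
  fnorm :> (T -> \bar R) -> \bar R ;
  fnorm_ge0 : forall f, Mplus f -> 0 <= fnorm f ;
  fnorm_eq0 : forall f, Mplus f ->
    fnorm f = 0 <-> {ae mu, forall x, D x -> f x = 0} ;
  fnormZ : forall (a : R) f, (0 <= a)%R -> Mplus f ->
    fnorm (fun x => a%:E * f x) = a%:E * fnorm f ;
  fnormD : forall f g, Mplus f -> Mplus g ->
    fnorm (fun x => f x + g x) <= fnorm f + fnorm g ;
  fnorm_le : forall f g, Mplus f -> Mplus g ->
    {ae mu, forall x, D x -> g x <= f x} -> fnorm g <= fnorm f ;
  fnorm_fatou : forall (f_ : nat -> T -> \bar R) f,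
    (forall m, Mplus (f_ m)) -> Mplus f ->
    {ae mu, forall x, D x -> nondecreasing_seq (fun m => f_ m x) /\
                             f_ m x @[m --> \oo] --> f x} ->
    fnorm (f_ m) @[m --> \oo] --> fnorm f ;
  fnorm_indic : forall A, measurable A -> A `<=` D -> mu A < +oo ->
    fnorm (fun x => (\1_A x)%:E) < +oo ;
  fnorm_integral : forall A, measurable A -> A `<=` D -> mu A < +oo ->
    exists2 C : R, (0 < C)%R &
      forall f, Mplus f -> \int[mu]_(x in A) f x <= C%:E * fnorm f }.

Definition distribution_function f (l : R) : \bar R :=
  mu (D `&` [set x | l%:E < f x]).

(* f^* for f >= 0; the infimum of the empty set is +oo. *)
Definition rearrangement f (t : R) : \bar R :=
  ereal_inf [set l%:E | l in
    [set l : R | (0 <= l)%R /\ distribution_function f l <= t%:E]].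

Definition rearrangement_invariant (rho : (T -> \bar R) -> \bar R) : Prop :=
  forall f g, Mplus f -> Mplus g ->
    {ae mu, forall x, D x -> f x < +oo} ->
    {ae mu, forall x, D x -> g x < +oo} ->
    (forall l : R, (0 <= l)%R ->
       distribution_function f l = distribution_function g l) ->
    rho f = rho g.

Record ri_space := RISpace {
  ri_norm :> function_norm ;
  ri_invariant : rearrangement_invariant ri_norm }.

End FunctionNorm.

Definition Rplus {R : realType} : set (measurableTypeR R) :=
  [set` `]0 : R, +oo[%R].

Definition itv0 {R : realType} (T : R) : set (measurableTypeR R) :=
  [set` `]0 : R, T[%R].

Notation leb := (@lebesgue_measure _).
Notation ri_space_Rn R n := (ri_space (@lebesgue_rV R n) setT).
Notation ri_space_Rplus R :=
  (@ri_space _ (measurableTypeR R) R (@lebesgue_measure R) Rplus).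

Section Spaces.
Context {R : realType}.

Definition representation_space n (E : ri_space_Rn R n)
    (Et : ri_space_Rplus R) : Prop :=
  forall f, Mplus setT f -> E f = Et (rearrangement (lebesgue_rV n) setT f).

Definition rearr_Rplus (f : R -> \bar R) : R -> \bar R :=
  rearrangement leb Rplus f.

Definition associate_norm (Et : ri_space_Rplus R) (h : R -> \bar R) : \bar R :=
  ereal_sup [set (\int[leb]_(t in Rplus)
                    (rearr_Rplus h t * rearr_Rplus f t))%E
            | f in [set f | Mplus Rplus f /\ (Et f <= 1)%E]].

Definition zero_ext (T : R) (s : R -> R) : R -> \bar R :=
  fun t => ((s \_ (itv0 T)) t)%:E.

(* Generalized Banach function space on (0, T); values outside (0, T) are
   irrelevant, and gbfs_norm is meaningful on gbfs_mem only. *)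
Record gbfs (T : R) := GBFS {
  gbfs_mem : set (R -> R) ;
  gbfs_norm : (R -> R) -> R ;
  gbfs_measurable : forall f, gbfs_mem f ->
    measurable_fun (itv0 T) f ;
  gbfs_memD : forall f g, gbfs_mem f -> gbfs_mem g -> gbfs_mem (f \+ g) ;
  gbfs_memZ : forall (a : R) f, gbfs_mem f -> gbfs_mem (fun t => a * f t) ;
  gbfs_normD : forall f g, gbfs_mem f -> gbfs_mem g ->
    gbfs_norm (f \+ g) <= gbfs_norm f + gbfs_norm g ;
  gbfs_normZ : forall (a : R) f, gbfs_mem f ->
    gbfs_norm (fun t => a * f t) = `|a| * gbfs_norm f ;
  gbfs_P1 : forall f, gbfs_mem f ->
    gbfs_norm f = 0 <-> {ae leb, forall t : R, 0 < t < T -> f t = 0} ;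
  gbfs_P2 : forall f g : R -> R,
    measurable_fun (itv0 T) f -> gbfs_mem g ->
    {ae leb, forall t : R, 0 < t < T -> `|f t| <= g t} ->
    gbfs_mem f /\ gbfs_norm f <= gbfs_norm g ;
  gbfs_P3 : forall (f_ : nat -> R -> R) (f : R -> R),
    (forall m, gbfs_mem (f_ m)) ->
    measurable_fun (itv0 T) f ->
    {ae leb, forall t : R, 0 < t < T ->
       [/\ forall m, 0 <= f_ m t, nondecreasing_seq (fun m => f_ m t) &
           f_ m t @[m --> \oo] --> f t]} ->
    (gbfs_mem f <-> cvgn (fun m => gbfs_norm (f_ m))) /\
    (gbfs_mem f -> gbfs_norm (f_ m) @[m --> \oo] --> gbfs_norm f) ;
  gbfs_P4 : forall B : set (measurableTypeR R), measurable B ->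
    B `<=` itv0 T -> (0 < leb B)%E ->
    exists h : R -> R, exists c : R,
      [/\ measurable_fun B h, {ae leb, forall t, B t -> 0 < h t}, 0 < c &
        forall f, gbfs_mem f ->
          (\int[leb]_(t in B) (h t * `|f t|)%:E <= (c * gbfs_norm f)%:E)%E] ;
  gbfs_P5 : forall B : set (measurableTypeR R), measurable B ->
    B `<=` itv0 T -> (0 < leb B)%E ->
    exists2 f, gbfs_mem f & {ae leb, forall t, B t -> 0 < f t} }.

(* Euclidean norm: `|x| on 'rV[R]_n is the maximum norm. *)
Definition enorm n (x : 'rV[R]_n) : R := Num.sqrt (\sum_(i < n) x ord0 i ^+ 2).

Definition ball_volume n : R :=
  fine (lebesgue_rV n [set x : 'rV[R]_n | enorm x <= 1]).

(* The modulus as an element of R (`|z| lives in R[i]). *)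
Definition cmod (z : R[i]) : R := ComplexField.Normc.normc z.

Section FunctionsOnRn.
Variable n : nat.
Implicit Types (f u : 'rV[R]_n -> R[i]) (h x y : 'rV[R]_n).

Definition ri_mem (E : ri_space_Rn R n) : set ('rV[R]_n -> R[i]) :=
  [set f | [/\ measurable_fun setT (fun x => complex.Re (f x)),
               measurable_fun setT (fun x => complex.Im (f x)) &
               (E (fun x => (cmod (f x))%:E) < +oo)%E]].

Definition ri_normc (E : ri_space_Rn R n) f : R :=
  fine (E (fun x => (cmod (f x))%:E)).

Definition convolution (G : 'rV[R]_n -> R) f : 'rV[R]_n -> R[i] := fun x =>
  Complex (\int[lebesgue_rV n]_y (G (x - y) * complex.Re (f y)))
          (\int[lebesgue_rV n]_y (G (x - y) * complex.Im (f y))).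

(* The value at 0 is arbitrary. *)
Definition radial_kernel (Phi : R -> R) : 'rV[R]_n -> R := fun x => Phi (enorm x).

Definition potentials (E : ri_space_Rn R n) G : set ('rV[R]_n -> R[i]) :=
  [set convolution G f | f in ri_mem E].

Definition potential_norm (E : ri_space_Rn R n) G u : R :=
  inf [set ri_normc E f | f in [set f | ri_mem E f /\ convolution G f = u]].

Definition space_C : set ('rV[R]_n -> R[i]) :=
  [set u | (exists M : R, forall x, cmod (u x) <= M) /\
           (forall e : R, 0 < e -> exists2 r : R, 0 < r &
              forall x y, enorm (x - y) < r -> cmod (u x - u y) < e)].

Definition norm_C u : R := sup [set cmod (u x) | x in setT].

Definition finite_difference k h u : 'rV[R]_n -> R[i] := fun x =>
  \sum_(j < k.+1) 'C(k, j)%:R * (-1) ^+ (k - j) * u (x + j%:R *: h).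

Definition modulus_continuity k u (t : R) : R :=
  sup [set norm_C (finite_difference k h u) | h in [set h | enorm h <= t]].

Definition modulus_root k u : R -> R :=
  fun t => modulus_continuity k u (t `^ n%:R^-1).

Definition calderon k T (X : gbfs T) : set ('rV[R]_n -> R[i]) :=
  [set u | space_C u /\ gbfs_mem X (modulus_root k u)].

Definition calderon_norm k T (X : gbfs T) u : R :=
  norm_C u + gbfs_norm X (modulus_root k u).

End FunctionsOnRn.

Definition continuously_embedded (V : zmodType) (Y Z : set V)
    (nY nZ : V -> R) : Prop :=
  Y `<=` Z /\
  forall u, Y u -> forall e : R, 0 < e -> exists2 r : R, 0 < r &
    forall v, Y v -> nY (v - u) < r -> nZ (v - u) < e.

(* The best constant in nZ u <= c * nY u, u in Y. *)
Definition embedding_norm (V : Type) (Y : set V) (nY nZ : V -> R) : R :=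
  inf [set c : R | 0 <= c /\ forall u, Y u -> nZ u <= c * nY u].

Section Cone.
Variables (n k : nat) (T : R) (Et : ri_space_Rplus R) (phi : R -> R).

Definition Omega (t tau : R) : R :=
  phi tau / (1 + (tau / t) `^ (k%:R / n%:R)).

Definition Etilde0 : set (R -> R) :=
  [set s | [/\ forall t, 0 < t < T -> 0 <= s t,
               forall t1 t2, 0 < t1 -> t1 <= t2 -> t2 < T -> s t2 <= s t1 &
               (Et (zero_ext T s) < +oo)%E]].

Definition cone_represents (s h : R -> R) : Prop :=
  Etilde0 s /\
  forall t, 0 < t < T ->
    (h t)%:E = (\int[leb]_(tau in itv0 T) (Omega t tau * s tau)%:E)%E.

Definition cone : set (R -> R) :=
  [set h | (forall t, 0 < t < T -> 0 <= h t) /\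
           exists s, cone_represents s h].

Definition cone_rho (h : R -> R) : R :=
  inf [set fine (Et (zero_ext T s)) | s in [set s | cone_represents s h]].

Definition cone_embedded (X : gbfs T) : Prop :=
  cone `<=` gbfs_mem X /\
  exists2 c : R, 0 < c & forall h, cone h -> gbfs_norm X h <= c * cone_rho h.

End Cone.

(* ((1/z) d/dz)^j Phi *)
Definition Phi_iter (Phi : R -> R) (j : nat) : R -> R :=
  iter j (fun (g : R -> R) z => z^-1 * derive1 g z) Phi.

Definition Ck_pos (k : nat) (Phi : R -> R) : Prop :=
  (forall j, (j < k)%N -> forall z : R, 0 < z -> derivable (derive1n j Phi) z 1) /\
  (forall z : R, 0 < z -> {for z, continuous (derive1n k Phi)}).

Definition profile (Phi : R -> R) (n : nat) : R -> R :=
  fun tau => Phi ((tau / ball_volume n) `^ n%:R^-1).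

End Spaces.

(* Main.v *)
Require Import Defs.
From mathcomp Require Import all_boot all_order all_algebra.
From mathcomp Require Import complex.
From mathcomp Require Import all_classical all_reals all_analysis.
From mathcomp Require Import measurable_realfun.
From mathcomp Require Import ring lra zify.

Set Implicit Arguments.
Unset Strict Implicit.
Unset Printing Implicit Defensive.

Import Order.TTheory GRing.Theory Num.Theory.
Import numFieldNormedType.Exports.

Local Open Scope classical_set_scope.
Local Open Scope ring_scope.

(** The proof works with the variable nu x = V_n |x|^n, the measure of the ball
    of radius |x|. The kernel G is then the function phi o nu, and every
    density f enters through its decreasing rearrangement f*.

    Embedding from the cone. Let u = G * f and |h| <= r with r^n = t. A
    difference of order k of G is estimated in two ways. Near the origin each of
    its terms is bounded on its own. Away from the origin the mean value theorem
    for differences turns it into a k-th derivative along a line, which is a sum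
    of the functions Phi_j with coefficients of equal homogeneity; the bounds on
    z^(2j) Phi_j make it at most (r / |z|)^k times the kernel near the origin,
    and r^k times the kernel far away. Together the difference of G is at most a
    constant times a few translates and a dilation of Omega (t, nu z) cut off at
    nu z = T, plus t^(k/n) times those of the kernel itself ([kernel_upper]). After
    convolution with |f| the first part is bounded, by the Hardy-Littlewood
    inequality, by the pairing of Omega (t, .) with f*, a member of the cone; the
    second part is bounded by t^(k/n) times the sup-norm of a potential
    ([difference_le]). The power t^(k/n) is in turn dominated by another member of
    the cone, generated by a function that attains half of the associate norm of
    phi ([pow_le_cone_fun]). Monotonicity of the norm of X concludes
    ([modulus_le_cone]). The constant contains the quotient of the norm of the
    embedding into C by the associate norm of phi; this quotient is at most a
    constant depending on Phi, n and T, since the tail of phi is controlled by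
    its part on (0, T) ([profile_tail]).

    Embedding of the cone. In a narrow cone around a direction e the k-th
    derivative of G along e is close to the radial one, which by hypothesis has
    the sign (-1)^k and the order z^(-k) Phi z. Hence differences of G along e
    have a fixed sign there and are at least a constant times Omega
    ([cone_difference_Om]). Given a nonincreasing sigma, transplant it to R^n as
    sigma (c nu x), restricted to the opposite cone near the origin. This does
    not increase the norm, and the differences at the origin of its potential
    involve no cancellation, so the modulus of continuity of the potential is at
    least a constant times the member of the cone generated by sigma
    ([difference_lower]). Continuity of the embedding at 0, applied to small
    multiples of sigma, then bounds the norm of that member in X
    ([cone_of_continuously_embedded]).

    Potentials are bounded because phi pairs with f* ([convolution_bound]), and
    uniformly continuous because the kernel is, up to a small peak and a small
    tail, Lipschitz with bounded support ([pot_unif_cont]). *)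

(** * Inner product and Euclidean norm *)

Section EuclideanNorm.
Context {R : realType}.
Variable n : nat.
Implicit Types x y z : 'rV[R]_n.

Definition dotp x y : R := \sum_(i < n) x ord0 i * y ord0 i.

Lemma enorm_ge0 x : 0 <= enorm x.
Proof. exact: sqrtr_ge0. Qed.

Lemma dotpp_ge0 x : 0 <= dotp x x.
Proof. by apply: sumr_ge0 => i _; rewrite -expr2 sqr_ge0. Qed.

Lemma sqr_enorm x : enorm x ^+ 2 = dotp x x.
Proof.
rewrite /enorm sqr_sqrtr /dotp; last by apply: sumr_ge0 => i _; exact: sqr_ge0.
by apply: eq_bigr => i _; rewrite expr2.
Qed.

Lemma enormE x : enorm x = Num.sqrt (dotp x x).
Proof. by rewrite -sqr_enorm sqrtr_sqr ger0_norm ?enorm_ge0. Qed.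

Lemma dotpC x y : dotp x y = dotp y x.
Proof. by apply: eq_bigr => i _; rewrite mulrC. Qed.

Lemma dotpDl x y z : dotp (x + y) z = dotp x z + dotp y z.
Proof. by rewrite -big_split; apply: eq_bigr => i _; rewrite /= mxE mulrDl. Qed.

Lemma dotpZl (a : R) x z : dotp (a *: x) z = a * dotp x z.
Proof. by rewrite /dotp mulr_sumr; apply: eq_bigr => i _; rewrite mxE mulrA. Qed.

Lemma dotp0r x : dotp x 0 = 0.
Proof. by apply: big1 => i _; rewrite mxE mulr0. Qed.

Lemma dotpDr x y z : dotp z (x + y) = dotp z x + dotp z y.
Proof. by rewrite dotpC dotpDl ![dotp _ z]dotpC. Qed.

Lemma dotpZr (a : R) x z : dotp z (a *: x) = a * dotp z x.
Proof. by rewrite dotpC dotpZl dotpC. Qed.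

Lemma dotp_eq0 x : dotp x x = 0 -> x = 0.
Proof.
move=> /eqP; rewrite psumr_eq0; last by move=> i _; rewrite -expr2 sqr_ge0.
move=> /allP x0; apply/rowP => i; rewrite mxE; apply/eqP.
by have := x0 i (mem_index_enum _); rewrite /= mulf_eq0 orbb.
Qed.

Lemma enorm0 : enorm (0 : 'rV[R]_n) = 0.
Proof. by rewrite enormE /dotp big1 ?sqrtr0// => i _; rewrite mxE mul0r. Qed.

Lemma enorm_eq0 x : enorm x = 0 -> x = 0.
Proof.
by move=> x0; apply: dotp_eq0; rewrite -sqr_enorm x0 expr0n.
Qed.

Lemma enorm_gt0 x : x != 0 -> 0 < enorm x.
Proof.
move=> x0; rewrite lt_neqAle enorm_ge0 andbT eq_sym.
by apply: contra x0 => /eqP/enorm_eq0/eqP.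
Qed.

Lemma enormZ (a : R) x : enorm (a *: x) = `|a| * enorm x.
Proof.
by rewrite !enormE dotpZl dotpZr mulrA -expr2 sqrtrM ?sqr_ge0// sqrtr_sqr.
Qed.

Lemma enormN x : enorm (- x) = enorm x.
Proof. by rewrite -scaleN1r enormZ normrN1 mul1r. Qed.

Lemma enormB x y : enorm (x - y) = enorm (y - x).
Proof. by rewrite -enormN opprB. Qed.

Lemma dotp_le x y : `|dotp x y| <= enorm x * enorm y.
Proof.
have AB : dotp x y ^+ 2 <= dotp x x * dotp y y.
  have [y0|y0] := eqVneq (dotp y y) 0.
    have -> : y = 0 by exact: dotp_eq0.
    by rewrite !dotp0r expr0n mulr0.
  have B0 : 0 < dotp y y by rewrite lt_neqAle eq_sym y0 dotpp_ge0.
  have := dotpp_ge0 (dotp y y *: x + (- dotp x y) *: y).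
  rewrite !(dotpDl, dotpDr, dotpZl, dotpZr) [dotp y x]dotpC.
  set A := dotp x x; set B := dotp y y; set P := dotp x y => H.
  rewrite -subr_ge0 -(pmulr_rge0 _ B0) -/B.
  by move: H; congr (_ <= _); ring.
rewrite -(@ler_pXn2r _ 2) ?nnegrE ?mulr_ge0 ?enorm_ge0 ?normr_ge0//.
by rewrite exprMn !sqr_enorm real_normK ?num_real.
Qed.

Lemma enormD x y : enorm (x + y) <= enorm x + enorm y.
Proof.
rewrite -(@ler_pXn2r _ 2) ?nnegrE ?addr_ge0 ?enorm_ge0//.
rewrite sqrrD !sqr_enorm dotpDl !dotpDr (dotpC y x).
have := ler_norm (dotp x y); have := dotp_le x y; lra.
Qed.

Lemma enorm_lb x y : enorm x - enorm y <= enorm (x + y).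
Proof. by have := enormD (x + y) (- y); rewrite addrK enormN; lra. Qed.

Lemma coord_le_enorm x i : `|x ord0 i| <= enorm x.
Proof.
rewrite -(@ler_pXn2r _ 2) ?nnegrE ?enorm_ge0//.
rewrite sqr_enorm real_normK ?num_real// /dotp (bigD1 i)//= -expr2 lerDl.
by apply: sumr_ge0 => j _; rewrite -expr2 sqr_ge0.
Qed.

Lemma enorm_le_sum x : enorm x <= \sum_(i < n) `|x ord0 i|.
Proof.
have H : 0 <= \sum_(i < n) `|x ord0 i| by apply: sumr_ge0.
rewrite -(@ler_pXn2r _ 2) ?nnegrE ?enorm_ge0//.
rewrite sqr_enorm expr2 mulr_suml; apply: ler_sum => i _.
apply: le_trans (ler_norm _) _; rewrite normrM ler_wpM2l//.
by rewrite (bigD1 i)//= lerDl; apply: sumr_ge0.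
Qed.

Lemma measurable_enorm : measurable_fun setT (@enorm R n).
Proof.
rewrite /enorm; apply: measurableT_comp;
  first exact: (continuous_measurable_fun (@sqrt_continuous R)).
apply: measurable_sum => i; apply: measurable_funX.
exact: measurable_rv_coord.
Qed.

Lemma measurable_affine (a : R) (b : 'rV[R]_n) :
  measurable_fun setT (fun x : 'rV[R]_n => a *: x + b).
Proof.
apply: measurable_fun_rowvec => i.
apply: (eq_measurable_fun (fun x : 'rV[R]_n => a * x ord0 i + b ord0 i)).
  by move=> x _; rewrite !mxE.
apply: measurable_funD; last exact: measurable_cst.
by apply: measurable_funM; [exact: measurable_cst|exact: measurable_rv_coord].
Qed.

End EuclideanNorm.

(** * Lebesgue measure under affine maps *)

Section LebesgueRV.
Context {R : realType}.

Lemma rv_consl n (c : R) (v : 'rV[R]_n) (j : 'I_1) :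
  rv_cons (c, v) ord0 (lshift n j) = c.
Proof. by rewrite /rv_cons (row_mxEl (const_mx c : 'rV[R]_1) v) mxE. Qed.

Lemma rv_consr n (c : R) (v : 'rV[R]_n) (j : 'I_n) :
  rv_cons (c, v) ord0 (rshift 1 j) = v ord0 j.
Proof. by rewrite /rv_cons (row_mxEr (const_mx c : 'rV[R]_1) v). Qed.

Lemma measurable_rv_cons n : measurable_fun setT (@rv_cons R n).
Proof.
apply: measurable_fun_rowvec => i.
case: (@split_ordP 1 n i) => j ->.
  apply: (eq_measurable_fun fst) => [p _|]; last exact: measurable_fst.
  by case: p => c v; rewrite rv_consl.
apply: (eq_measurable_fun (fun p => (snd p : 'rV[R]_n) ord0 j)) => [p _|].
  by case: p => c v; rewrite rv_consr.
apply: (measurableT_comp (measurable_rv_coord j)); exact: measurable_snd.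
Qed.

Local Open Scope ereal_scope.

(** The measure on R^(n+1) is the image under rv_cons of a product measure, so
    Tonelli's theorem splits off the first coordinate. *)
Lemma ge0_integral_rV_step n (f : 'rV[R]_n.+1 -> \bar R) :
  measurable_fun setT f -> (forall x, 0 <= f x) ->
  \int[lebesgue_rV n.+1]_x f x =
  \int[leb]_a \int[lebesgue_rV n]_v f (rv_cons (a, v)).
Proof.
move=> mf f0.
change (\int[pushforward (leb \x lebesgue_rV n) (@rv_cons R n)]_x f x =
  \int[leb]_a \int[lebesgue_rV n]_v f (rv_cons (a, v))).
rewrite (ge0_integral_pushforward (@measurable_rv_cons n))//.
rewrite preimage_setT.
rewrite (fubini_tonelli1 (f \o @rv_cons R n))//.
  by apply: measurableT_comp => //; exact: measurable_rv_cons.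
all: try by move=> *; exact: f0.
Qed.

Lemma measurable_affine1 (a b : R) :
  measurable_fun setT (fun x : measurableTypeR R => (a * x + b)%R).
Proof.
apply: measurable_funD; last exact: measurable_cst.
exact: mulrl_measurable.
Qed.

Lemma integral_oppr (f : R -> \bar R) :
  measurable_fun setT f -> (forall x, 0 <= f x) ->
  \int[leb]_x f (- x)%R = \int[leb]_x f x.
Proof.
move=> mf f0.
have mN : measurable_fun setT (-%R : measurableTypeR R -> measurableTypeR R) by [].
pose p := measure_function_pushforward__canonical__measure_function_Measure leb mN.
transitivity (\int[p]_x f x).
  by rewrite (ge0_integral_pushforward mN leb)// preimage_setT.
by apply: eq_measure_integral => A mA _; exact: lebesgue_measureN.
Qed.

(** Both sides integrate f against measures that agree on intervals. *)
Lemma ge0_integral_affine1 (a b : R) (f : R -> \bar R) : a != 0%R ->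
  measurable_fun setT f -> (forall x, 0 <= f x) ->
  (`|a|)%:E * \int[leb]_x f (a * x + b)%R = \int[leb]_x f x.
Proof.
wlog a0 : a f / (0 < a)%R => [H a0 mf f0|].
  have [|a0'] := ltP 0%R a; first by move=> *; exact: H.
  have aN : (0 < - a)%R by rewrite oppr_gt0 lt_neqAle a0.
  rewrite -(H (- a)%R f)// ?oppr_eq0// normrN; congr (_ * _).
  rewrite -(integral_oppr (f := fun x => f (- a * x + b)%R))//.
    by apply: eq_integral => x _ /=; rewrite mulrNN.
  by apply: measurableT_comp => //; exact: measurable_affine1.
move=> an mf f0.
have mphi : measurable_fun setT
  (fun x : measurableTypeR R => (a * x + b)%R : measurableTypeR R).
  exact: measurable_affine1.
pose p := measure_function_pushforward__canonical__measure_function_Measure leb mphi.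
have na : (0 <= `|a|)%R by [].
have E A : measurable A -> leb A = mscale (NngNum na) p A.
  apply: lebesgue_measure_unique => _ [[c d]] _ <-.
  change (leb [set` `]c, d]%R] = `|a|%:E * leb ((fun x : measurableTypeR R =>
    (a * x + b)%R : measurableTypeR R) @^-1` [set` `]c, d]%R])).
  have -> : (fun x : measurableTypeR R => (a * x + b)%R : measurableTypeR R) @^-1`
      [set` `]c, d]%R] = [set` `]((c - b) / a)%R, ((d - b) / a)%R]%R].
    apply/seteqP; split => x /=; rewrite !in_itv/= ltr_pdivrMr// ler_pdivlMr//;
    by rewrite (mulrC x) ltrBlDr lerBrDr.
  rewrite [LHS]lebesgue_measure_itv lebesgue_measure_itv/= !lte_fin.
  rewrite ltr_pM2r ?invr_gt0// ltrD2r.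
  case: ltP => _; last by rewrite mule0.
  rewrite -!EFinB -EFinM; congr EFin.
  by rewrite gtr0_norm// -mulrBl opprB addrA subrK mulrC divfK.
transitivity (\int[mscale (NngNum na) p]_x f x); last first.
  by apply/esym; apply: eq_measure_integral => A mA _; exact: E.
rewrite ge0_integral_mscale//; congr (_ * _).
change (\int[leb]_x f (a * x + b)%R = \int[pushforward leb
  (fun x : measurableTypeR R => (a * x + b)%R : measurableTypeR R)]_x f x).
by rewrite (ge0_integral_pushforward mphi leb)// preimage_setT.
Qed.

(** Tonelli reduces the dimension by one: an affine map with scalar linear
    part acts on each coordinate separately. *)
Lemma ge0_integral_affine n (a : R) (b : 'rV[R]_n) (f : 'rV[R]_n -> \bar R) :
  a != 0%R -> measurable_fun setT f -> (forall x, 0 <= f x) ->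
  (`|a| ^+ n)%:E * \int[lebesgue_rV n]_x f (a *: x + b)%R =
  \int[lebesgue_rV n]_x f x.
Proof.
move=> a0; elim: n b f => [|n IH] b f mf f0.
  rewrite expr0 mul1e; apply: eq_integral => x _; congr f.
  by rewrite !thinmx0.
have maff := measurable_affine a b.
rewrite ge0_integral_rV_step//; last exact: measurableT_comp.
pose b0 : R := b ord0 ord0; pose b1 : 'rV[R]_n := rsubmx (b : 'rV[R]_(1 + n)).
have E c (v : 'rV_n) : (a *: rv_cons (c, v) + b = rv_cons (a * c + b0, a *: v + b1))%R.
  apply/rowP => i; case: (@split_ordP 1 n i) => j ->.
    rewrite [LHS]mxE [X in (X + _)%R]mxE !rv_consl; congr (_ + b _ _)%R.
    by apply: val_inj; rewrite /= (ord1 j).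
  by rewrite [LHS]mxE [X in (X + _)%R]mxE !rv_consr !mxE.
have msec c : measurable_fun setT (fun v => f (rv_cons (c, v))).
  exact: (measurableT_comp mf
    (measurableT_comp (@measurable_rv_cons n) (pair1_measurable c))).
rewrite exprS (mulrC `|a|%R) EFinM -muleA.
under eq_integral do under eq_integral do rewrite E.
have step c : (`|a| ^+ n)%:E * \int[lebesgue_rV n]_v f (rv_cons (a * c + b0, a *: v + b1)%R)
    = \int[lebesgue_rV n]_v f (rv_cons (a * c + b0, v)%R).
  exact: (IH b1 (fun v => f (rv_cons (a * c + b0, v)%R))).
have mF : measurable_fun setT (fun c => \int[lebesgue_rV n]_v f (rv_cons (c, v))).
  apply: (measurable_fun_fubini_tonelli_F (f \o @rv_cons R n)).
    exact: (measurableT_comp mf (@measurable_rv_cons n)).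
  by move=> p; exact: f0.
have F0 c : 0 <= \int[lebesgue_rV n]_v f (rv_cons (c, v)).
  by apply: integral_ge0 => v _; exact: f0.
have H := ge0_integral_affine1 b0 a0 mF F0.
have an0 : (`|a| ^+ n != 0)%R by rewrite expf_neq0// normr_eq0.
have inner c : \int[lebesgue_rV n]_v f (rv_cons (a * c + b0, a *: v + b1)%R) =
    ((`|a| ^+ n)^-1)%:E * \int[lebesgue_rV n]_v f (rv_cons (a * c + b0, v)%R).
  by rewrite -step muleA -EFinM mulVf// mul1e.
under eq_integral do rewrite inner.
rewrite ge0_integralZl//.
- rewrite ge0_integral_rV_step// -H muleCA; congr (_ * _).
  by move: (integral _ _ _) => X; rewrite muleA -EFinM mulfV// mul1e.
- exact: (measurableT_comp mF (measurable_affine1 a b0)).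
Qed.

Lemma rV_translate n (b : 'rV[R]_n) (f : 'rV[R]_n -> \bar R) :
  measurable_fun setT f -> (forall x, 0 <= f x) ->
  \int[lebesgue_rV n]_x f (x + b)%R = \int[lebesgue_rV n]_x f x.
Proof.
move=> mf f0; rewrite -[RHS](@ge0_integral_affine n 1%R b)//.
rewrite normr1 expr1n mul1e.
by apply: eq_integral => x _; rewrite scale1r.
Qed.

Lemma rV_reflect n (b : 'rV[R]_n) (f : 'rV[R]_n -> \bar R) :
  measurable_fun setT f -> (forall x, 0 <= f x) ->
  \int[lebesgue_rV n]_x f (b - x)%R = \int[lebesgue_rV n]_x f x.
Proof.
move=> mf f0; rewrite -[RHS](@ge0_integral_affine n (-1)%R b)// ?oppr_eq0//.
rewrite normrN1 expr1n mul1e.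
by apply: eq_integral => x _; rewrite scaleN1r addrC.
Qed.

Lemma measurable_preimage_rV n (a : R) (b : 'rV[R]_n) (A : set 'rV[R]_n) :
  measurable A -> measurable [set x | A (a *: x + b)%R].
Proof.
by move=> mA; rewrite -[X in measurable X]setTI; exact: (measurable_affine a b).
Qed.

Lemma lebesgue_rV_affine n (a : R) (b : 'rV[R]_n) (A : set 'rV[R]_n) :
  a != 0%R -> measurable A ->
  (`|a| ^+ n)%:E * lebesgue_rV n [set x | A (a *: x + b)%R] = lebesgue_rV n A.
Proof.
move=> a0 mA.
have mB := measurable_preimage_rV a b mA.
have E B : measurable B -> lebesgue_rV n B = \int[lebesgue_rV n]_x (\1_B x : R)%:E.
  by move=> mB'; rewrite integral_indic// setIT.
rewrite (E _ mB) (E _ mA).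
apply: (@ge0_integral_affine n a b (fun x => (\1_A x : R)%:E) a0).
  exact/measurable_EFinP/measurable_indic.
by move=> x; rewrite lee_fin.
Qed.

Definition box n (c : 'rV[R]_n) (e : R) : set 'rV[R]_n :=
  [set x | forall i, `|x ord0 i - c ord0 i| <= e]%R.

Lemma measurable_box n (c : 'rV[R]_n) (e : R) : measurable (box c e).
Proof.
rewrite (_ : box c e = \bigcap_(i in [set: 'I_n])
  (fun x : 'rV[R]_n => x ord0 i) @^-1` [set` `[c ord0 i - e, c ord0 i + e]%R]).
  apply: fin_bigcap_measurable; first exact: finite_finset.
  by move=> i _; rewrite -[X in measurable X]setTI; exact: measurable_rv_coord.
apply/seteqP; split => x /=.
  by move=> xe i _ /=; rewrite in_itv/= -ler_distlC distrC.
by move=> xe i; have := xe i I; rewrite /= in_itv/= -ler_distlC distrC.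
Qed.

Lemma lebesgue_rV_box0 n : lebesgue_rV n (box 0%R 1%R) = ((2 ^+ n)%R : R)%:E.
Proof.
elim: n => [|n IH].
  rewrite expr0; change (@dirac _ 'rV[R]_0 0%R R (box 0%R 1%R) = 1%:E).
  by rewrite diracE mem_set// => -[].
change ((leb \x lebesgue_rV n) (@rv_cons R n @^-1` box 0%R 1%R) = ((2 ^+ n.+1)%R : R)%:E).
have -> : @rv_cons R n @^-1` box 0%R 1%R = [set` `[-1, 1]%R] `*` box 0%R 1%R.
  apply/seteqP; split => -[c v] /=.
    move=> H; split => /=.
      have := H (lshift n (ord0 : 'I_1)); rewrite rv_consl mxE subr0 ler_norml.
      by rewrite in_itv.
    by move=> i; have := H (rshift 1 i); rewrite rv_consr !mxE.
  move=> [/= c1 v1] i; case: (@split_ordP 1 n i) => j ->.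
    by rewrite rv_consl mxE subr0 ler_norml; rewrite in_itv/= in c1.
  by rewrite rv_consr; have := v1 j; rewrite !mxE.
rewrite product_measure1E//; last exact: measurable_box.
rewrite IH exprS EFinM; congr (_ * _).
change (leb [set` `[(-1)%R, 1%R]%R] = (2%:R : R)%:E).
rewrite lebesgue_measure_itv/= lte_fin gtrN//.
by rewrite -EFinB opprK.
Qed.

Lemma lebesgue_rV_box n (c : 'rV[R]_n) (e : R) : (0 < e)%R ->
  lebesgue_rV n (box c e) = ((2 * e) ^+ n)%:E.
Proof.
move=> e0; have mb := measurable_box (0%R : 'rV[R]_n) 1%R.
have := @lebesgue_rV_affine n e^-1 (- (e^-1 *: c))%R _ _ mb.
rewrite lebesgue_rV_box0 gtr0_norm ?invr_gt0// => /(_ _)/=.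
rewrite (_ : [set x | _] = box c e); last first.
  have E (x : 'rV[R]_n) i :
    ((e^-1 *: x - e^-1 *: c) ord0 i = e^-1 * (x ord0 i - c ord0 i))%R.
    by rewrite !mxE mulrBr.
  apply/seteqP; split => x /= H i; have := H i.
    by rewrite E !mxE subr0 normrM gtr0_norm ?invr_gt0// ler_pdivrMl// mulr1.
  by rewrite E !mxE subr0 normrM gtr0_norm ?invr_gt0// ler_pdivrMl// mulr1.
move=> H; rewrite exprMn mulrC EFinM -H ?gt_eqF ?invr_gt0//.
by rewrite muleA -EFinM -exprMn mulfV ?gt_eqF// expr1n mul1e.
Qed.

End LebesgueRV.

(** * Volumes of balls and cones *)

Section Radial.
Context {R : realType}.

Lemma root_expn n (s : R) : (0 < n)%N -> 0 <= s -> (s `^ n%:R^-1) ^+ n = s.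
Proof.
move=> n0 s0; rewrite -powR_mulrn ?powR_ge0// -powRrM mulVf ?pnatr_eq0 -?lt0n//.
by rewrite powRr1.
Qed.

Lemma expn_root n (s : R) : (0 < n)%N -> 0 <= s -> (s ^+ n) `^ n%:R^-1 = s.
Proof.
move=> n0 s0; rewrite -powR_mulrn// -powRrM mulfV ?pnatr_eq0 -?lt0n//.
by rewrite powRr1.
Qed.

Variable n : nat.
Implicit Types x : 'rV[R]_n.
Let V : R := ball_volume n.

(** The measure of the ball of radius |x|: as a function of nu x, a radial
    function on R^n has the same distribution as on the half line. *)
Definition nu x : R := ball_volume n * enorm x ^+ n.

Lemma measurable_enorm_le (r : R) : measurable [set x : 'rV[R]_n | enorm x <= r].
Proof.
rewrite (_ : mkset _ = @enorm R n @^-1` [set` `]-oo, r]%R]); last first.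
  by apply/seteqP; split => x /=; rewrite in_itv.
by rewrite -[X in measurable X]setTI; exact: measurable_enorm.
Qed.

Lemma lebesgue_rV_unit_ball :
  lebesgue_rV n [set x : 'rV[R]_n | enorm x <= 1] = V%:E.
Proof.
rewrite fineK// ge0_fin_numE//.
apply: (@le_lt_trans _ _ (lebesgue_rV n (box (0 : 'rV[R]_n) 1))).
  apply: le_measure; rewrite ?inE; [exact: measurable_enorm_le|exact: measurable_box|].
  move=> x /= x1 i; rewrite mxE subr0.
  exact: le_trans (coord_le_enorm x i) x1.
by rewrite lebesgue_rV_box// ltry.
Qed.

Lemma lebesgue_rV_gt0 (A : set 'rV[R]_n) (c : 'rV[R]_n) (e : R) :
  measurable A -> 0 < e -> box c e `<=` A -> (0 < lebesgue_rV n A)%E.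
Proof.
move=> mA e0 bA.
apply: (@lt_le_trans _ _ (lebesgue_rV n (box c e))).
  by rewrite lebesgue_rV_box// lte_fin exprn_gt0// mulr_gt0.
by apply: le_measure => //; rewrite inE//; exact: measurable_box.
Qed.

Lemma enorm_box (c : 'rV[R]_n) (e : R) x : box c e x -> enorm (x - c) <= n%:R * e.
Proof.
move=> xe; apply: le_trans (enorm_le_sum _) _.
rewrite mulr_natl -[X in _ *+ X]card_ord -sumr_const; apply: ler_sum => i _.
by rewrite !mxE; exact: xe.
Qed.

Lemma ball_volume_gt0 : 0 < V.
Proof.
rewrite -lte_fin -lebesgue_rV_unit_ball.
apply: (@lebesgue_rV_gt0 _ 0 (n.+1%:R^-1)) => //; first exact: measurable_enorm_le.
move=> x /enorm_box /=; rewrite subr0 => /le_trans; apply.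
by rewrite ler_pdivrMr// mul1r ler_nat.
Qed.

Lemma nu_ge0 x : 0 <= nu x.
Proof. by rewrite mulr_ge0 ?exprn_ge0 ?enorm_ge0// ltW// ball_volume_gt0. Qed.

Lemma nuZ (a : R) x : nu (a *: x) = `|a| ^+ n * nu x.
Proof. by rewrite /nu enormZ exprMn mulrCA. Qed.

Lemma nuN x : nu (- x) = nu x.
Proof. by rewrite /nu enormN. Qed.

Lemma measurable_nu : measurable_fun setT nu.
Proof.
apply: (measurableT_comp (mulrl_measurable (ball_volume n))).
by apply: measurable_funX; exact: measurable_enorm.
Qed.

Lemma measurable_nu_le (s : R) : measurable [set x | nu x <= s].
Proof.
rewrite (_ : mkset _ = nu @^-1` [set` `]-oo, s]%R]); last first.
  by apply/seteqP; split => x /=; rewrite in_itv.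
by rewrite -[X in measurable X]setTI; exact: measurable_nu.
Qed.

Hypothesis n0 : (0 < n)%N.

Lemma nu_gt0 x : x != 0 -> 0 < nu x.
Proof.
by move=> x0; rewrite mulr_gt0 ?exprn_gt0 ?enorm_gt0// ball_volume_gt0.
Qed.

Lemma nu_le_enorm x (r : R) : 0 <= r -> (nu x <= V * r ^+ n) = (enorm x <= r).
Proof.
by move=> r0; rewrite ler_pM2l ?ball_volume_gt0// ler_pXn2r ?nnegrE ?enorm_ge0.
Qed.

Lemma nu_root x : (nu x / V) `^ n%:R^-1 = enorm x.
Proof.
rewrite /nu mulrC mulrA mulVf ?mul1r ?expn_root ?enorm_ge0//.
by rewrite gt_eqF ?ball_volume_gt0.
Qed.

(** The dilation by the n-th root of s preserves Q and multiplies volumes by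
    s. *)
Lemma lebesgue_rV_cone (Q : set 'rV[R]_n) (s : R) : measurable Q ->
  (forall (a : R) x, 0 < a -> Q (a *: x) <-> Q x) -> 0 < s ->
  lebesgue_rV n (Q `&` [set x | nu x <= s]) =
  (s%:E * lebesgue_rV n (Q `&` [set x | (nu x <= 1)%R]))%E.
Proof.
move=> mQ hQ s0; pose a := s `^ n%:R^-1.
have a0 : 0 < a by rewrite powR_gt0.
have an : `|a| ^+ n = s by rewrite gtr0_norm// root_expn// ltW.
rewrite -(@lebesgue_rV_affine _ _ a 0 (Q `&` [set x | nu x <= s])); last 2 first.
- by rewrite gt_eqF.
- by apply: measurableI => //; exact: measurable_nu_le.
rewrite an; congr (_ * lebesgue_rV n _)%E.
apply/seteqP; split => x /=; rewrite addr0 hQ// nuZ an => -[Qx].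
  by rewrite -{2}(mulr1 s) ler_pM2l.
by rewrite -{2}(mulr1 s) ler_pM2l.
Qed.

Lemma lebesgue_rV_nu_gt0 (s : R) : 0 < s -> lebesgue_rV n [set x | nu x <= s] = s%:E.
Proof.
have V0 := ball_volume_gt0.
have E (r : R) : 0 < r -> lebesgue_rV n [set x | nu x <= r] =
    (r%:E * lebesgue_rV n [set x | (nu x <= 1)%R])%E.
  move=> r0; have := @lebesgue_rV_cone setT r measurableT _ r0.
  by rewrite !setTI; apply.
have := E V V0.
rewrite (_ : [set x | nu x <= V] = [set x | enorm x <= 1]); last first.
  by apply/seteqP; split => x /=; rewrite -(nu_le_enorm x ler01) expr1n mulr1.
rewrite lebesgue_rV_unit_ball => VE s0.
rewrite E// (_ : lebesgue_rV n [set x | nu x <= 1] = 1%E) ?mule1//.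
have /(congr1 (fun z => (V^-1)%:E * z)%E) := VE.
by rewrite muleA -!EFinM mulVf ?gt_eqF// mul1e => <-.
Qed.

Lemma lebesgue_rV_nu (s : R) : 0 <= s -> lebesgue_rV n [set x | nu x <= s] = s%:E.
Proof.
rewrite le_eqVlt => /predU1P[<-|]; last exact: lebesgue_rV_nu_gt0.
apply/eqP; rewrite eq_le measure_ge0 andbT; apply/lee_addgt0Pr => e e0.
rewrite add0e -(lebesgue_rV_nu_gt0 e0).
apply: le_measure; rewrite ?inE; try exact: measurable_nu_le.
by move=> x /= /le_trans; apply; exact: ltW.
Qed.

Lemma rV_point0 : [set 0 : 'rV[R]_n] = [set x | nu x <= 0].
Proof.
apply/seteqP; split => y /=; first by move=> ->; rewrite /nu enorm0 expr0n gtn_eqF// mulr0.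
by have [->//|y0] := eqVneq y 0; rewrite leNgt nu_gt0.
Qed.

Lemma rV_pointE x : [set x] = [set y | [set 0 : 'rV[R]_n] (1 *: y + - x)].
Proof.
apply/seteqP; split => y /=; rewrite scale1r; first by move=> ->; rewrite subrr.
by move/eqP; rewrite subr_eq0 => /eqP.
Qed.

Lemma measurable_rV_point x : measurable [set x].
Proof.
rewrite rV_pointE; apply: measurable_preimage_rV.
by rewrite rV_point0; exact: measurable_nu_le.
Qed.

Lemma lebesgue_rV_point x : lebesgue_rV n [set x] = 0%E.
Proof.
have := @lebesgue_rV_affine _ n 1 (- x) _ (oner_neq0 _) (measurable_rV_point 0).
by rewrite normr1 expr1n mul1e -rV_pointE => ->; rewrite rV_point0 lebesgue_rV_nu.
Qed.

End Radial.

(** * Layer cake formula and Hardy-Littlewood inequality *)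

Lemma lebesgue_0itv {R : realType} (s : R) : 0 <= s -> leb [set` `]0, s]%R] = s%:E.
Proof.
move=> s0; rewrite lebesgue_measure_itv/= lte_fin; case: ltP => [_|s1].
  by rewrite oppr0 adde0.
by congr EFin; apply: le_anti; rewrite s0 s1.
Qed.

Lemma le_leb {R : realType} (A B : set (measurableTypeR R)) :
  measurable A -> measurable B -> A `<=` B -> (leb A <= leb B)%E.
Proof. by move=> mA mB AB; apply: le_measure; rewrite ?inE. Qed.

Lemma indicMx {R : realType} (S : Type) (A B : set S) (x : S) :
  \1_A x * \1_B x = \1_(A `&` B) x :> R.
Proof. by rewrite indicI. Qed.

(** Continuity of the measure from below. *)
Lemma lt_measure_bigcup d (S : measurableType d) (R : realType)
  (mu : {measure set S -> \bar R}) (F : (set S)^nat) (a : \bar R) :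
  (forall m, measurable (F m)) -> nondecreasing_seq F ->
  (a < mu (\bigcup_m F m))%E -> exists m, (a < mu (F m))%E.
Proof.
move=> mF ndF aF; apply/not_existsP => H; move: aF; rewrite ltNge => /negP; apply.
have cF := @nondecreasing_cvg_mu _ _ _ mu F mF (bigcup_measurable (fun m _ => mF m)) ndF.
rewrite -(cvg_lim _ cF)//; apply: lime_le; first by apply/cvg_ex; eexists; exact: cF.
by apply: nearW => m; rewrite leNgt; apply/negP/H.
Qed.

Section LayerCake.
Local Open Scope ereal_scope.
Context d (S : measurableType d) (R : realType).
Variable mu : {sigma_finite_measure set S -> \bar R}.

(** Requiring 0 < l lets the layer cake formula integrate over all of R. *)
Definition level (F : S -> R) (l : R) : set S := [set x | 0 < l <= F x]%R.

Lemma measurable_subgraph (F : S -> R) : measurable_fun setT F ->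
  measurable [set p : S * measurableTypeR R | level F p.2 p.1].
Proof.
move=> mF.
have mF1 : measurable_fun setT (fun p : S * measurableTypeR R => F p.1).
  exact: measurableT_comp.
rewrite (_ : mkset _ =
  (@snd S (measurableTypeR R) @^-1` [set` `]0, +oo[%R]) `&`
  ((fun p : S * measurableTypeR R => F p.1 - p.2)%R @^-1` [set` `[0, +oo[%R])).
  apply: measurableI; rewrite -[X in measurable X]setTI.
    exact: measurable_snd.
  by apply: measurable_funB => //; exact: measurable_snd.
apply/seteqP; split => -[x l] /=; rewrite /level /= !in_itv/= !andbT subr_ge0.
  by move=> /andP[].
by move=> [-> ->].
Qed.

Lemma measurable_level (F : S -> R) l : measurable_fun setT F -> measurable (level F l).
Proof.
move=> mF; rewrite (_ : level F l = (fun x => (x, l : measurableTypeR R)) @^-1`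
   [set p : S * measurableTypeR R | level F p.2 p.1]) //.
rewrite -[X in measurable X]setTI; apply: pair2_measurable => //.
exact: measurable_subgraph.
Qed.

Lemma integral_level_itv (c : R) : (0 <= c)%R ->
  \int[leb]_l (\1_[set l : R | 0 < l <= c]%R l)%:E = c%:E.
Proof.
move=> c0; rewrite (_ : mkset _ = [set` `]0, c]%R]); last first.
  by apply/seteqP; split => l /=; rewrite in_itv.
by rewrite integral_indic// setIT; exact: lebesgue_0itv.
Qed.

Lemma measurable_layer (F : S -> R) (w : S -> \bar R) : measurable_fun setT F ->
  measurable_fun setT w -> (forall x, 0 <= w x) ->
  measurable_fun setT (fun l => \int[mu]_x ((\1_(level F l) x)%:E * w x)).
Proof.
move=> mF mw w0; apply: (measurable_fun_fubini_tonelli_G (m1 := mu)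
  (fun p : S * measurableTypeR R =>
    (\1_[set p : S * measurableTypeR R | level F p.2 p.1] p)%:E * w p.1)).
  apply: emeasurable_funM; last exact: (measurableT_comp mw measurable_fst).
  by apply/measurable_EFinP/measurable_indic; exact: measurable_subgraph.
by move=> p; rewrite mule_ge0// lee_fin.
Qed.

(** Tonelli's theorem on the region under the graph of F, weighted by w. *)
Lemma layer_cake (F : S -> R) (w : S -> \bar R) :
  measurable_fun setT F -> (forall x, 0 <= F x)%R ->
  measurable_fun setT w -> (forall x, 0 <= w x) ->
  \int[mu]_x ((F x)%:E * w x) =
  \int[leb]_l \int[mu]_x ((\1_(level F l) x)%:E * w x).
Proof.
move=> mF F0 mw w0.
pose h (p : S * measurableTypeR R) : \bar R :=
  (\1_[set p : S * measurableTypeR R | level F p.2 p.1] p)%:E * w p.1.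
have mh : measurable_fun setT h.
  apply: emeasurable_funM.
    by apply/measurable_EFinP/measurable_indic; exact: measurable_subgraph.
  exact: (measurableT_comp mw measurable_fst).
have h0 p : 0 <= h p by rewrite mule_ge0// lee_fin.
transitivity (\int[mu]_x \int[leb]_l h (x, l)).
  apply: eq_integral => x _.
  rewrite -{1}(integral_level_itv (F0 x)) -ge0_integralZr//.
  apply/measurable_EFinP/measurable_indic.
  have -> : [set l : R | 0 < l <= F x]%R = [set` `]0%R, F x]%R] :> set R.
    by apply/seteqP; split => l /=; rewrite in_itv.
  exact: measurable_itv.
by rewrite (fubini_tonelli h).
Qed.

End LayerCake.

Section Rearrangement1.
Local Open Scope ereal_scope.
Context {R : realType}.

(** Vanishing on s <= 0 turns integrals over the half line into integrals over
    R; no continuity and no value at the origin is prescribed. *)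
Definition decr0 (g : R -> R) : Prop :=
  [/\ forall s, (0 <= g s)%R, forall s, (s <= 0)%R -> g s = 0%R &
      forall s t, (0 < s)%R -> (s <= t)%R -> (g t <= g s)%R].

Lemma lower_set_itv (I : set R) :
  (forall s t, I t -> 0 < s -> s <= t -> I s)%R -> (forall s, I s -> 0 < s)%R ->
  is_interval I.
Proof.
move=> Il I0 s t Is It u /andP[su ut]; apply: (Il _ t) => //.
exact: lt_le_trans (I0 _ Is) su.
Qed.

Lemma decr0_level (g : R -> R) l : decr0 g ->
  [/\ forall s t, level g l t -> (0 < s)%R -> (s <= t)%R -> level g l s,
      forall s, level g l s -> (0 < s)%R & measurable (level g l : set (measurableTypeR R))].
Proof.
move=> [g0 gN gd].
have A s t : level g l t -> (0 < s)%R -> (s <= t)%R -> level g l s.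
  by move=> /andP[l0 lt] s0 st; apply/andP; split=> //; exact: le_trans lt (gd _ _ s0 st).
have B s : level g l s -> (0 < s)%R.
  move=> /andP[l0 ls]; rewrite ltNge; apply/negP => s0.
  by move: (lt_le_trans l0 ls); rewrite gN// ltxx.
split=> //; apply: is_interval_measurable; exact: lower_set_itv.
Qed.

Lemma decr0_measurable (g : R -> R) : decr0 g ->
  measurable_fun setT (g : measurableTypeR R -> measurableTypeR R).
Proof.
move=> gD; apply: (measurability (@RGenCInfty.G R)).
  exact: RGenCInfty.measurableE.
move=> /= _ [_] [r] -> <-; rewrite setTI.
have [r0|r0] := ltP 0%R r.
  rewrite (_ : _ @^-1` _ = level g r); first by case: (decr0_level r gD).
  by apply/seteqP; split => s /=; rewrite in_itv/= andbT /level/= r0.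
case: gD => g0 _ _.
rewrite (_ : _ @^-1` _ = setT)//.
by apply/seteqP; split => s //= _; rewrite in_itv/= andbT (le_trans r0).
Qed.

(** A downward closed set of positive reals contains an interval from 0 to
    each of its points. *)
Lemma lower_set_ge (I : set (measurableTypeR R)) (a : \bar R) : measurable I ->
  (forall s t, I t -> 0 < s -> s <= t -> I s)%R ->
  (forall s : R, (0 < s)%R -> ~ I s -> a <= s%:E) -> a <= leb I.
Proof.
move=> mI Il Ia; rewrite leNgt; apply/negP => Ilt.
have [s [Is sa]] : exists s : R, leb I < s%:E /\ s%:E < a.
  have Ifin : leb I \is a fin_num.
    by rewrite ge0_fin_numE ?measure_ge0//; exact: lt_le_trans Ilt (leey _).
  move: Ilt; rewrite -(fineK Ifin); move: (fine _) => r.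
  case: a {Ia} => // [b rb|_].
    exists ((r + b) / 2)%R; move: rb; rewrite !lte_fin => rb.
    by rewrite !midf_lt.
  by exists (r + 1)%R; rewrite ltry lte_fin ltrDl.
have s0 : (0 < s)%R by rewrite -lte_fin; exact: le_lt_trans (measure_ge0 _ _) Is.
have [HI|/(Ia _ s0)] := pselect (I s); last by rewrite leNgt sa.
suff : s%:E <= leb I by rewrite leNgt Is.
rewrite -(lebesgue_0itv (ltW s0)); apply: le_measure; rewrite ?inE//.
by move=> t /=; rewrite in_itv/= => /andP[t0 ts]; exact: Il HI t0 ts.
Qed.

(** Levels of g are intervals starting at 0, so the measure of a level is
    bounded once all of its points are; integrating this over the levels, by
    the layer cake formula on both sides, gives the claim. *)
Lemma layer_cake_ge d (S : measurableType d)
  (mu : {sigma_finite_measure set S -> \bar R}) (F : S -> R) (w : S -> \bar R)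
  (g : R -> R) (C : R) :
  measurable_fun setT F -> (forall x, 0 <= F x)%R ->
  measurable_fun setT w -> (forall x, 0 <= w x) ->
  decr0 g -> (0 <= C)%R ->
  (forall s l : R, (0 < s)%R -> (0 < l <= g s)%R ->
    s%:E <= C%:E * \int[mu]_x ((\1_(level F l) x)%:E * w x)) ->
  \int[leb]_s (g s)%:E <= C%:E * \int[mu]_x ((F x)%:E * w x).
Proof.
move=> mF F0 mw w0 gD C0 H.
have mg := decr0_measurable gD; have [g0 gN gd] := gD.
rewrite layer_cake//.
rewrite (_ : \int[leb]_s (g s)%:E = \int[leb]_s ((g s)%:E * 1)); last first.
  by apply: eq_integral => s _; rewrite mule1.
rewrite (layer_cake leb (F := g) (w := cst 1))//.
pose J l := \int[mu]_x ((\1_(level F l) x)%:E * w x).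
have J0 l : 0 <= J l by apply: integral_ge0 => x _; rewrite mule_ge0// lee_fin.
have mJ : measurable_fun setT J.
  exact: measurable_layer.
rewrite -(ge0_integralZl_EFin _ measurableT)//.
apply: ge0_le_integral => //.
- by move=> l _; apply: integral_ge0 => s _; rewrite mule1 lee_fin.
- exact: (measurable_layer leb mg (measurable_cst 1)).
- by apply: emeasurable_funM.
move=> l _.
have [Il I0 mI] := decr0_level l gD.
under eq_integral do rewrite mule1.
rewrite integral_indic// setIT.
have [fin|] := ltP (C%:E * J l) +oo; last by rewrite leye_eq => /eqP ->; rewrite leey.
have Jge : 0 <= C%:E * J l by rewrite mule_ge0// lee_fin.
have Cfin : C%:E * J l \is a fin_num by rewrite ge0_fin_numE.
rewrite -(fineK Cfin) -[leRHS]lebesgue_0itv ?fine_ge0//.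
apply: (le_leb mI) => // s /= ls.
rewrite in_itv/= (I0 _ ls)/= -lee_fin fineK//.
by apply: H => //; exact: I0 ls.
by move=> l _; exact: J0.
Qed.

End Rearrangement1.

Section HardyLittlewood.
Local Open Scope ereal_scope.
Context {R : realType}.
Variable n : nat.
Hypothesis n0 : (0 < n)%N.

(** The layer cake formula in both factors leaves products of indicators to
    compare. On R^n these are a ball in the variable nu and a level set of f,
    whose intersection is at most as large as the smaller of the two; on the
    half line they are intervals with a common endpoint, whose intersection is
    exactly the smaller one. *)
Lemma hardy_littlewood (g sig : R -> R) (f : 'rV[R]_n -> R) :
  decr0 g -> decr0 sig -> measurable_fun setT f -> (forall x, 0 <= f x)%R ->
  (forall s l : R, (0 < s)%R -> (sig s < l)%R ->
     lebesgue_rV n [set x | l < f x]%R <= s%:E) ->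
  \int[lebesgue_rV n]_x (g (nu x) * f x)%:E <= \int[leb]_s (g s * sig s)%:E.
Proof.
move=> gD sD mf f0 H.
have mg := decr0_measurable gD; have ms := decr0_measurable sD.
have [g0 gN gd] := gD; have [s0 sN sd] := sD.
have mgn : measurable_fun setT (fun x : 'rV[R]_n => g (nu x)).
  exact: (measurableT_comp mg (@measurable_nu R n)).
under eq_integral do rewrite EFinM.
under [X in _ <= X]eq_integral do rewrite EFinM.
rewrite (layer_cake (lebesgue_rV n) (F := fun x => g (nu x)) (w := EFin \o f))//;
  last exact/measurable_EFinP.
rewrite (layer_cake leb (F := g) (w := EFin \o sig))//; last exact/measurable_EFinP.
apply: ge0_le_integral => //.
- by move=> l _; apply: integral_ge0 => x _; rewrite mule_ge0// lee_fin.
- by apply: measurable_layer => //; exact/measurable_EFinP.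
- by apply: measurable_layer => //; exact/measurable_EFinP.
move=> l _.
have mB := measurable_level l mgn; have [Il I0 mI] := decr0_level l gD.
under eq_integral do rewrite muleC.
under [X in _ <= X]eq_integral do rewrite muleC.
rewrite (layer_cake (lebesgue_rV n) (F := f)
  (w := fun x => (\1_(level (fun x : 'rV[R]_n => g (nu x)) l) x)%:E))//;
  last exact/measurable_EFinP/measurable_indic.
rewrite (layer_cake leb (F := sig) (w := fun x => (\1_(level g l) x)%:E))//;
  last exact/measurable_EFinP/measurable_indic.
apply: ge0_le_integral => //.
- by move=> m _; apply: integral_ge0 => x _; rewrite mule_ge0// lee_fin.
- by apply: measurable_layer => //; exact/measurable_EFinP/measurable_indic.
- by apply: measurable_layer => //; exact/measurable_EFinP/measurable_indic.
move=> m _.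
have [Jl J0 mJ] := decr0_level m sD; have mA := measurable_level m mf.
under eq_integral do rewrite -EFinM indicMx.
under [X in _ <= X]eq_integral do rewrite -EFinM indicMx.
rewrite !integral_indic ?setIT//; [|exact: measurableI..].
have [m0|m0] := ltP 0%R m; last first.
  rewrite (_ : level f m = set0) ?set0I ?measure0//.
  by apply/seteqP; split => x //= /andP[]; rewrite ltNge m0.
have [l0|l0] := ltP 0%R l; last first.
  rewrite (_ : level _ l = set0) ?setI0 ?measure0//.
  by apply/seteqP; split => x //= /andP[]; rewrite ltNge l0.
apply: lower_set_ge; first exact: measurableI.
  by move=> s t [Js Is] sp st; split; [exact: Jl Js sp st|exact: Il Is sp st].
move=> s sp /not_andP[sJ|sI].
  have sm : (sig s < m)%R by rewrite ltNge; apply/negP => h; apply: sJ; rewrite /level /= m0.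
  have mlt : ((sig s + m) / 2 < m)%R by rewrite midf_lt.
  have slt : (sig s < (sig s + m) / 2)%R by rewrite midf_lt.
  apply: le_trans (H s _ sp slt); apply: le_measure; rewrite ?inE.
  - exact: measurableI.
  - rewrite (_ : mkset _ = f @^-1` [set` `](sig s + m) / 2, +oo[%R]); last first.
      by apply/seteqP; split => x /=; rewrite in_itv/= andbT.
    by rewrite -[X in measurable X]setTI; exact: mf.
  - by move=> x [/andP[_ mx] _] /=; exact: lt_le_trans mlt mx.
rewrite -(lebesgue_rV_nu n0 (ltW sp)); apply: le_measure; rewrite ?inE.
- exact: measurableI.
- exact: measurable_nu_le.
move=> x [_ /andP[_ lx]] /=; rewrite leNgt; apply/negP => sx.
by apply: sI; rewrite /level/= l0/=; apply: le_trans lx (gd _ _ sp (ltW sx)).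
Qed.

End HardyLittlewood.

(** * Decreasing rearrangement *)

Section RearrangementTheory.
Local Open Scope ereal_scope.
Context d (S : measurableType d) (R : realType).
Variables (mu : {measure set S -> \bar R}) (D : set S).
Hypothesis mD : measurable D.
Implicit Types f g : S -> \bar R.

Let df := distribution_function mu D.
Let fs := rearrangement mu D.

Lemma measurable_superlevel f (l : R) : measurable_fun D f ->
  measurable (D `&` [set x | l%:E < f x]).
Proof.
move=> mf; rewrite (_ : [set x | l%:E < f x] = f @^-1` [set` `]l%:E, +oo[%O]).
  by apply: mf => //; exact: emeasurable_itv.
by apply/seteqP; split => x /=; rewrite in_itv/= andbT.
Qed.

Lemma distribution_le f (l m : R) : measurable_fun D f -> (l <= m)%R ->
  df f m <= df f l.
Proof.
move=> mf lm; apply: le_measure; rewrite ?inE; try exact: measurable_superlevel.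
by move=> x [Dx] /= mx; split => //=; apply: le_lt_trans mx; rewrite lee_fin.
Qed.

Lemma rearr_ge0 f t : 0 <= fs f t.
Proof. by apply: le_ereal_inf_tmp => _ [l [l0 _] <-]; rewrite lee_fin. Qed.

Lemma rearr_le f (t l : R) : (0 <= l)%R -> df f l <= t%:E -> fs f t <= l%:E.
Proof. by move=> l0 lt; apply: ereal_inf_lbound; exists l. Qed.

Lemma rearr_lt f (t l : R) : measurable_fun D f -> fs f t < l%:E -> df f l <= t%:E.
Proof.
move=> mf /ereal_inf_lt[_ [m [m0 mt] <-]]; rewrite lte_fin => ml.
exact: le_trans (distribution_le mf (ltW ml)) mt.
Qed.

Lemma rearr_ge f (s l : R) : measurable_fun D f -> s%:E < df f l -> l%:E <= fs f s.
Proof.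
move=> mf sl; rewrite leNgt; apply/negP => /(rearr_lt mf).
by rewrite leNgt sl.
Qed.

(** The distribution function is right continuous, by continuity of the
    measure from below. *)
Lemma rearr_gt f (s l : R) : measurable_fun D f -> s%:E < df f l -> l%:E < fs f s.
Proof.
move=> mf sl.
pose F (m : nat) := D `&` [set x | (l + m.+1%:R^-1)%:E < f x].
have mF m : measurable (F m) by exact: measurable_superlevel.
have FE : \bigcup_m F m = D `&` [set x | l%:E < f x].
  apply/seteqP; split => x.
    by move=> [m _ [Dx mx]]; split => //=; apply: le_lt_trans mx; rewrite lee_fin lerDl.
  move=> [Dx] /= lx.
  have [m mx] : exists m : nat, (l + m.+1%:R^-1)%:E < f x.
    case: (f x) lx => // [r|_]; last by exists 0%N; rewrite ltry.
    rewrite lte_fin => lr.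
    have [m] := @ltr_add_invr R _ _ lr.
    by exists m; rewrite lte_fin.
  by exists m.
have ndF : nondecreasing_seq F.
  move=> m k mk; apply/subsetPset => x [Dx] /= mx; split => //=.
  apply: le_lt_trans mx; rewrite lee_fin lerD2l lef_pV2 ?posrE//.
  by rewrite ler_nat ltnS.
have [m] : exists m, s%:E < mu (F m).
  by apply: lt_measure_bigcup => //; rewrite FE.
move=> /(@rearr_ge f s (l + m.+1%:R^-1) mf); apply: lt_le_trans.
by rewrite lte_fin ltrDl.
Qed.

Lemma rearr_nonincr f (s t : R) : (s <= t)%R -> fs f t <= fs f s.
Proof.
move=> st; apply: ereal_inf_le_tmp => _ [l [l0 ls] <-]; exists l => //; split => //.
by apply: le_trans ls _; rewrite lee_fin.
Qed.

End RearrangementTheory.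

Section HalfLine.
Local Open Scope ereal_scope.
Context {R : realType}.

Lemma measurable_Rplus : measurable (@Rplus R).
Proof. exact: measurable_itv. Qed.

Lemma RplusP (t : R) : Rplus t <-> (0 < t)%R.
Proof. by rewrite /Rplus /= in_itv/= andbT. Qed.

Lemma enonincreasing_measurable (D : set (measurableTypeR R)) (h : R -> \bar R) :
  measurable D ->
  (forall s t, (s <= t)%R -> h t <= h s) -> measurable_fun D h.
Proof.
move=> mD hd; apply: (measurability (@ErealGenCInfty.G R)).
  exact: ErealGenCInfty.measurableE.
move=> /= _ [_] [r] -> <-; apply: measurableI => //.
apply: is_interval_measurable => s t /=; rewrite !in_itv/= !andbT => _ rt u /andP[_ ut].
by rewrite in_itv/= andbT (le_trans rt)// hd.
Qed.

Lemma Mplus_rearr d (S : measurableType d) (mu : {measure set S -> \bar R})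
  (D : set S) f : Mplus Rplus (rearrangement mu D f).
Proof.
split; last by move=> x _; exact: rearr_ge0.
apply: enonincreasing_measurable; first exact: measurable_Rplus.
by move=> s t; exact: rearr_nonincr.
Qed.

Lemma Mplus_decr0 (g : R -> R) : decr0 g -> Mplus Rplus (EFin \o g).
Proof.
move=> gD; split; last by move=> x _; rewrite /= lee_fin; case: gD.
apply: measurable_funTS; apply/measurable_EFinP; exact: decr0_measurable.
Qed.

Lemma rearr_decr0_le (g : R -> R) (t : R) : decr0 g -> (0 < t)%R ->
  rearr_Rplus (EFin \o g) t <= (g t)%:E.
Proof.
move=> [g0 gN gd] t0; apply: rearr_le => //.
rewrite -(lebesgue_0itv (ltW t0)); apply: le_leb => //.
  apply: measurable_superlevel; first exact: measurable_Rplus.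
  by case: (Mplus_decr0 (And3 g0 gN gd)).
move=> s [/RplusP s0] /=; rewrite lte_fin => gts.
rewrite in_itv/= s0/= leNgt; apply/negP => ts.
by move: gts; rewrite ltNge gd// ltW.
Qed.

(** A nonincreasing function need not be right continuous, so it may exceed
    its rearrangement at its jumps; halving the argument absorbs this. *)
Lemma rearr_decr0_ge (g : R -> R) (t : R) : decr0 g -> (0 < t)%R ->
  (g (2 * t))%:E <= rearr_Rplus (EFin \o g) t.
Proof.
move=> [g0 gN gd] t0; apply: le_ereal_inf_tmp => _ [l [l0 lt] <-].
rewrite lee_fin leNgt; apply/negP => lg.
have t2 : (0 <= 2 * t)%R by rewrite mulr_ge0// ltW.
suff : (2 * t)%:E <= t%:E by rewrite lee_fin -subr_ge0; lra.
apply: le_trans lt; rewrite -[leLHS]lebesgue_0itv//; apply: le_leb => //.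
  apply: measurable_superlevel; first exact: measurable_Rplus.
  by case: (Mplus_decr0 (And3 g0 gN gd)).
move=> s /=; rewrite in_itv/= => /andP[s0 st]; split; first exact/RplusP.
by rewrite /= lte_fin (lt_le_trans lg)// gd.
Qed.

Lemma integral_Rplus (h : R -> R) : (forall s, (s <= 0)%R -> h s = 0%R) ->
  \int[leb]_(s in Rplus) (h s)%:E = \int[leb]_s (h s)%:E.
Proof.
move=> hN; rewrite [LHS]integral_mkcond; apply: eq_integral => s _.
rewrite patchE; case: ifPn => // /negP sR; rewrite hN// leNgt; apply/negP => s0.
by apply: sR; rewrite inE; exact/RplusP.
Qed.

End HalfLine.

Section FunctionNormTheory.
Local Open Scope ereal_scope.
Context d (S : measurableType d) (R : realType).
Variables (mu : {measure set S -> \bar R}) (D : set S) (rho : function_norm mu D).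

Lemma fnorm_mono f g : Mplus D f -> Mplus D g ->
  (forall x, D x -> g x <= f x) -> rho g <= rho f.
Proof. by move=> Mf Mg fg; apply: fnorm_le => //; exact: aeW. Qed.

Lemma fnorm_eq f g : Mplus D f -> Mplus D g ->
  (forall x, D x -> g x = f x) -> rho g = rho f.
Proof.
move=> Mf Mg fg; apply/eqP; rewrite eq_le; apply/andP; split.
  by apply: fnorm_mono => // x Dx; rewrite fg.
by apply: fnorm_mono => // x Dx; rewrite fg.
Qed.

Lemma fnorm_fin f : Mplus D f -> rho f < +oo -> rho f \is a fin_num.
Proof. by move=> Mf f1; rewrite ge0_fin_numE ?fnorm_ge0. Qed.

End FunctionNormTheory.

Section RplusSpace.
Local Open Scope ereal_scope.
Context {R : realType}.
Variable Et : ri_space_Rplus R.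

(** Functions of finite norm are locally integrable, whereas an infinite value
    of a nonincreasing function would spread over an interval. *)
Lemma fnorm_nonincr_lty (h : R -> \bar R) (s : R) :
  Mplus Rplus h -> (forall s t, (s <= t)%R -> h t <= h s) ->
  Et h < +oo -> (0 < s)%R -> h s < +oo.
Proof.
move=> [mh h0] hd hfin s0; rewrite ltey; apply/eqP => hs.
have mA : measurable [set` `]0%R, s]%R] by exact: measurable_itv.
have AR : [set` `]0%R, s]%R] `<=` @Rplus R.
  by move=> t /=; rewrite in_itv/= => /andP[t0 _]; exact/RplusP.
have Afin : leb [set` `]0%R, s]%R] < +oo by rewrite lebesgue_0itv ?ltry// ltW.
have [C C0 HC] := fnorm_integral Et mA AR Afin.
have := HC h (conj mh h0); rewrite leNgt => /negP; apply.
have -> : \int[leb]_(x in [set` `]0%R, s]%R]) h x = +oo.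
  transitivity (\int[leb]_(x in [set` `]0%R, s]%R]) cst +oo x).
    apply: eq_integral => t; rewrite inE/= in_itv/= => /andP[_ ts].
    by apply/eqP; rewrite -leye_eq -hs hd.
  rewrite integral_cst//.
  change (+oo * leb [set` `]0%R, s]%R] = +oo); rewrite lebesgue_0itv ?ltW//.
  by rewrite gt0_mulye// lte_fin.
by rewrite lte_mul_pinfty// lee_fin ltW.
Qed.

(** The associate norm pairs rearrangements; a dilation by 2 makes them
    dominate the functions themselves, whichever values those take at their
    jumps. *)
Lemma associate_norm_ge (h sig : R -> R) (M : R) : decr0 h -> decr0 sig ->
  (0 < M)%R -> Et (EFin \o sig) <= M%:E ->
  \int[leb]_s (h s * sig s)%:E <= (2 * M)%:E * associate_norm Et (EFin \o h).
Proof.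
move=> hD sD M0 sM.
have [h0 hN hd] := hD; have [s0 sN sd] := sD.
have mh := decr0_measurable hD; have ms := decr0_measurable sD.
pose tau s := (M^-1 * sig s)%R.
have tD : decr0 tau.
  split=> [s|s s1|s t sp st]; rewrite /tau.
  - by rewrite mulr_ge0// invr_ge0 ltW.
  - by rewrite sN// mulr0.
  - by rewrite ler_pM2l ?invr_gt0// sd.
have mt := decr0_measurable tD.
have tE : Et (EFin \o tau) <= 1.
  rewrite (_ : EFin \o tau = fun x => (M^-1)%:E * (EFin \o sig) x)//.
  rewrite fnormZ ?invr_ge0 ?(ltW M0)//; last exact: Mplus_decr0.
  apply: (@le_trans _ _ ((M^-1)%:E * M%:E)).
    by apply: lee_wpmul2l => //; rewrite lee_fin invr_ge0 ltW.
  by rewrite -EFinM mulVf// gt_eqF.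
have step : \int[leb]_t (h (2 * t) * tau (2 * t))%:E <= associate_norm Et (EFin \o h).
  apply: (@le_trans _ _ (\int[leb]_(t in Rplus)
    (rearr_Rplus (EFin \o h) t * rearr_Rplus (EFin \o tau) t))); last first.
    apply: ereal_sup_ubound; exists (EFin \o tau) => //; split => //.
    exact: Mplus_decr0.
  rewrite -integral_Rplus; last first.
    by move=> s s1; rewrite hN ?mul0r// pmulr_rle0.
  apply: ge0_le_integral => //.
  - exact: measurable_Rplus.
  - by move=> t _; rewrite lee_fin mulr_ge0//; case: tD.
  - apply: measurable_funTS; apply/measurable_EFinP; apply: measurable_funM.
      exact: (measurableT_comp mh (mulrl_measurable 2)).
    exact: (measurableT_comp mt (mulrl_measurable 2)).
  - by apply: emeasurable_funM; case: (@Mplus_rearr R _ _ leb Rplus (EFin \o h));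
      case: (@Mplus_rearr R _ _ leb Rplus (EFin \o tau)).
  move=> t /RplusP t0; rewrite EFinM; apply: lee_pmul.
  - by rewrite lee_fin.
  - by rewrite lee_fin; case: tD.
  - exact: rearr_decr0_ge.
  - exact: rearr_decr0_ge.
have := @ge0_integral_affine1 R 2 0 (fun s => (h s * tau s)%:E).
rewrite pnatr_eq0/= => /(_ isT) H.
have E : \int[leb]_s (h s * tau s)%:E = 2%:E * \int[leb]_t (h (2 * t) * tau (2 * t))%:E.
  rewrite -H; first last.
  - by move=> s; rewrite lee_fin mulr_ge0//; case: tD.
  - apply/measurable_EFinP; exact: measurable_funM.
  rewrite ger0_norm//; congr (_ * _).
  by apply: eq_integral => s _; rewrite addr0.
have -> : \int[leb]_s (h s * sig s)%:E = M%:E * \int[leb]_s (h s * tau s)%:E.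
  rewrite -ge0_integralZl_EFin ?(ltW M0)//.
  - apply: eq_integral => s _; rewrite /tau -EFinM; congr EFin.
    by rewrite [RHS]mulrCA mulVKf// gt_eqF.
  - by move=> s _; rewrite lee_fin mulr_ge0//; case: tD.
  - apply/measurable_EFinP; exact: measurable_funM.
rewrite E muleA -EFinM (mulrC M); apply: lee_wpmul2l => //.
by rewrite lee_fin mulr_ge0// ltW.
Qed.

End RplusSpace.

(** * Nonincreasing competitors for the associate norm *)

Section AssociateNorm.
Local Open Scope ereal_scope.
Context {R : realType}.
Variable Et : ri_space_Rplus R.

Lemma lee_real_below (x y : \bar R) : 0 <= y ->
  (forall l : R, (0 <= l)%R -> l%:E < x -> l%:E <= y) -> x <= y.
Proof.
move=> y0 H; rewrite leNgt; apply/negP => yx.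
have yfin : y \is a fin_num by rewrite ge0_fin_numE//; exact: lt_le_trans yx (leey _).
have yr0 : (0 <= fine y)%R by rewrite fine_ge0.
case: x H yx => [r| |] H; last 2 first.
- have := H (fine y + 1)%R; rewrite ltry addr_ge0// => /(_ isT isT).
  by rewrite -{2}(fineK yfin) lee_fin gerDl ler10.
- by rewrite ltNge leNye.
rewrite -(fineK yfin) lte_fin => yr.
have /andP[ym mr] : (fine y < (fine y + r) / 2 < r)%R by rewrite !midf_lt.
have m0 : (0 <= (fine y + r) / 2)%R by rewrite ltW// (le_lt_trans yr0).
have := H _ m0; rewrite lte_fin mr => /(_ isT).
by rewrite -(fineK yfin) lee_fin leNgt ym.
Qed.

(** Cutting off both values and support makes all distribution functions
    finite, without which a function and its rearrangement need not be
    equimeasurable. *)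
Definition truncation (f : R -> \bar R) (m : nat) : R -> \bar R :=
  (fun x => Order.min (f x) m%:R%:E) \_ [set` `]0%R, m%:R]%R].

Lemma truncation_lt (f : R -> \bar R) (m : nat) (l x : R) : (0 <= l)%R ->
  (l%:E < truncation f m x) <->
  [/\ (0 < x)%R, (x <= m%:R)%R, l%:E < f x & (l < m%:R)%R].
Proof.
move=> l0; rewrite /truncation patchE; case: ifPn.
  rewrite inE/= in_itv/= => /andP[-> ->]; rewrite lt_min lte_fin.
  by split => [/andP[]//|[_ _ -> ->]].
move=> xm; split => [|[x0 xm']]; first by rewrite lte_fin ltNge l0.
by move: xm; rewrite notin_setE/= in_itv/= x0 xm'.
Qed.

Lemma truncation_ge0 (f : R -> \bar R) m x : Mplus Rplus f -> 0 <= truncation f m x.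
Proof.
move=> [_ f0]; rewrite /truncation patchE; case: ifPn => //.
rewrite inE/= in_itv/= => /andP[x0 _]; have xR : Rplus x by exact/RplusP.
by rewrite le_min; apply/andP; split; [exact: f0|rewrite lee_fin].
Qed.

Lemma truncation_le (f : R -> \bar R) m x : Mplus Rplus f -> Rplus x ->
  truncation f m x <= f x.
Proof.
move=> [_ f0] x0; rewrite /truncation patchE; case: ifPn => _; last exact: f0.
by rewrite ge_min lexx.
Qed.

Lemma truncation_le_nat (f : R -> \bar R) m x : truncation f m x <= m%:R%:E.
Proof.
rewrite /truncation patchE; case: ifPn => _; last by rewrite lee_fin.
by rewrite ge_min lexx orbT.
Qed.

Lemma Mplus_truncation (f : R -> \bar R) m : Mplus Rplus f ->
  Mplus Rplus (truncation f m).
Proof.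
move=> Mf; split => [|x _]; last exact: truncation_ge0.
have mI : measurable ([set` `]0%R, m%:R]%R] : set (measurableTypeR R)).
  exact: measurable_itv.
apply: measurable_funTS; apply/(measurable_restrictT _ mI).
apply: (@measurable_funS _ _ _ _ (@Rplus R)); first exact: measurable_Rplus.
  by move=> x /=; rewrite in_itv/= => /andP[x0 _]; exact/RplusP.
by apply: measurable_mine => //; case: Mf.
Qed.

Lemma truncation_distribution (f : R -> \bar R) (s l : R) :
  Mplus Rplus f -> (0 <= l)%R ->
  s%:E < distribution_function leb Rplus f l ->
  exists m, s%:E < distribution_function leb Rplus (truncation f m) l.
Proof.
move=> Mf l0 sl.
pose F (m : nat) := Rplus `&` [set x | l%:E < truncation f m x].
have mF m : measurable (F m).
  apply: measurable_superlevel; first exact: measurable_Rplus.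
  by case: (Mplus_truncation m Mf).
have FE : \bigcup_m F m = Rplus `&` [set x | l%:E < f x].
  apply/seteqP; split => x.
    by move=> [m _ [Dx /=]] /(truncation_lt _ _ _ l0)[].
  move=> [Dx] /= lx; pose M := Num.max x (l + 1)%R.
  have Mm : (M <= (Num.truncn M).+1%:R)%R.
    by rewrite ltW// truncnS_gt.
  exists (Num.truncn M).+1 => //; split => //=; apply/(truncation_lt _ _ _ l0); split => //.
  - exact/RplusP.
  - by apply: le_trans Mm; rewrite le_max lexx.
  - by apply: lt_le_trans Mm; rewrite lt_max ltrDl ltr01 orbT.
have ndF : nondecreasing_seq F.
  move=> m k mk; apply/subsetPset => x [Dx] /= /(truncation_lt _ _ _ l0)[x0 xm lf lm].
  have mk' : (m%:R <= k%:R :> R)%R by rewrite ler_nat.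
  split => //=; apply/(truncation_lt _ _ _ l0); split => //.
    exact: le_trans xm mk'.
  exact: lt_le_trans lm mk'.
by apply: (@lt_measure_bigcup _ _ _ leb F) => //; rewrite FE.
Qed.

Lemma truncation_rearr_nd (f : R -> \bar R) (m k : nat) (s : R) :
  Mplus Rplus f -> (m <= k)%N ->
  rearr_Rplus (truncation f m) s <= rearr_Rplus (truncation f k) s.
Proof.
move=> Mf mk; apply: ereal_inf_le_tmp => _ [l [l0 ls] <-]; exists l => //; split => //.
apply: le_trans ls; apply: le_leb.
- apply: measurable_superlevel; first exact: measurable_Rplus.
  by case: (Mplus_truncation m Mf).
- apply: measurable_superlevel; first exact: measurable_Rplus.
  by case: (Mplus_truncation k Mf).
move=> x [Dx] /= /(truncation_lt _ _ _ l0)[x0 xm lf lm].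
have mk' : (m%:R <= k%:R :> R)%R by rewrite ler_nat.
split => //=; apply/(truncation_lt _ _ _ l0); split => //.
  exact: le_trans xm mk'.
exact: lt_le_trans lm mk'.
Qed.

Lemma truncation_rearr_le (f : R -> \bar R) (m : nat) (s : R) :
  (0 < s)%R -> rearr_Rplus (truncation f m) s <= m%:R%:E.
Proof.
move=> s0; apply: rearr_le => //.
rewrite /distribution_function (_ : _ `&` _ = set0) ?measure0 ?lee_fin ?ltW//.
by apply/seteqP; split => x //= [_]; rewrite ltNge truncation_le_nat.
Qed.

(** A bounded function of bounded support is equimeasurable with its
    rearrangement, so the invariance of the norm applies. *)
Lemma fnorm_truncation_rearr (f : R -> \bar R) (m : nat) : Mplus Rplus f ->
  Et (rearr_Rplus (truncation f m)) = Et (truncation f m).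
Proof.
move=> Mf; have Mt := Mplus_truncation m Mf; have [mt _] := Mt.
apply: (ri_invariant Et) => //.
- exact: Mplus_rearr.
- apply: aeW => s /RplusP s0.
  exact: le_lt_trans (truncation_rearr_le f m s0) (ltry _).
- apply: aeW => s _; exact: le_lt_trans (truncation_le_nat f m s) (ltry _).
move=> l l0; set a := RHS.
have afin : a \is a fin_num.
  rewrite ge0_fin_numE ?measure_ge0//.
  apply: (@le_lt_trans _ _ (leb [set` `]0%R, m%:R]%R])).
    apply: le_leb => //.
      by apply: measurable_superlevel => //; exact: measurable_Rplus.
    by move=> x [_] /= /(truncation_lt _ _ _ l0)[x0 xm _ _]; rewrite in_itv/= x0.
  by rewrite lebesgue_0itv// ltry.
rewrite /distribution_function (_ : _ `&` _ = [set` `]0%R, fine a[%R]).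
  change (leb [set` `]0%R, fine a[%R] = a).
  rewrite lebesgue_measure_itv/= lte_fin; case: ltP => [_|a0].
    by rewrite oppr0 adde0 fineK.
  by apply/eqP; rewrite eq_le measure_ge0 -(fineK afin) lee_fin a0.
apply/seteqP; split => s /=; rewrite in_itv/=.
  move=> [/RplusP s0 ls]; rewrite s0/= -lte_fin fineK// ltNge; apply/negP => as_.
  by move: ls; rewrite ltNge rearr_le.
move=> /andP[s0]; rewrite -lte_fin fineK// => sa; split; first exact/RplusP.
by apply: rearr_gt => //; exact: measurable_Rplus.
Qed.

(** A competitor f may be replaced by the rearrangement of one of its
    truncations: this has the norm of the truncation, and by monotone
    convergence it does not lose the strict inequality. *)
Lemma associate_norm_approx (h : R -> R) (a : R) : decr0 h ->
  a%:E < associate_norm Et (EFin \o h) ->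
  exists sig : R -> R, [/\ decr0 sig, Et (EFin \o sig) <= 1 &
    a%:E < \int[leb]_s (h s * sig s)%:E].
Proof.
move=> hD /ereal_sup_gt[_ [f [Mf f1] <-]].
have [h0 hN hd] := hD; have mh := decr0_measurable hD.
pose ft m := rearr_Rplus (truncation f m).
have ft0 m s : 0 <= ft m s by exact: rearr_ge0.
have mft m : measurable_fun Rplus (ft m) by case: (@Mplus_rearr R _ _ leb Rplus (truncation f m)).
have ndft s : nondecreasing_seq (fun m => ft m s).
  by move=> m k mk; exact: truncation_rearr_nd.
have cvft s : cvgn (fun m => ft m s) by apply: ereal_nondecreasing_is_cvgn.
have lim_ge s : (0 < s)%R -> rearr_Rplus f s <= limn (fun m => ft m s).
  move=> s0; apply: lee_real_below.
    by apply: lime_ge => //; apply: nearW => m.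
  move=> l l0 lf.
  have : s%:E < distribution_function leb Rplus f l.
    by rewrite ltNge; apply/negP => /(rearr_le l0); rewrite leNgt lf.
  move=> /(truncation_distribution Mf l0)[m] sm.
  have : l%:E <= ft m s.
    apply: rearr_ge sm; first exact: measurable_Rplus.
    by case: (Mplus_truncation m Mf).
  move=> lm; apply: lime_ge; first exact: cvft.
  exists m; [exact: I|move=> k /= mk; exact: le_trans lm (ndft s m k mk)].
move=> alt.
pose g m s := (h s)%:E * ft m s.
have g0 m s : 0 <= g m s by rewrite mule_ge0// lee_fin.
have mg m : measurable_fun Rplus (g m).
  by apply: emeasurable_funM => //; apply: measurable_funTS; exact/measurable_EFinP.
have ndg s : nondecreasing_seq (fun m => g m s).
  move=> m k mk; apply: lee_wpmul2l; first by rewrite lee_fin.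
  exact: (ndft s m k mk).
have : a%:E < \int[leb]_(s in Rplus) limn (fun m => g m s).
  apply: lt_le_trans alt _; apply: ge0_le_integral => //.
  - exact: measurable_Rplus.
  - by move=> s _; rewrite mule_ge0//; exact: rearr_ge0.
  - by apply: emeasurable_funM; case: (@Mplus_rearr R _ _ leb Rplus (EFin \o h));
      case: (@Mplus_rearr R _ _ leb Rplus f).
  - apply: (emeasurable_fun_cvg g) => // s _.
    exact: ereal_nondecreasing_is_cvgn.
  move=> s /RplusP s0; apply: (@le_trans _ _ ((h s)%:E * limn (fun m => ft m s))).
    apply: lee_pmul; [exact: rearr_ge0|exact: rearr_ge0|exact: rearr_decr0_le|].
    exact: lim_ge.
  by rewrite /g limeMl.
rewrite monotone_convergence//; last exact: measurable_Rplus.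
move=> alim; have [m am] : exists m, a%:E < \int[leb]_(s in Rplus) g m s.
  apply/not_existsP => H; move: alim; rewrite ltNge => /negP; apply.
  apply: lime_le.
    apply: ereal_nondecreasing_is_cvgn => m k mk.
    apply: ge0_le_integral.
    - exact: measurable_Rplus.
    - by move=> s _; exact: (g0 m).
    - exact: (mg m).
    - exact: (mg k).
    - by move=> s _; exact: (ndg s m k mk).
  by apply: nearW => m; rewrite leNgt; apply/negP/H.
have ftfin s : (0 < s)%R -> ft m s \is a fin_num.
  by move=> s0; rewrite ge0_fin_numE//; apply: le_lt_trans (truncation_rearr_le f m s0) (ltry _).
pose sig s := if (0 < s)%R then fine (ft m s) else 0%R.
have sigE s : (0 < s)%R -> (sig s)%:E = ft m s.
  by move=> s0; rewrite /sig s0 fineK// ftfin.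
have sD : decr0 sig.
  split => [s|s s0|s t s0 st].
  - by rewrite /sig; case: ifPn => // _; rewrite fine_ge0.
  - by rewrite /sig ltNge s0.
  - by rewrite -lee_fin !sigE// ?(lt_le_trans s0)//; exact: rearr_nonincr.
exists sig; split => //.
  apply: le_trans f1; apply: (@le_trans _ _ (Et (truncation f m))).
    rewrite -fnorm_truncation_rearr//; apply: fnorm_mono.
    - exact: Mplus_rearr.
    - exact: Mplus_decr0.
    - by move=> s /RplusP s0; rewrite /= sigE.
  apply: fnorm_mono => //; first exact: Mplus_truncation.
  by move=> s s0; exact: truncation_le.
rewrite -integral_Rplus => [|s s0]; last by rewrite hN// mul0r.
congr (_ < _): am; apply: eq_integral => s; rewrite inE => /RplusP s0.
by rewrite EFinM sigE.
Qed.

End AssociateNorm.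

(** * Function spaces on R^n and their representation *)

Section Representation.
Local Open Scope ereal_scope.
Context {R : realType}.
Variables (n : nat) (E : ri_space_Rn R n) (Et : ri_space_Rplus R).
Hypothesis rep : representation_space E Et.
Implicit Types f : 'rV[R]_n -> R.

Lemma Mplus_EFin f : measurable_fun setT f -> (forall x, 0 <= f x)%R ->
  Mplus setT (EFin \o f).
Proof. by move=> mf f0; split; [exact/measurable_EFinP|move=> x _; rewrite lee_fin]. Qed.

(** The rearrangement with real values, and 0 for s <= 0 as decr0 requires;
    functions of finite norm have finite rearrangements. *)
Definition rearr_fun f (s : R) : R :=
  if (0 < s)%R then fine (rearrangement (lebesgue_rV n) setT (EFin \o f) s) else 0%R.

Section FiniteNorm.
Variable f : 'rV[R]_n -> R.
Hypotheses (mf : measurable_fun setT f) (f0 : forall x, (0 <= f x)%R).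
Hypothesis Ef : E (EFin \o f) < +oo.
Let Mf := Mplus_EFin mf f0.
Let fs := rearrangement (lebesgue_rV n) setT (EFin \o f).

Lemma rearr_funE s : (0 < s)%R -> (rearr_fun f s)%:E = fs s.
Proof.
move=> s0; rewrite /rearr_fun s0 fineK// ge0_fin_numE; last exact: rearr_ge0.
apply: (@fnorm_nonincr_lty _ Et) => //.
- exact: Mplus_rearr.
- by move=> u v; exact: rearr_nonincr.
- by rewrite -rep.
Qed.

Lemma rearr_fun_decr0 : decr0 (rearr_fun f).
Proof.
split => [s|s s0|s t s0 st].
- by rewrite /rearr_fun; case: ifPn => // _; rewrite fine_ge0//; exact: rearr_ge0.
- by rewrite /rearr_fun ltNge s0.
- by rewrite -lee_fin !rearr_funE// ?(lt_le_trans s0)//; exact: rearr_nonincr.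
Qed.

Lemma fnorm_rearr_fun : Et (EFin \o rearr_fun f) = E (EFin \o f).
Proof.
rewrite rep//; apply: fnorm_eq.
- exact: Mplus_rearr.
- exact/Mplus_decr0/rearr_fun_decr0.
- by move=> s /RplusP s0; exact: rearr_funE.
Qed.

Lemma rearr_fun_level (s l : R) : (0 < s)%R -> (rearr_fun f s < l)%R ->
  lebesgue_rV n [set x | l < f x]%R <= s%:E.
Proof.
move=> s0; rewrite -lte_fin rearr_funE// => /(rearr_lt measurableT).
rewrite /distribution_function setTI; apply.
exact/measurable_EFinP.
Qed.

(** Such a map divides the volume of level sets by |a|^n >= 1. *)
Lemma rearr_fun_level_affine (a : R) (b : 'rV[R]_n) (s l : R) : (1 <= `|a|)%R ->
  (0 < s)%R -> (rearr_fun f s < l)%R ->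
  lebesgue_rV n [set x | l < f (a *: x + b)]%R <= s%:E.
Proof.
move=> a1 s0 sl; apply: le_trans (rearr_fun_level s0 sl).
have a0 : a != 0%R by rewrite -normr_gt0 (lt_le_trans ltr01).
rewrite -(@lebesgue_rV_affine R n a b [set x | l < f x]%R)//; last first.
  rewrite (_ : mkset _ = f @^-1` [set` `]l, +oo[%R]); last first.
    by apply/seteqP; split => x /=; rewrite in_itv/= andbT.
  by rewrite -[X in measurable X]setTI; exact: mf.
rewrite -[leLHS]mul1e; apply: lee_wpmul2r => //.
by rewrite lee_fin exprn_ege1.
Qed.

(** Dilating by a factor of modulus at least 1 shrinks the level sets. *)
Lemma fnorm_dilation (a : R) : (1 <= `|a|)%R ->
  E (EFin \o (fun x => f (a *: x))) <= E (EFin \o f).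
Proof.
move=> a1; pose g x := f (a *: x).
have mg : measurable_fun setT g.
  have := measurableT_comp mf (measurable_affine a (0%R : 'rV[R]_n)).
  by apply: eq_measurable_fun => x _; rewrite /= addr0.
have g0 x : (0 <= g x)%R by exact: f0.
rewrite -fnorm_rearr_fun rep; last exact: Mplus_EFin.
apply: fnorm_mono; first exact/Mplus_decr0/rearr_fun_decr0.
  exact: Mplus_rearr.
have [r0 _ _] := rearr_fun_decr0.
move=> s /RplusP s0; apply/lee_addgt0Pr => e e0.
rewrite -EFinD; apply: rearr_le; first by rewrite addr_ge0// ltW.
rewrite /distribution_function setTI.
have := @rearr_fun_level_affine a 0%R s (rearr_fun f s + e)%R a1 s0.
rewrite ltrDl => /(_ e0); apply: le_trans.
rewrite le_eqVlt; apply/orP; left; apply/eqP; congr (lebesgue_rV n _).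
by apply/seteqP; split => x /=; rewrite lte_fin addr0.
Qed.

End FiniteNorm.

Hypothesis n0 : (0 < n)%N.

(** Since nu has the distribution of the identity on the half line, x |-> sig
    (nu x) rearranges to sig; the compression by c and the cutoff to A keep
    the norm below that of sig. *)
Definition transplant (sig : R -> R) (c : R) (A : set 'rV[R]_n) (x : 'rV[R]_n) : R :=
  (sig (c * nu x) * \1_A x)%R.

Lemma transplant_ge0 sig c A x : decr0 sig -> (0 <= transplant sig c A x)%R.
Proof. by case=> s0 _ _; rewrite /transplant mulr_ge0. Qed.

Lemma measurable_transplant sig c A : decr0 sig -> measurable A ->
  measurable_fun setT (transplant sig c A).
Proof.
move=> sD mA; apply: measurable_funM; last exact: measurable_indic.
apply: (measurableT_comp (decr0_measurable sD)).
exact: (measurableT_comp (mulrl_measurable c) (@measurable_nu R n)).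
Qed.

Lemma fnorm_transplant sig c A : decr0 sig -> measurable A -> (1 <= c)%R ->
  E (EFin \o transplant sig c A) <= Et (EFin \o sig).
Proof.
move=> sD mA c1; have [sg0 sN sd] := sD.
have c0 : (0 < c)%R by exact: lt_le_trans c1.
rewrite rep; last first.
  by apply: Mplus_EFin; [exact: measurable_transplant|move=> x; exact: transplant_ge0].
apply: fnorm_mono; [exact: Mplus_decr0|exact: Mplus_rearr|].
move=> t /RplusP t0; apply: rearr_le => //.
rewrite /distribution_function setTI -(lebesgue_rV_nu n0 (ltW t0)).
apply: le_measure; rewrite ?inE.
- have := @measurable_superlevel _ _ R setT measurableT (EFin \o transplant sig c A) (sig t).
  by rewrite setTI; apply; apply/measurable_EFinP; exact: measurable_transplant.
- exact: measurable_nu_le.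
move=> x /=; rewrite lte_fin => tx.
have {tx} tx : (sig t < sig (c * nu x))%R.
  apply: lt_le_trans tx _; by rewrite /transplant ler_piMr// indicE.
rewrite leNgt; apply/negP => tnu; move: tx; rewrite ltNge => /negP; apply.
apply: sd => //; apply: le_trans (ltW tnu) _.
by rewrite ler_peMl// nu_ge0.
Qed.

End Representation.

(** * Integrals of nonnegative real functions *)

Section NonnegRealIntegrals.
Local Open Scope ereal_scope.
Context d (S : measurableType d) (R : realType).
Variable mu : {measure set S -> \bar R}.
Implicit Types f g : S -> R.

Lemma int_le f g : measurable_fun setT f -> measurable_fun setT g ->
  (forall x, 0 <= f x)%R -> (forall x, f x <= g x)%R ->
  \int[mu]_x (f x)%:E <= \int[mu]_x (g x)%:E.
Proof.
move=> mf mg f0 fg; apply: ge0_le_integral.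
- exact: measurableT.
- by move=> x _; rewrite lee_fin.
- exact/measurable_EFinP.
- exact/measurable_EFinP.
- by move=> x _; rewrite lee_fin.
Qed.

Lemma int_add f g : measurable_fun setT f -> measurable_fun setT g ->
  (forall x, 0 <= f x)%R -> (forall x, 0 <= g x)%R ->
  \int[mu]_x (f x + g x)%:E = \int[mu]_x (f x)%:E + \int[mu]_x (g x)%:E.
Proof.
move=> mf mg f0 g0.
by rewrite -ge0_integralD//; [move=> x _; rewrite lee_fin|exact/measurable_EFinP|
  move=> x _; rewrite lee_fin|exact/measurable_EFinP].
Qed.

Lemma int_scale (c : R) f : measurable_fun setT f -> (0 <= c)%R ->
  (forall x, 0 <= f x)%R ->
  \int[mu]_x (c * f x)%:E = c%:E * \int[mu]_x (f x)%:E.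
Proof.
move=> mf c0 f0; rewrite -ge0_integralZl_EFin//; last exact/measurable_EFinP.
by move=> x _; rewrite lee_fin.
Qed.

Lemma int_ge0 f : (forall x, 0 <= f x)%R -> 0 <= \int[mu]_x (f x)%:E.
Proof. by move=> f0; apply: integral_ge0 => x _; rewrite lee_fin. Qed.

Lemma int_sum I (s : seq I) (f : I -> S -> R) :
  (forall i, measurable_fun setT (f i)) -> (forall i x, 0 <= f i x)%R ->
  \int[mu]_x (\sum_(i <- s) f i x)%R%:E = \sum_(i <- s) \int[mu]_x (f i x)%:E.
Proof.
move=> mf f0; elim: s => [|i s IH].
  by rewrite big_nil; under eq_integral do rewrite big_nil; rewrite integral0.
rewrite big_cons -IH -int_add//.
- by apply: eq_integral => x _; rewrite big_cons.
- exact: measurable_sum.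
- by move=> x; exact: sumr_ge0.
Qed.

End NonnegRealIntegrals.

(** * The profile of a radial kernel *)

Section Profile.
Context {R : realType}.
Implicit Types (Phi : R -> R) (n : nat).

Definition extend0 (g : R -> R) (s : R) : R := if 0 < s then g s else 0.

Lemma extend0E (g : R -> R) s : 0 < s -> extend0 g s = g s.
Proof. by rewrite /extend0 => ->. Qed.

Lemma extend0_decr0 (g : R -> R) : (forall s, 0 < s -> 0 <= g s) ->
  (forall s t, 0 < s -> s <= t -> g t <= g s) -> decr0 (extend0 g).
Proof.
move=> g0 gd; split => [s|s s0|s t s0 st].
- by rewrite /extend0; case: ifPn => // /g0.
- by rewrite /extend0 ltNge s0.
- by rewrite !extend0E ?(lt_le_trans s0)//; exact: gd.
Qed.

Lemma decr0_cut (g : R -> R) (T : R) : decr0 g ->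
  decr0 (fun s => if s < T then g s else 0).
Proof.
move=> [g0 gN gd]; split => [s|s s0|s t s0 st].
- by case: ifPn.
- by rewrite gN// if_same.
- case: ifPn => [tT|_]; last by case: ifPn.
  by rewrite (le_lt_trans st tT); exact: gd.
Qed.

Lemma decr0M (g h : R -> R) : decr0 g -> decr0 h -> decr0 (fun s => g s * h s).
Proof.
move=> [g0 gN gd] [h0 hN hd]; split => [s|s s0|s t s0 st].
- exact: mulr_ge0.
- by rewrite gN// mul0r.
- by apply: ler_pM; rewrite ?gd ?hd.
Qed.

Lemma in_itv0 (T t : R) : (t \in itv0 T) = (0 < t < T).
Proof. by apply/idP/idP; rewrite inE /itv0/= in_itv. Qed.

Lemma decr0_restrict (s : R -> R) (T : R) :
  (forall t, 0 < t < T -> 0 <= s t) ->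
  (forall t1 t2, 0 < t1 -> t1 <= t2 -> t2 < T -> s t2 <= s t1) ->
  decr0 (s \_ (itv0 T)).
Proof.
move=> s0 sd; split => [t|t t0|t1 t2 t10 t12].
- by rewrite patchE in_itv0; case: ifPn => // /s0.
- by rewrite patchE in_itv0 ltNge t0.
- rewrite !patchE !in_itv0; case: ifPn => [/andP[t20 t2T]|_].
    by rewrite t10 (le_lt_trans t12 t2T)/= sd.
  by case: ifPn => // /s0.
Qed.

Lemma restrict_cut (s : R -> R) (T : R) :
  s \_ (itv0 T) = fun t => if t < T then extend0 s t else 0.
Proof.
apply/funext => t; rewrite patchE /extend0 in_itv0.
by case: (0 < t); case: (t < T).
Qed.

Section Tail.
Local Open Scope ereal_scope.
Variables (Phi : R -> R) (n : nat).
Hypothesis n0 : (0 < n)%N.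
Hypothesis Phi0 : (forall z, 0 < z -> 0 <= Phi z)%R.
Hypothesis Phid : (forall z w, 0 < z -> z <= w -> Phi w <= Phi z)%R.
Hypothesis PhiI : 0 < \int[leb]_(z in Rplus) (Phi z * z ^+ n.-1)%:E < +oo.

Let V : R := ball_volume n.
Let V0 : (0 < V)%R := ball_volume_gt0 n.

Definition phi0 : R -> R := extend0 (profile Phi n).

Lemma root_le (s t : R) : (0 <= s)%R -> (s <= t)%R ->
  ((s / V) `^ n%:R^-1 <= (t / V) `^ n%:R^-1)%R.
Proof.
move=> s0 st; apply: ge0_ler_powR; rewrite ?invr_ge0 ?nnegrE ?divr_ge0 ?(ltW V0)//.
  exact: le_trans st.
by rewrite ler_pM2r// invr_gt0.
Qed.

Lemma phi0_decr0 : decr0 phi0.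
Proof.
apply: extend0_decr0 => [s s0|s t s0 st]; rewrite /profile.
  by apply: Phi0; rewrite powR_gt0// divr_gt0.
apply: Phid; first by rewrite powR_gt0// divr_gt0.
by apply: root_le => //; exact: ltW.
Qed.

Lemma phi0_nu (x : 'rV[R]_n) : x != 0%R -> phi0 (nu x) = Phi (enorm x).
Proof. by move=> x0; rewrite /phi0 extend0E ?nu_gt0// /profile nu_root. Qed.

(** Otherwise Phi, being nonincreasing, would vanish identically, against the
    positivity of its integral. *)
Lemma phi0_gt0 (T : R) : (0 < T)%R -> exists T', (0 < T' < T)%R /\ (0 < phi0 T')%R.
Proof.
move=> T0; apply: contrapT => H.
have phiz s : (0 < s < T)%R -> phi0 s = 0%R.
  move=> sT; apply/eqP; rewrite eq_le; have [p0 _ _] := phi0_decr0.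
  rewrite p0 andbT leNgt; apply/negP => sp; apply: H; exists s; by split.
have T2 : (0 < T / 2 < T)%R by rewrite divr_gt0//= ltr_pdivrMr// mulr_natr mulr2n ltrDl.
have Phiz z : (0 < z)%R -> Phi z = 0%R.
  move=> z0; pose r := (Num.min (T / 2) (V * z ^+ n))%R.
  have zn0 : (0 < V * z ^+ n)%R by rewrite mulr_gt0// exprn_gt0.
  have r0 : (0 < r)%R by rewrite lt_min zn0; case/andP: T2 => ->.
  have := @phiz r; rewrite r0 /phi0 extend0E// /profile => /(_ _) H1.
  apply/eqP; rewrite eq_le Phi0// andbT -H1; last first.
    by rewrite gt_min; case/andP: T2 => _ ->.
  apply: Phid; first by rewrite powR_gt0// divr_gt0.
  rewrite -[leRHS](expn_root n0 (ltW z0)).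
  have -> : (z ^+ n)%R = ((V * z ^+ n) / V)%R by rewrite mulrAC mulfV ?gt_eqF// mul1r.
  by apply: root_le; [exact: ltW|rewrite ge_min lexx orbT].
move: PhiI => /andP[+ _]; rewrite ltNge => /negP; apply.
rewrite (_ : \int[leb]_(z in Rplus) _ = \int[leb]_(z in Rplus) 0); last first.
  by apply: eq_integral => z; rewrite inE => /RplusP z0; rewrite Phiz// mul0r.
by rewrite integral0.
Qed.

(** Substituting s = V z^n would turn the integral of the profile into that of
    Phi z * z^(n-1). Instead of differentiating, the level sets are compared:
    if a level of Phi contains (0, z], then the weight of the interval from z
    / 2 to z is already a fixed fraction of z^n. *)
Lemma integral_phi0_lty : \int[leb]_s (phi0 s)%:E < +oo.
Proof.
have PhiD : decr0 (extend0 Phi) by exact: extend0_decr0.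
have mP := decr0_measurable PhiD; have [P0 PN Pd] := PhiD.
pose w z : R := (\1_(@Rplus R) z * z ^+ n.-1)%R.
have mR : measurable (@Rplus R) by exact: measurable_Rplus.
have mw : measurable_fun setT (w : measurableTypeR R -> R).
  apply: measurable_funM; first exact: measurable_indic.
  by apply: measurable_funX.
have w0 z : (0 <= w z)%R.
  rewrite /w indicE; case: (boolP (z \in _)) => [|_]; last by rewrite mul0r.
  by rewrite inE => /RplusP z0; rewrite mul1r exprn_ge0// ltW.
have := @layer_cake_ge R _ _ leb (extend0 Phi) (EFin \o w) phi0 (2 ^+ n * V)%R mP P0.
have mEw : measurable_fun setT (EFin \o w) by exact/measurable_EFinP.
move=> /(_ mEw) /(_ (fun z => w0 z)) /(_ phi0_decr0).
have C0 : (0 <= 2 ^+ n * V)%R by rewrite mulr_ge0 ?exprn_ge0// ltW.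
move=> /(_ C0) H; apply: le_lt_trans (H _) _; last first.
  rewrite lte_mul_pinfty ?lee_fin// (_ : \int[leb]_x _ =
    \int[leb]_(z in Rplus) (Phi z * z ^+ n.-1)%:E); first by case/andP: PhiI.
  rewrite [RHS]integral_mkcond; apply: eq_integral => z _.
  rewrite patchE /w /= indicE -EFinM; case: ifPn => [|_]; last by rewrite !mul0r mulr0.
  by rewrite inE => /RplusP z0; rewrite extend0E// mul1r.
move=> s l s0 /andP[l0 ls]; pose z0 := ((s / V) `^ n%:R^-1)%R.
have z00 : (0 < z0)%R by rewrite powR_gt0// divr_gt0.
have zn : (z0 ^+ n = s / V)%R by rewrite root_expn// divr_ge0// ltW.
have mL := measurable_level l mP.
have half : (0 < z0 / 2)%R by rewrite divr_gt0.
pose A : set (measurableTypeR R) := [set` `[z0 / 2, z0]%R].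
have mA : measurable A by exact: measurable_itv.
apply: (@le_trans _ _ ((2 ^+ n * V)%:E * \int[leb]_x ((z0 / 2) ^+ n.-1 * \1_A x)%:E)).
  have zh0 : (0 <= (z0 / 2) ^+ n.-1)%R by rewrite exprn_ge0// ltW.
  rewrite int_scale// (_ : integral _ _ _ = (z0 / 2)%:E); last first.
    rewrite integral_indic// setIT; change (leb A = (z0 / 2)%:E).
    rewrite /A lebesgue_measure_itv/= lte_fin ltr_pdivrMr// mulr_natr mulr2n ltrDl z00.
    by rewrite -EFinB; congr EFin; lra.
  rewrite -!EFinM lee_fin -exprSr prednK// exprMn zn exprVn.
  have n2 : (2 ^+ n != 0 :> R)%R by rewrite expf_neq0.
  rewrite le_eqVlt; apply/orP; left; apply/eqP; field.
  by rewrite n2 gt_eqF.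
apply: lee_wpmul2l; first by rewrite lee_fin.
apply: ge0_le_integral => //.
- by move=> x _; rewrite lee_fin mulr_ge0// exprn_ge0// ltW.
- apply/measurable_EFinP; apply: measurable_funM => //; exact: measurable_indic.
- by apply: emeasurable_funM => //; exact/measurable_EFinP/measurable_indic.
move=> x _; rewrite /= -EFinM lee_fin {1}indicE; case: (boolP (x \in A)) => xA.
  move: xA; rewrite inE /A/= in_itv/= => /andP[xz zx].
  have x0 : (0 < x)%R by exact: lt_le_trans xz.
  have xL : level (extend0 Phi) l x.
    rewrite /level/= l0 extend0E//; apply: le_trans ls _; rewrite /phi0 extend0E//.
    exact: Phid.
  rewrite mulr1 indicE mem_set// mul1r /w indicE mem_set ?mul1r; last exact/RplusP.
  by rewrite lerXn2r ?nnegrE ?(ltW x0)// ltW.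
by rewrite mulr0 mulr_ge0.
Qed.

(** Beyond T the pairing is at most sig T times the integral of the profile,
    and sig T is at most a multiple of the pairing over (0, T'), where the
    profile is bounded below. *)
Lemma profile_tail (T : R) : (0 < T)%R -> exists2 C : R, (0 < C)%R &
  forall sig, decr0 sig ->
  \int[leb]_s (phi0 s * sig s)%:E <=
  C%:E * \int[leb]_s ((if s < T then phi0 s else 0) * sig s)%R%:E.
Proof.
move=> T0; have [T' [/andP[T'0 T'T] pT']] := phi0_gt0 T0.
have [p0 pN pd] := phi0_decr0; have mp := decr0_measurable phi0_decr0.
have pI : \int[leb]_s (phi0 s)%:E \is a fin_num.
  by rewrite ge0_fin_numE ?integral_phi0_lty//; exact: int_ge0.
pose I := fine (\int[leb]_s (phi0 s)%:E).
have I0 : (0 <= I)%R by rewrite fine_ge0//; exact: int_ge0.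
pose c := (T' * phi0 T')%R; have c0 : (0 < c)%R by rewrite mulr_gt0.
exists (1 + I / c)%R; first by rewrite ltr_pwDl// divr_ge0// ltW.
move=> sig sD; have [s0 sN sd] := sD; have ms := decr0_measurable sD.
have cD := decr0_cut T phi0_decr0; have mc := decr0_measurable cD.
have mcs : measurable_fun setT (fun s : measurableTypeR R =>
   (if s < T then phi0 s else 0) * sig s)%R by exact: measurable_funM.
have cs0 s : (0 <= (if s < T then phi0 s else 0) * sig s)%R.
  by rewrite mulr_ge0//; case: ifPn.
set J := \int[leb]_s ((if s < T then phi0 s else 0) * sig s)%R%:E.
have J0 : 0 <= J by exact: int_ge0.
have step1 : \int[leb]_s (phi0 s * sig s)%:E <= J + (sig T)%:E * I%:E.
  rewrite /I fineK// -int_scale// /J -int_add//; last 2 first.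
  - exact: measurable_funM.
  - by move=> s; rewrite mulr_ge0.
  apply: int_le => //.
  - exact: measurable_funM.
  - apply: measurable_funD => //; exact: measurable_funM.
  - by move=> s; rewrite mulr_ge0.
  move=> s; case: ltP => sT; first by rewrite lerDl mulr_ge0.
  by rewrite mul0r add0r mulrC ler_wpM2r// sd.
have step2 : (c * sig T)%:E <= J.
  have -> : (c * sig T)%:E = \int[leb]_s ((phi0 T' * sig T) * \1_[set` `]0%R, T'%R]%R] s)%:E.
    rewrite int_scale ?mulr_ge0//.
    rewrite integral_indic// setIT; change ((c * sig T)%:E =
      (phi0 T' * sig T)%:E * leb [set` `]0%R, T'%R]%R]).
    by rewrite lebesgue_0itv ?ltW// -EFinM /c; congr EFin; ring.
  apply: int_le => //.
  - apply: measurable_funM => //; apply: measurable_indic; exact: measurable_itv.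
  - by move=> s; rewrite !mulr_ge0.
  move=> s; rewrite indicE; case: (boolP (s \in _)) => [|_]; last by rewrite mulr0.
  rewrite inE/= in_itv/= => /andP[sp sT'].
  rewrite mulr1 (le_lt_trans sT' T'T); apply: ler_pM => //.
    exact: pd.
  by apply: sd => //; apply: le_trans sT' (ltW T'T).
apply: le_trans step1 _; rewrite EFinD ge0_muleDl ?lee_fin ?divr_ge0 ?(ltW c0)//.
rewrite mul1e leeD2l// -EFinM.
have -> : (sig T * I)%R = (I / c * (c * sig T))%R by field; rewrite gt_eqF.
rewrite EFinM; apply: lee_wpmul2l => //.
by rewrite lee_fin divr_ge0// ltW.
Qed.

End Tail.
End Profile.

(** * Potentials of radial kernels *)

Section Potentials.
Context {R : realType}.
Variables (n : nat) (E : ri_space_Rn R n) (Et : ri_space_Rplus R).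
Hypothesis rep : representation_space E Et.
Hypothesis n0 : (0 < n)%N.
Implicit Types (f F : 'rV[R]_n -> R) (g : R -> R) (x y z h : 'rV[R]_n).
Notation lam := (@lebesgue_rV R n).

(** The kernel enters as a function of nu, so that its value at the origin is
    0. *)
Definition pot g f x : R := \int[lam]_y (g (nu (x - y)) * f y).

Section Bounds.
Local Open Scope ereal_scope.
Variable F : 'rV[R]_n -> R.
Hypotheses (mF : measurable_fun setT F) (F0 : forall x, (0 <= F x)%R).
Hypothesis EF : E (EFin \o F) < +oo.
Let sig := rearr_fun F.

Lemma measurable_comp_affine d (Y : measurableType d) (H : 'rV[R]_n -> Y)
  (a : R) (b : 'rV[R]_n) : measurable_fun setT H ->
  measurable_fun setT (fun x => H (a *: x + b)%R).
Proof. by move=> mH; exact: (measurableT_comp mH (measurable_affine a b)). Qed.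

Lemma measurable_comp_sub d (Y : measurableType d) (H : 'rV[R]_n -> Y)
  (b : 'rV[R]_n) : measurable_fun setT H ->
  measurable_fun setT (fun x => H (b - x)%R).
Proof.
move=> mH; apply: (eq_measurable_fun (fun x => H (-1 *: x + b)%R)).
  by move=> x _; rewrite scaleN1r addrC.
exact: measurable_comp_affine.
Qed.

Lemma measurable_radial g : decr0 g -> measurable_fun setT (fun x : 'rV[R]_n => g (nu x)).
Proof.
by move=> gD; exact: (measurableT_comp (decr0_measurable gD) (@measurable_nu R n)).
Qed.

Lemma measurable_radial_affine g (a : R) (b : 'rV[R]_n) : decr0 g ->
  measurable_fun setT (fun x : 'rV[R]_n => g (nu (a *: x + b))%R).
Proof. by move=> gD; exact: (measurableT_comp (measurable_radial gD) (measurable_affine a b)). Qed.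

Lemma measurable_radial_add g (b : 'rV[R]_n) : decr0 g ->
  measurable_fun setT (fun x : 'rV[R]_n => g (nu (x + b))%R).
Proof.
move=> gD; apply: (eq_measurable_fun (fun x => g (nu (1 *: x + b))%R)).
  by move=> x _; rewrite scale1r.
exact: measurable_radial_affine.
Qed.

(** Dilations by factors of modulus at least 1 and translations do not enlarge
    level sets, so the Hardy-Littlewood inequality applies with the
    rearrangement of F itself. *)
Lemma radial_bound g (a : R) (b : 'rV[R]_n) : decr0 g -> (1 <= `|a|)%R ->
  \int[lam]_z (g (nu z) * F (a *: z + b))%:E <= \int[leb]_s (g s * sig s)%:E.
Proof.
move=> gD a1; apply: hardy_littlewood => //.
- exact: (rearr_fun_decr0 rep).
- exact: measurable_comp_affine.
- by move=> s l s0 sl; apply: (rearr_fun_level_affine rep).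
Qed.

Lemma conv_bound g x : decr0 g ->
  \int[lam]_y (g (nu (x - y)) * F y)%:E <= \int[leb]_s (g s * sig s)%:E.
Proof.
move=> gD; have [g0 _ _] := gD; have mg := measurable_radial gD.
rewrite -(@rV_reflect R n x); last 2 first.
- by apply/measurable_EFinP; apply: measurable_funM => //; exact: (measurable_comp_sub x mg).
- by move=> y; rewrite lee_fin mulr_ge0.
rewrite (_ : \int[lam]_y _ = \int[lam]_z (g (nu z) * F (-1 *: z + x))%:E).
  by apply: radial_bound => //; rewrite normrN1.
by apply: eq_integral => z _; rewrite subKr scaleN1r addrC.
Qed.

Section Signed.
Variables (f : 'rV[R]_n -> R) (g : R -> R).
Hypotheses (mf : measurable_fun setT f) (fF : forall x, (`|f x| <= F x)%R).
Hypotheses (gD : decr0 g) (gI : \int[leb]_s (g s * sig s)%:E < +oo).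

Lemma pot_integrable x :
  lam.-integrable setT (EFin \o (fun y => g (nu (x - y)) * f y)%R).
Proof.
have [g0 _ _] := gD; have mg := measurable_radial gD.
have mgx := measurable_comp_sub x mg.
apply/integrableP; split; first by apply/measurable_EFinP; exact: measurable_funM.
apply: le_lt_trans gI; apply: le_trans (conv_bound x gD).
apply: ge0_le_integral => //.
- apply: measurableT_comp => //; apply/measurable_EFinP; exact: measurable_funM.
- by apply/measurable_EFinP; exact: measurable_funM.
by move=> y _; rewrite /= lee_fin normrM ger0_norm// ler_wpM2l.
Qed.

Lemma pot_sum (J : Type) (s : seq J) (c : J -> R) (t : J -> 'rV[R]_n) :
  (lam.-integrable setT (EFin \o (fun y => (\sum_(j <- s) c j * g (nu (t j - y))) * f y)%R)
  /\ \sum_(j <- s) c j * pot g f (t j) =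
     \int[lam]_y ((\sum_(j <- s) c j * g (nu (t j - y))) * f y))%R.
Proof.
elim: s => [|j s [IHi IHe]].
  rewrite big_nil; split.
    rewrite (_ : EFin \o _ = fun _ => 0) ?integrable0//.
    by apply/funext => y /=; rewrite big_nil mul0r.
  by rewrite /Rintegral integral0_eq// => y _; rewrite big_nil mul0r.
have ij : lam.-integrable setT (EFin \o (fun y => c j * (g (nu (t j - y)) * f y))%R).
  have := integrableZl measurableT (c j) (pot_integrable (t j)).
  by congr (integrable _ _ _); apply/funext => y /=; rewrite EFinM.
have E1 y : ((\sum_(i <- j :: s) c i * g (nu (t i - y))) * f y =
  c j * (g (nu (t j - y)) * f y) + (\sum_(i <- s) c i * g (nu (t i - y))) * f y)%R.
  by rewrite big_cons mulrDl mulrA.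
split.
  have := integrableD measurableT ij IHi.
  by congr (integrable _ _ _); apply/funext => y /=; rewrite -EFinD E1.
rewrite big_cons IHe -RintegralZl//; last exact: (pot_integrable (t j)).
rewrite -RintegralD//; apply: eq_Rintegral => y _; exact/esym/E1.
Qed.

Lemma pot_sum_le (J : Type) (s : seq J) (c : J -> R) (t : J -> 'rV[R]_n) x :
  (`|\sum_(j <- s) c j * pot g f (x + t j)|%R)%:E <=
  \int[lam]_z (`|\sum_(j <- s) c j * g (nu (z + t j))| * F (x - z))%R%:E.
Proof.
have [Hi He] := pot_sum s c (fun j => x + t j)%R.
rewrite He; apply: (@le_trans _ _ (\int[lam]_y
   (`|\sum_(j <- s) c j * g (nu (x + t j - y))| * F y)%R%:E)).
  rewrite EFin_normr_Rintegral//; apply: le_trans (le_abse_integral _ _ _) _ => //.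
    by case/integrableP: Hi.
  apply: ge0_le_integral => //.
  - by case/integrableP: Hi => mH _; exact: measurableT_comp.
  - apply/measurable_EFinP; apply: measurable_funM => //.
    apply: measurableT_comp => //; apply: measurable_sum => j.
    by apply: measurable_funM => //; exact: (measurable_comp_sub _ (measurable_radial gD)).
  by move=> y _; rewrite /= lee_fin normrM ler_wpM2l.
rewrite -(@rV_reflect R n x); last 2 first.
- apply/measurable_EFinP; apply: measurable_funM => //.
  apply: measurableT_comp => //; apply: measurable_sum => j.
  by apply: measurable_funM => //; exact: (measurable_comp_sub _ (measurable_radial gD)).
- by move=> y; rewrite lee_fin mulr_ge0.
rewrite le_eqVlt; apply/orP; left; apply/eqP; apply: eq_integral => z _.
congr (EFin (`|_| * _)%R); apply: eq_bigr => j _; congr (_ * g (nu _))%R.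
by rewrite opprB [LHS]addrC addrA subrK.
Qed.

Lemma pot_le x : (`|pot g f x|)%:E <= \int[leb]_s (g s * sig s)%:E.
Proof.
have [g0 _ _] := gD; have mg := measurable_radial gD.
apply: le_trans (conv_bound x gD).
rewrite /pot EFin_normr_Rintegral//; last exact: pot_integrable.
apply: le_trans (le_abse_integral _ _ _) _ => //.
  by case/integrableP: (pot_integrable x).
apply: ge0_le_integral => //.
- by case/integrableP: (pot_integrable x) => mH _; exact: measurableT_comp.
- by apply/measurable_EFinP; apply: measurable_funM => //; exact: (measurable_comp_sub x mg).
by move=> y _; rewrite /= lee_fin normrM ger0_norm// ler_wpM2l.
Qed.

End Signed.
End Bounds.
End Potentials.

(** * Finite differences and iterated chain rule *)

Section FiniteDifferences.
Context {R : realType}.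
Implicit Types (g : R -> R) (D : nat -> R -> R).

Definition fdiff (k : nat) (eta : R) g (s : R) : R :=
  \sum_(j < k.+1) 'C(k, j)%:R * (-1) ^+ (k - j) * g (s + j%:R * eta).

Lemma fdiff0 eta g s : fdiff 0 eta g s = g s.
Proof. by rewrite /fdiff big_ord1 bin0 subnn expr0 !mul1r mul0r addr0. Qed.

(** Pascal's rule. *)
Lemma fdiffS k eta g s :
  fdiff k.+1 eta g s = fdiff k eta (fun x => g (x + eta) - g x) s.
Proof.
rewrite /fdiff.
transitivity (\sum_(j < k.+1) 'C(k, j)%:R * (-1) ^+ (k - j) * g (s + j%:R * eta + eta) -
   \sum_(j < k.+1) 'C(k, j)%:R * (-1) ^+ (k - j) * g (s + j%:R * eta)); last first.
  by rewrite -sumrB; apply: eq_bigr => j _; rewrite mulrBr.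
rewrite big_ord_recl bin0 subn0 mul1r.
under eq_bigr => j _ do rewrite lift0 binS subSS natrD 2!mulrDl.
rewrite big_split/= addrA addrC; congr (_ + _).
  apply: eq_bigr => j _; congr (_ * g _).
  by rewrite -addn1 natrD mulrDl mul1r addrA.
rewrite [in RHS]big_ord_recl bin0 subn0 mul1r opprD -mulNr; congr (_ + _).
  by rewrite exprS mulN1r.
rewrite -sumrN [LHS]big_ord_recr/= bin_small// !mul0r addr0.
apply: eq_bigr => j _; rewrite /bump leq0n add1n -mulNr; congr (_ * _).
rewrite -mulrN; congr (_ * _); have -> : (k - j = (k - j.+1).+1)%N by rewrite subnSK.
by rewrite exprS mulN1r.
Qed.

Lemma MVT_diff g (dg : R -> R) (a b : R) : a <= b ->
  (forall x, a <= x <= b -> is_derive x 1 g (dg x)) ->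
  exists2 c, a <= c <= b & g b - g a = dg c * (b - a).
Proof.
move=> ab gd; have [||c] := @MVT_segment R g dg a b ab.
- by move=> x; rewrite in_itv/= => /andP[ax xb]; apply: gd; rewrite !ltW.
- apply: derivable_within_continuous => x; rewrite in_itv/= => xab.
  by case: (gd _ xab).
by rewrite in_itv/= => cab E; exists c.
Qed.

Lemma is_derive_shift_arg g (dg : R) (x c : R) :
  is_derive (x + c) 1 g dg -> is_derive x 1 (fun y => g (y + c)) dg.
Proof.
move=> dgx.
have dc : is_derive x 1 (fun y : R => y + c) 1.
  exact: is_derive_shift.
have := @is_derive1_comp R g (fun y => y + c) x _ _ dgx dc.
by rewrite mulr1.
Qed.

(** Induction on k: a difference of order k + 1 is a difference of order k of
    a first difference, to which the mean value theorem applies once more. *)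
Lemma fdiff_mean k D (eta s : R) : 0 <= eta ->
  (forall m x, (m < k)%N -> s <= x <= s + k%:R * eta -> is_derive x 1 (D m) (D m.+1 x)) ->
  exists2 xi, s <= xi <= s + k%:R * eta & fdiff k eta (D 0%N) s = eta ^+ k * D k xi.
Proof.
move=> eta0; elim: k D => [|k IH] D HD.
  by exists s; rewrite ?mul0r ?addr0 ?lexx// fdiff0 expr0 mul1r.
have kE : k.+1%:R * eta = k%:R * eta + eta by rewrite -addn1 natrD mulrDl mul1r.
have [m x mk /andP[sx xs]|xi /andP[sxi xis] E] :=
    IH (fun m x => D m (x + eta) - D m x).
  apply: is_deriveB.
    apply: is_derive_shift_arg; apply: HD; first by rewrite ltnS ltnW.
    by rewrite kE addrA lerD2r xs (le_trans sx)// lerDl.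
  by apply: HD; rewrite ?ltnS ?(ltnW mk)// sx kE addrA (le_trans xs)// lerDl.
have [|x /andP[xix xxi]|c /andP[xic cxi] Ec] := @MVT_diff (D k) (D k.+1) xi (xi + eta).
- by rewrite lerDl.
- by apply: HD => //; rewrite (le_trans sxi)//= kE addrA (le_trans xxi)// lerD2r.
exists c.
  by rewrite (le_trans sxi)//= kE addrA (le_trans cxi)// lerD2r.
by rewrite fdiffS E Ec addrAC subrr add0r mulrC [RHS]mulrC exprSr -mulrA (mulrC eta).
Qed.

(** The derivative with respect to the step of a difference of order k is k
    times a difference of order k - 1 of the first derivative, hence a
    nonnegative multiple of a value of the k-th derivative. *)
Lemma fdiff_step_mono k D (eta1 eta2 s : R) : (0 < k)%N -> 0 <= eta1 -> eta1 <= eta2 ->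
  (forall m x, (m < k)%N -> s <= x <= s + k%:R * eta2 -> is_derive x 1 (D m) (D m.+1 x)) ->
  (forall x, s <= x <= s + k%:R * eta2 -> 0 <= (-1) ^+ k * D k x) ->
  (-1) ^+ k * fdiff k eta1 (D 0%N) s <= (-1) ^+ k * fdiff k eta2 (D 0%N) s.
Proof.
case: k => // k _ e1 e12 HD Dk.
pose dpsi eta := k.+1%:R * fdiff k eta (D 1%N) (s + eta).
have psid x : eta1 <= x <= eta2 ->
    is_derive x 1 (fun eta => fdiff k.+1 eta (D 0%N) s) (dpsi x).
  move=> /andP[x1 x2]; have x0 : 0 <= x by exact: le_trans x1.
  pose h (j : 'I_k.+2) (eta : R) : R := 'C(k.+1,
    j)%:R * (-1) ^+ (k.+1 - j) * D 0%N (s + j%:R * eta).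
  pose dh (j : 'I_k.+2) : R := 'C(k.+1, j)%:R * (-1) ^+ (k.+1 - j) * (j%:R * D 1%N (s + j%:R * x)).
  have hd j : is_derive x 1 (h j) (dh j).
    have jk : (j <= k.+1)%N by rewrite -ltnS.
    have d1 : is_derive x 1 (fun eta : R => s + j%:R * eta) j%:R.
      have -> : (fun eta : R => s + j%:R * eta) = cst s + (j%:R \*: id).
        by apply/funext => y.
      by apply: is_derive_eq; rewrite add0r /GRing.scale/= mulr1.
    have d2 : is_derive (s + j%:R * x) 1 (D 0%N) (D 1%N (s + j%:R * x)).
      apply: HD => //; rewrite lerDl mulr_ge0//= lerD2l ler_pM// ?ler_nat//.
    have d3 := @is_derive1_comp R _ _ x _ _ d2 d1.
    have := @is_deriveZ _ _ _ _ ('C(k.+1, j)%:R * (-1) ^+ (k.+1 - j)) _ _ _ d3.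
    by congr (is_derive _ _ _ _); rewrite /GRing.scale/= /dh; ring.
  have := @is_derive_sum R R R k.+2 h x 1 dh hd.
  have -> : \sum_(i < k.+2) h i = (fun eta => fdiff k.+1 eta (D 0%N) s).
    by apply/funext => eta; rewrite fct_sumE.
  suff -> : \sum_(i < k.+2) dh i = dpsi x by [].
  rewrite big_ord_recl /dh/= mul0r mulr0 add0r /dpsi /fdiff mulr_sumr.
  apply: eq_bigr => j _; rewrite /bump leq0n add1n subSS.
  have -> : s + x + j%:R * x = s + j.+1%:R * x.
    by rewrite -natr1 mulrDl mul1r -addrA (addrC x).
  rewrite !mulrA; congr (_ * _).
  rewrite -[LHS]mulrA [X in _ * X]mulrC mulrA; congr (_ * _).
  by rewrite -!natrM mulnC mul_bin_diag.
have [c /andP[c1 c2] Ec] := MVT_diff e12 psid.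
have c0 : 0 <= c by exact: le_trans c1.
have kE : k.+1%:R * c = k%:R * c + c by rewrite -addn1 natrD mulrDl mul1r.
have kc : k.+1%:R * c <= k.+1%:R * eta2 by rewrite ler_wpM2l.
have [m x mk /andP[sx xs]|xi /andP[sxi xis] E] :=
    @fdiff_mean k (fun m => D m.+1) c (s + c) c0.
  apply: HD => //; rewrite (le_trans _ sx) ?lerDl//=.
  by apply: le_trans xs _; rewrite -addrA [c + _]addrC -kE lerD2l.
rewrite -subr_ge0 -mulrBr Ec /dpsi E.
have := Dk xi; rewrite (le_trans _ sxi) ?lerDl//=.
rewrite (le_trans xis) -?addrA ?[c + _]addrC -?kE ?lerD2l// => /(_ isT) H.
rewrite (_ : _ * _ = ((-1) ^+ k.+1 * D k.+1 xi) * (k.+1%:R * c ^+ k * (eta2 - eta1))); last by ring.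
by rewrite mulr_ge0// mulr_ge0 ?subr_ge0// mulr_ge0// exprn_ge0.
Qed.

End FiniteDifferences.

Section DerivativeChain.
Context {R : realType}.

(** Coefficients in the k-th derivative of a function of a quadratic argument
    (the formula of Faa di Bruno when the inner function has a constant second
    derivative). The truncated subtraction is harmless, as the coefficients
    with 2 j < m vanish. *)
Fixpoint quad_coef (m j : nat) : nat :=
  if m is m'.+1 then
    (if j is j'.+1 then quad_coef m' j' else 0) + (2 * j - m') * quad_coef m' j
  else (j == 0).

Lemma quad_coef_small m j : (2 * j < m)%N -> quad_coef m j = 0%N.
Proof.
elim: m j => // m IH j /=; rewrite ltnS leq_eqVlt => /predU1P[jm|jm].
  rewrite jm subnn mul0n addn0; case: j jm => // j jm.
  by apply: IH; lia.
rewrite (IH j jm) muln0 addn0; case: j jm => // j jm; apply: IH; lia.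
Qed.

Lemma quad_coef_big m j : (m < j)%N -> quad_coef m j = 0%N.
Proof.
elim: m j => [|m IH] [|j] //= mj; rewrite (IH j)//.
by rewrite (IH j.+1) ?muln0// ltnW.
Qed.

Variables (A : nat -> R -> R) (p : R -> R) (H : R).

(** The m-th derivative of A 0 when A j has derivative A (j + 1) p and p has
    the constant derivative H. For A j = Phi_j (|z + s h|) this is the m-th
    derivative of Phi along a line. *)
Definition chain (m : nat) (s : R) : R :=
  \sum_(j < m.+1) (quad_coef m j)%:R * A j s * p s ^+ (2 * j - m) * H ^+ (m - j).

Lemma chain0 s : chain 0 s = A 0%N s.
Proof. by rewrite /chain big_ord1 !expr0 !mulr1 mul1r. Qed.

Lemma chain_derive (k m : nat) (s : R) : (m < k)%N ->
  (forall j, (j < k)%N -> is_derive s 1 (A j) (A j.+1 s * p s)) ->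
  is_derive s 1 p H -> is_derive s 1 (chain m) (chain m.+1 s).
Proof.
move=> mk dA dp.
pose h (j : 'I_m.+1) (x : R) : R :=
  ((quad_coef m j)%:R * H ^+ (m - j)) * (A j x * p x ^+ (2 * j - m)).
pose dh (j : 'I_m.+1) : R := ((quad_coef m j)%:R * H ^+ (m - j)) *
  (A j s * ((2 * j - m)%:R * p s ^+ (2 * j - m).-1 * H) + p s ^+ (2 * j - m) * (A j.+1 s * p s)).
have hd j : is_derive s 1 (h j) (dh j).
  have jk : (j < k)%N by apply: leq_ltn_trans mk; rewrite -ltnS.
  have d1 := @is_deriveX R R p (2 * j - m) s 1 H dp.
  have d2 := @is_deriveM R R (A j) (p ^+ (2 * j - m)) s 1 _ _ (dA _ jk) d1.
  have := @is_deriveZ _ _ _ _ ((quad_coef m j)%:R * H ^+ (m - j)) _ _ _ d2.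
  have pX x : (p ^+ (2 * j - m)) x = p x ^+ (2 * j - m) by rewrite exprfctE.
  congr (is_derive _ _ _ _); first by apply/funext => x; rewrite /h -pX.
  by rewrite pX.
have := @is_derive_sum R R R m.+1 h s 1 dh hd.
have -> : \sum_(i < m.+1) h i = chain m.
  apply/funext => x; rewrite fct_sumE; apply: eq_bigr => j _.
  rewrite /h; move: (_%:R) (p x ^+ _) (H ^+ _) => a b c; ring.
suff -> : \sum_(i < m.+1) dh i = chain m.+1 s by [].
rewrite /chain.
transitivity (\sum_(j < m.+2) (((2 * j - m) * quad_coef m j)%N%:R * A j s *
    p s ^+ (2 * j - m.+1) * H ^+ (m.+1 - j)) +
  \sum_(j < m.+1) ((quad_coef m j)%:R * A j.+1 s *
    p s ^+ (2 * j.+1 - m.+1) * H ^+ (m.+1 - j.+1))); last first.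
  rewrite [in RHS](eq_bigr (fun j : 'I_m.+2 =>
   (((2 * j - m) * quad_coef m j)%N%:R * A j s *
    p s ^+ (2 * j - m.+1) * H ^+ (m.+1 - j)) +
   ((if (j : nat) is j'.+1 then quad_coef m j' else 0%N)%:R * A j s *
    p s ^+ (2 * j - m.+1) * H ^+ (m.+1 - j)))).
    rewrite big_split/=; congr (_ + _).
    by rewrite [RHS]big_ord_recl/= !mul0r add0r.
  by move=> j _; rewrite /= natrD !mulrDl addrC.
rewrite [X in _ = X + _]big_ord_recr/= quad_coef_big// muln0 !mul0r addr0 -big_split.
apply: eq_bigr => j _; rewrite /dh/= mulrDr; congr (_ + _).
  have -> : (m.+1 - j = (m - j).+1)%N by rewrite subSn// -ltnS.
  by rewrite exprS natrM subnS; ring.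
rewrite subSS; case: (ltnP (2 * j) m) => jm.
  by rewrite quad_coef_small// !mul0r.
have -> : (2 * j.+1 - m.+1 = (2 * j - m).+1)%N by lia.
by rewrite exprS; ring.
Qed.

End DerivativeChain.

(** * Derivatives of a radial function along lines *)

Section SmoothOnHalfLine.
Context {R : realType}.
Implicit Types g h : R -> R.

Lemma near_pos (z : R) : 0 < z -> \forall x \near z, 0 < x.
Proof. by move=> z0; exact: lt_nbhsr. Qed.

(** Differentiability of order m on the half line, as a recursion on the
    derivative: this is the form in which products are handled by induction. *)
Fixpoint smooth (m : nat) g : Prop :=
  if m is m'.+1 then
    (forall z, 0 < z -> derivable g z 1) /\ smooth m' (derive1 g)
  else True.

Lemma derive1_near g h (z : R) : 0 < z -> (forall x, 0 < x -> g x = h x) ->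
  derive1 g z = derive1 h z.
Proof.
move=> z0 gh; rewrite !derive1E; apply: near_eq_derive.
by apply: filterS (near_pos z0) => x; exact: gh.
Qed.

Lemma smooth_ext m g h : (forall x, 0 < x -> g x = h x) -> smooth m g -> smooth m h.
Proof.
elim: m g h => // m IH g h gh [dg sg]; split.
  move=> z z0; apply: near_eq_derivable (dg z z0).
  by apply: filterS (near_pos z0) => x; exact: gh.
by apply: IH sg => x x0; exact: derive1_near.
Qed.

Lemma smoothW m g : smooth m.+1 g -> smooth m g.
Proof. by elim: m g => // m IH g [dg /IH]. Qed.

Lemma smoothD m g h : smooth m g -> smooth m h -> smooth m (fun z => g z + h z).
Proof.
elim: m g h => // m IH g h [dg sg] [dh sh]; split.
  by move=> z z0; apply: derivableD; [exact: dg|exact: dh].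
apply: smooth_ext (IH _ _ sg sh) => x x0.
rewrite !derive1E deriveD//; [exact: dg|exact: dh].
Qed.

Lemma smoothM m g h : smooth m g -> smooth m h -> smooth m (fun z => g z * h z).
Proof.
elim: m g h => // m IH g h sg sh; have := smoothW sg; have := smoothW sh.
case: sg sh => dg sg [dh sh] sh' sg'; split.
  by move=> z z0; apply: derivableM; [exact: dg|exact: dh].
apply: smooth_ext (smoothD (IH _ _ sg' sh) (IH _ _ sh' sg)) => x x0.
rewrite !derive1E (deriveM (dg _ x0) (dh _ x0)) /GRing.scale/=; ring.
Qed.

Lemma smooth_cst m (c : R) : smooth m (fun=> c).
Proof.
elim: m c => // m IH c; split; first by move=> z _; exact: derivable_cst.
by apply: smooth_ext (IH 0) => x _; rewrite derive1_cst.
Qed.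

Lemma smoothV m : smooth m (fun z : R => z^-1).
Proof.
elim: m => // m IH; split.
  by move=> z z0; apply: (@derivableV _ _ id) => //; rewrite gt_eqF.
apply: smooth_ext (smoothM (smooth_cst m (-1)) (smoothM IH IH)) => x x0.
rewrite derive1E (@deriveV _ _ id) ?gt_eqF// ?derive_id.
rewrite /GRing.scale/= mulr1 mulN1r -invfM expr2//.
Qed.

Lemma smooth_derive1n k g : (forall j, (j < k)%N -> forall z, 0 < z ->
  derivable (derive1n j g) z 1) -> smooth k g.
Proof.
elim: k g => // k IH g Hg; split; first by move=> z z0; exact: (Hg 0%N).
by apply: IH => j jk z z0; have := Hg j.+1 jk z z0; rewrite /derive1n iterSr.
Qed.

End SmoothOnHalfLine.

Section RadialDerivatives.
Context {R : realType}.
Variables (Phi : R -> R) (k : nat).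
Hypothesis sm : forall j, (j < k)%N -> forall z : R, 0 < z ->
  derivable (derive1n j Phi) z 1.

Lemma Phi_iter_smooth j : (j <= k)%N -> smooth (k - j) (Phi_iter Phi j).
Proof.
elim: j => [|j IH] jk; first by rewrite subn0; exact: smooth_derive1n.
have := IH (ltnW jk); rewrite -subnSK// => -[_ sj].
exact: smoothM (smoothV _) sj.
Qed.

Lemma Phi_iter_derive j (z : R) : (j < k)%N -> 0 < z ->
  is_derive z 1 (Phi_iter Phi j) (Phi_iter Phi j.+1 z * z).
Proof.
move=> jk z0; have := Phi_iter_smooth (ltnW jk); rewrite -subnSK// => -[dj _].
have := derivableP (dj z z0); rewrite -derive1E.
congr (is_derive _ _ _ _).
by rewrite /= mulrC mulrA mulfV ?mul1r// gt_eqF.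
Qed.

(** The ordinary derivatives of Phi are those along a ray: the inner product
    is the radius itself. *)
Lemma radial_derivative m (z : R) : (m <= k)%N -> 0 < z ->
  derive1n m Phi z = chain (Phi_iter Phi) id 1 m z.
Proof.
elim: m z => [|m IH] z mk z0; first by rewrite chain0.
rewrite /derive1n iterS -/(derive1n m Phi).
rewrite (@derive1_near _ _ (chain (Phi_iter Phi) id 1 m))//; last first.
  by move=> x x0; apply: IH => //; exact: ltnW.
rewrite derive1E; apply: derive_val; apply: (@chain_derive _ _ _ _ k) => //.
by move=> j jk; exact: Phi_iter_derive.
Qed.

Variable n : nat.
Implicit Types z h : 'rV[R]_n.

Definition line_arg z h (s : R) : R := dotp z h + s * dotp h h.
Definition line_chain z h (m : nat) (s : R) : R :=
  chain (fun j x => Phi_iter Phi j (enorm (z + x *: h))) (line_arg z h) (dotp h h) m s.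

Lemma enorm_line_derive z h s : z + s *: h != 0 ->
  is_derive s 1 (fun x => enorm (z + x *: h)) (line_arg z h s / enorm (z + s *: h)).
Proof.
move=> zs0.
have q x : dotp (z + x *: h) (z + x *: h) =
    dotp z z + (2 * dotp z h * x + dotp h h * (x * x)).
  rewrite dotpDl !dotpDr !dotpZl !dotpZr (dotpC h z); ring.
have dq : is_derive s 1 (fun x => dotp (z + x *: h) (z + x *: h)) (2 * line_arg z h s).
  have -> : (fun x => dotp (z + x *: h) (z + x *: h)) =
    cst (dotp z z) + (((2 * dotp z h) \*: id) + ((dotp h h) \*: (id * id))).
    by apply/funext => x; rewrite q.
  rewrite /line_arg; move: (dotp z z) (dotp z h) (dotp h h) => a b c.
  have d1 : is_derive s 1 (id : R -> R) 1 by exact: is_derive_id.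
  have := is_deriveD (is_derive_cst a s 1)
    (is_deriveD (is_deriveZ (2 * b) d1) (is_deriveZ c (is_deriveM d1 d1))).
  by congr (is_derive _ _ _ _); rewrite /GRing.scale/=; ring.
have d1 : is_derive (dotp (z + s *: h) (z + s *: h)) 1 Num.sqrt
    (2 * Num.sqrt (dotp (z + s *: h) (z + s *: h)))^-1.
  apply: is_derive1_sqrt; rewrite -sqr_enorm exprn_gt0// enorm_gt0//.
have := @is_derive1_comp _ _ _ s _ _ d1 dq.
have -> : Num.sqrt \o (fun x => dotp (z + x *: h) (z + x *: h)) =
    (fun x => enorm (z + x *: h)).
  by apply/funext => x; rewrite /= enormE.
congr (is_derive _ _ _ _); rewrite -enormE; field.
by rewrite gt_eqF// enorm_gt0.
Qed.

Lemma line_derive z h m s : (m < k)%N -> z + s *: h != 0 ->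
  is_derive s 1 (line_chain z h m) (line_chain z h m.+1 s).
Proof.
move=> mk zs0; have rho0 := enorm_gt0 zs0.
apply: (@chain_derive _ _ _ _ k) => //.
  move=> j jk; have := Phi_iter_derive jk rho0 => d1.
  have := @is_derive1_comp _ _ _ s _ _ d1 (enorm_line_derive zs0).
  by congr (is_derive _ _ _ _); field; rewrite gt_eqF.
have -> : line_arg z h = cst (dotp z h) + (dotp h h \*: id).
  by apply/funext => x; rewrite /line_arg mulrC.
by apply: is_derive_eq; rewrite add0r /GRing.scale/= mulr1.
Qed.

Lemma line_chain0 z h s : line_chain z h 0 s = Phi (enorm (z + s *: h)).
Proof. by rewrite /line_chain chain0. Qed.

Definition coef_sum : R := \sum_(j < k.+1) (quad_coef k j)%:R.

Hypothesis k0 : (0 < k)%N.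

(** The power of the inner product with h in each term leaves the same
    homogeneity, |h|^k / |z + s h|^k, for all of them. *)
Lemma line_chain_le z h s (M : R) : z + s *: h != 0 -> 0 <= M ->
  (forall j, (0 < j <= k)%N ->
     enorm (z + s *: h) ^+ (2 * j) * `|Phi_iter Phi j (enorm (z + s *: h))| <= M) ->
  `|line_chain z h k s| <= coef_sum * M * enorm (z + s *: h) ^- k * enorm h ^+ k.
Proof.
move=> zs0 M0 HM; have rho0 := enorm_gt0 zs0; set rho := enorm (z + s *: h).
rewrite /line_chain /chain; apply: le_trans (ler_norm_sum _ _ _) _.
rewrite /coef_sum !mulr_suml; apply: ler_sum => j _.
have jk : (j <= k)%N by rewrite -ltnS.
have [jk2|kj2] := ltnP (2 * j) k.
  by rewrite quad_coef_small// !mul0r normr0.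
have j0 : (0 < j)%N by lia.
rewrite !normrM normr_nat -!mulrA; apply: ler_wpM2l => //.
have HE : `|dotp h h ^+ (k - j)| = enorm h ^+ (2 * (k - j)).
  by rewrite -sqr_enorm -exprM ger0_norm// exprn_ge0// enorm_ge0.
rewrite HE normrX.
have pb : `|line_arg z h s| <= rho * enorm h.
  rewrite (_ : line_arg z h s = dotp (z + s *: h) h) ?dotp_le//.
  by rewrite dotpDl dotpZl.
have := @HM j; rewrite j0 jk => /(_ isT); rewrite -/rho => HMj.
apply: (@le_trans _ _ (`|Phi_iter Phi j rho| * ((rho * enorm h) ^+ (2 * j - k) *
    enorm h ^+ (2 * (k - j))))).
  apply: ler_wpM2l => //; apply: ler_wpM2r; first by rewrite exprn_ge0// enorm_ge0.
  by rewrite lerXn2r// nnegrE ?mulr_ge0 ?enorm_ge0.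
rewrite exprMn -mulrA -exprD (_ : 2 * j - k + 2 * (k - j) = k)%N; last by lia.
rewrite !mulrA; apply: ler_wpM2r; first by rewrite exprn_ge0 ?enorm_ge0.
rewrite ler_pdivlMr ?exprn_gt0//.
by rewrite -mulrA -exprD subnK// mulrC.
Qed.

(** When h is nearly parallel to z + s h, the powers of their inner product
    differ little from powers of the norm, and the latter yield the radial
    derivative. *)
Lemma line_chain_cone z h s (M q : R) : z + s *: h != 0 -> 0 <= M -> 0 <= q <= 1 ->
  enorm h = 1 -> q * enorm (z + s *: h) <= dotp (z + s *: h) h ->
  (forall j, (0 < j <= k)%N ->
     enorm (z + s *: h) ^+ (2 * j) * `|Phi_iter Phi j (enorm (z + s *: h))| <= M) ->
  `|line_chain z h k s - derive1n k Phi (enorm (z + s *: h))| <=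
    coef_sum * M * enorm (z + s *: h) ^- k * (1 - q ^+ k).
Proof.
move=> zs0 M0 /andP[q0 q1] h1 hq HM; have rho0 := enorm_gt0 zs0.
rewrite radial_derivative//; set rho := enorm (z + s *: h) in hq HM rho0 *.
rewrite /line_chain /chain -sumrB; apply: le_trans (ler_norm_sum _ _ _) _.
rewrite /coef_sum !mulr_suml; apply: ler_sum => j _.
have jk : (j <= k)%N by rewrite -ltnS.
have [jk2|kj2] := ltnP (2 * j) k.
  by rewrite quad_coef_small// !mul0r subr0 normr0.
have j0 : (0 < j)%N by lia.
have hh : dotp h h = 1 by rewrite -sqr_enorm h1 expr1n.
have pE : line_arg z h s = dotp (z + s *: h) h by rewrite dotpDl dotpZl.
rewrite hh expr1n !mulr1 -mulrBr !normrM normr_nat -!mulrA; apply: ler_wpM2l => //.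
set p := line_arg z h s.
have p0 : 0 <= p by rewrite /p pE; apply: le_trans hq; rewrite mulr_ge0// ltW.
have prho : p <= rho.
  rewrite /p pE; apply: le_trans (ler_norm _) _.
  by apply: le_trans (dotp_le _ _) _; rewrite h1 mulr1.
have := @HM j; rewrite j0 jk => /(_ isT) HMj.
set e := (2 * j - k)%N; have ek : (e <= k)%N by rewrite /e; lia.
have pe : `|p ^+ e - id rho ^+ e| <= rho ^+ e * (1 - q ^+ k).
  rewrite ler0_norm ?subr_le0 ?lerXn2r ?nnegrE ?(ltW rho0)// opprB mulrBr mulr1 lerD2l lerN2.
  apply: (@le_trans _ _ ((q * rho) ^+ e)); last first.
    by rewrite lerXn2r ?nnegrE ?mulr_ge0 ?(ltW rho0)// /p pE.
  rewrite exprMn mulrC ler_wpM2r ?exprn_ge0 ?(ltW rho0)//.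
  exact: ler_wiXn2l.
apply: (@le_trans _ _ (`|Phi_iter Phi j rho| * (rho ^+ e * (1 - q ^+ k)))).
  by apply: ler_wpM2l.
rewrite !mulrA; apply: ler_wpM2r; first by rewrite subr_ge0 exprn_ile1.
by rewrite ler_pdivlMr ?exprn_gt0// -mulrA -exprD subnK// mulrC.
Qed.

(** Away from the origin the iterated chain rule supplies the derivatives
    needed by the mean value theorem for differences. *)
Lemma radial_fdiff_mean z h (eta : R) : 0 <= eta ->
  (forall s, 0 <= s <= k%:R * eta -> z + s *: h != 0) ->
  exists2 xi, 0 <= xi <= k%:R * eta &
    fdiff k eta (fun s => Phi (enorm (z + s *: h))) 0 = eta ^+ k * line_chain z h k xi.
Proof.
move=> eta0 Hz.
have -> : (fun s => Phi (enorm (z + s *: h))) = line_chain z h 0.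
  by apply/funext => s; rewrite line_chain0.
have [|xi] := @fdiff_mean R k (line_chain z h) eta 0 eta0.
  by move=> m x mk; rewrite add0r => /Hz; exact: line_derive.
by rewrite add0r => xik E; exists xi.
Qed.

End RadialDerivatives.

(** * Uniform continuity of potentials *)

Section UniformContinuity.
Local Open Scope ereal_scope.
Context {R : realType}.

Lemma dominated_small (h : nat -> R -> R) (H : R -> R) :
  (forall m, measurable_fun setT (h m : measurableTypeR R -> R)) ->
  measurable_fun setT (H : measurableTypeR R -> R) ->
  (forall m s, 0 <= h m s <= H s)%R -> \int[leb]_s (H s)%:E < +oo ->
  (forall s, h m s @[m --> \oo] --> 0%R) ->
  forall e : R, (0 < e)%R -> exists m, \int[leb]_s (h m s)%:E < e%:E.
Proof.
move=> mh mH hH HI h0 e e0.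
have H0 s : (0 <= H s)%R by case/andP: (hH 0%N s) => /le_trans h1 /h1.
have HI' : leb.-integrable setT (EFin \o H).
  apply/integrableP; split; first exact/measurable_EFinP.
  by under eq_integral do rewrite /= ger0_norm//.
have m1 m : measurable_fun setT (fun s : measurableTypeR R => (h m s)%:E).
  exact/measurable_EFinP.
have d1 : {ae leb, forall s, setT s -> (h m s)%:E @[m --> \oo] --> cst 0 s}.
  apply: aeW => s _; apply: cvg_EFin; first exact: nearW.
  exact: h0.
have d2 : {ae leb, forall s m, setT s -> `|(h m s)%:E| <= (EFin \o H) s}.
  by apply: aeW => s m _; rewrite /= lee_fin ger0_norm//; case/andP: (hH m s).
have [_ _] := dominated_convergence measurableT m1 (measurable_cst 0) d1 HI' d2.
rewrite integral0 => cv; apply/not_existsP => He.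
have : e%:E <= 0.
  rewrite -(cvg_lim _ cv)//; apply: lime_ge; first by apply/cvg_ex; exists 0.
  by apply: nearW => m; rewrite leNgt; apply/negP/He.
by rewrite lee_fin leNgt e0.
Qed.

End UniformContinuity.

Section UniformContinuityPotential.
Context {R : realType}.

Definition clamp (r1 r2 u : R) : R := Num.max r1 (Num.min u r2).

Lemma clamp_bounds (r1 r2 u : R) : r1 <= r2 -> r1 <= clamp r1 r2 u <= r2.
Proof. by move=> r12; rewrite /clamp maxEle minEle; do ?case: ifP; lra. Qed.

Lemma clamp_lip (r1 r2 u v : R) : r1 <= r2 -> u <= v ->
  0 <= clamp r1 r2 v - clamp r1 r2 u <= v - u.
Proof. by move=> r12 uv; rewrite /clamp !maxEle !minEle; do ?case: ifP; lra. Qed.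

Lemma clamp_gt (r1 r2 u : R) : r1 <= r2 -> r2 < u -> clamp r1 r2 u = r2.
Proof. by move=> r12 uv; rewrite /clamp maxEle minEle; do ?case: ifP; lra. Qed.

Lemma decr0D (g h : R -> R) : decr0 g -> decr0 h -> decr0 (fun s => g s + h s).
Proof.
move=> [g0 gN gd] [h0 hN hd]; split => [s|s s0|s t s0 st].
- exact: addr_ge0.
- by rewrite gN// hN// addr0.
- by apply: lerD; [exact: gd|exact: hd].
Qed.

Lemma decr0Z (c : R) (g : R -> R) : 0 <= c -> decr0 g -> decr0 (fun s => c * g s).
Proof.
move=> c0 [g0 gN gd]; split => [s|s s0|s t s0 st].
- exact: mulr_ge0.
- by rewrite gN// mulr0.
- by apply: ler_wpM2l => //; exact: gd.
Qed.

Lemma decr0_upto (tau : R) : decr0 (fun s : R => if 0 < s <= tau then 1 else 0).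
Proof.
split => [s|s s0|s t s0 st]; first by case: ifP.
  by rewrite ltNge s0.
case: ifP => [/andP[_ tt]|_]; last by case: ifP.
by rewrite s0 (le_trans st tt).
Qed.

Variables (n : nat) (E : ri_space_Rn R n) (Et : ri_space_Rplus R).
Hypothesis rep : representation_space E Et.
Hypothesis n0 : (0 < n)%N.
Variable Phi : R -> R.
Hypothesis Phi0 : (forall z, 0 < z -> 0 <= Phi z)%R.
Hypothesis Phid : (forall z w, 0 < z -> z <= w -> Phi w <= Phi z)%R.
Hypothesis PhiI : (0 < \int[leb]_(z in Rplus) (Phi z * z ^+ n.-1)%:E < +oo)%E.
Hypothesis Philip : forall r1 r2 : R, 0 < r1 -> exists2 L, 0 <= L &
  forall u v, r1 <= u -> u <= v -> v <= r2 -> Phi u - Phi v <= L * (v - u).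

Let ph := phi0 Phi n.
Let pD : decr0 ph := phi0_decr0 n Phi0 Phid.

Variable F : 'rV[R]_n -> R.
Hypotheses (mF : measurable_fun setT F) (F0 : forall x, (0 <= F x)%R).
Hypothesis EF : (E (EFin \o F) < +oo)%E.
Let sig := rearr_fun F.
Let sD : decr0 sig := rearr_fun_decr0 rep mF F0 EF.
Hypothesis psI : (\int[leb]_s (ph s * sig s)%:E < +oo)%E.

Lemma rearr_locally_integrable (tau : R) : 0 < tau ->
  (\int[leb]_s ((if 0 < s <= tau then 1 else 0) * sig s)%:E < +oo)%E.
Proof.
move=> tau0.
have mA : measurable [set` `]0%R, tau]%R] by exact: measurable_itv.
have AR : [set` `]0%R, tau]%R] `<=` @Rplus R.
  by move=> t /=; rewrite in_itv/= => /andP[t0 _]; exact/RplusP.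
have Afin : (leb [set` `]0%R, tau]%R] < +oo)%E by rewrite lebesgue_0itv ?ltry// ltW.
have [C C0 HC] := fnorm_integral Et mA AR Afin.
have := HC _ (Mplus_decr0 sD); rewrite (fnorm_rearr_fun rep mF F0 EF) => H.
apply: le_lt_trans (_ : (C%:E * E (EFin \o F) < +oo)%E); last first.
  by rewrite lte_mul_pinfty ?lee_fin ?ltW.
apply: le_trans H; rewrite [leRHS]integral_mkcond le_eqVlt; apply/orP; left; apply/eqP.
apply: eq_integral => s _; rewrite patchE.
have -> : (s \in [set` `]0%R, tau]%R]) = (0 < s <= tau).
  by apply/idP/idP; rewrite inE/= in_itv.
by case: ifP => _; rewrite ?mul1r ?mul0r.
Qed.

Lemma Phi_phi0 (r : R) : 0 < r -> Phi r = ph (ball_volume n * r ^+ n).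
Proof.
move=> r0; have V0 := @ball_volume_gt0 R n.
rewrite /ph /phi0 extend0E ?mulr_gt0 ?exprn_gt0// /profile.
by rewrite mulrAC mulfV ?gt_eqF// mul1r expn_root// ltW.
Qed.

(** The peak of the kernel above the level Phi (1 / m) lives on a ball that
    shrinks to the origin: dominated convergence. *)
Lemma near_kernel_small (e : R) : 0 < e -> exists m : nat,
  (\int[leb]_s (Num.max (ph s - Phi m.+1%:R^-1) 0 * sig s)%:E < e%:E)%E.
Proof.
have [p0 pN pd] := pD; have [s0 sN sd] := sD.
have mp := decr0_measurable pD; have ms := decr0_measurable sD.
apply: (@dominated_small _ (fun m s => Num.max (ph s - Phi m.+1%:R^-1) 0 * sig s)
  (fun s => ph s * sig s)) => //.
- move=> m; apply: measurable_funM => //; apply: measurable_maxr => //.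
  by apply: measurable_funB.
- exact: measurable_funM.
- move=> m s; rewrite mulr_ge0 ?le_max ?lexx ?orbT//= ler_wpM2r//.
  by rewrite ge_max p0 andbT gerBl Phi0// invr_gt0.
move=> s; apply: (@cvg_near_cst _ _ _ _ \oo).
have [sp|sp] := ltP 0 s; last first.
  apply: nearW => m; rewrite (sN s sp) mulr0//.
pose r := (s / ball_volume n) `^ n%:R^-1.
have V0 := @ball_volume_gt0 R n.
have r0 : 0 < r by rewrite powR_gt0// divr_gt0.
exists (Num.truncn r^-1) => // m /= mr.
have mr' : m.+1%:R^-1 <= r.
  rewrite -[leRHS]invrK lef_pV2 ?posrE ?invr_gt0//.
  by apply: (le_trans (ltW (truncnS_gt _))); rewrite ler_nat ltnS.
rewrite max_r ?mul0r// subr_le0 /ph /phi0 extend0E//.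
by apply: Phid => //; rewrite invr_gt0.
Qed.

(** A nonincreasing integrable profile satisfies s * phi s <= const. *)
Lemma Phi_at_infty (e : R) : 0 < e -> exists M : nat, forall m : nat, (M <= m)%N ->
  Phi m.+1%:R <= e.
Proof.
move=> e0; have V0 := @ball_volume_gt0 R n.
have [p0 pN pd] := pD.
have pI : (\int[leb]_s (ph s)%:E)%E \is a fin_num.
  rewrite ge0_fin_numE; first exact: (integral_phi0_lty n0 Phi0 Phid PhiI).
  by apply: integral_ge0 => s _; rewrite lee_fin p0.
pose I := fine (\int[leb]_s (ph s)%:E)%E.
have I0 : 0 <= I.
  by rewrite fine_ge0//; apply: integral_ge0 => s _; rewrite lee_fin p0.
have H tau : 0 < tau -> tau * ph tau <= I.
  move=> tau0; rewrite -lee_fin fineK// mulrC.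
  have -> : ((ph tau * tau)%:E = \int[leb]_s (ph tau * (\1_[set` `]0%R, tau]%R] s))%:E)%E.
    rewrite int_scale//; rewrite integral_indic// setIT.
    change ((ph tau * tau)%:E = (ph tau)%:E * leb [set` `]0%R, tau]%R])%E.
    by rewrite lebesgue_0itv ?ltW// EFinM.
  apply: int_le.
  - by apply: measurable_funM => //; apply: measurable_indic; exact: measurable_itv.
  - exact: (decr0_measurable pD).
  - by move=> s; rewrite mulr_ge0.
  move=> s; rewrite indicE; case: (boolP (s \in _)) => [|_]; last by rewrite mulr0.
  by rewrite inE/= in_itv/= mulr1 => /andP[sp st]; exact: pd.
exists (Num.truncn (I / (e * ball_volume n))) => m mM.
have m0 : 0 < m.+1%:R :> R by [].
rewrite Phi_phi0//; set tau := _ * _.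
have tauE : ball_volume n * m.+1%:R <= tau.
  rewrite /tau ler_pM2l// -[leLHS]expr1; apply: ler_weXn2l => //.
  by rewrite ler1n.
have tau0 : 0 < tau by apply: lt_le_trans tauE; exact: mulr_gt0.
rewrite -(ler_pM2l tau0); apply: le_trans (H _ tau0) _.
apply: (@le_trans _ _ (ball_volume n * m.+1%:R * e)); last by rewrite ler_pM2r.
have : I / (e * ball_volume n) <= m.+1%:R.
  by apply: (le_trans (ltW (truncnS_gt _))); rewrite ler_nat ltnS.
rewrite ler_pdivrMr ?mulr_gt0// => /le_trans; apply.
by rewrite le_eqVlt; apply/orP; left; apply/eqP; ring.
Qed.

Lemma far_kernel_small (e : R) (m0 : nat) : 0 < e -> exists2 m : nat, (m0 <= m)%N &
  (\int[leb]_s (Num.min (ph s) (Phi m.+1%:R) * sig s)%:E < e%:E)%E.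
Proof.
have [p0 pN pd] := pD; have [s0 sN sd] := sD.
have mp := decr0_measurable pD; have ms := decr0_measurable sD.
move=> e0.
have [|m Hm|H0|s|m Hm] := @dominated_small _ (fun m s => Num.min (ph s) (Phi
  (m0 + m).+1%:R) * sig s)
  (fun s => ph s * sig s) _ _ _ psI _ e e0.
- move=> m; apply: measurable_funM => //; exact: measurable_minr.
- exact: measurable_funM.
- move=> s; rewrite mulr_ge0 ?le_min ?p0 ?Phi0//= ler_wpM2r//.
  by rewrite ge_min lexx.
- apply/cvgrPdist_le => d d0.
  have [M HM] := @Phi_at_infty (d / (sig s + 1)) (divr_gt0 d0 (ltr_wpDl (s0 s) ltr01)).
  exists M => // m /= Mm; rewrite sub0r normrN ger0_norm; last first.
    by rewrite mulr_ge0// le_min p0 Phi0.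
  apply: (@le_trans _ _ (d / (sig s + 1) * (sig s + 1))); last first.
    by rewrite divfK// gt_eqF// ltr_wpDl.
  apply: ler_pM => //; rewrite ?le_min ?p0 ?Phi0 ?lerDl//.
  by rewrite ge_min HM ?orbT// (leq_trans Mm)// leq_addl.
by exists (m0 + m)%N => //; rewrite leq_addr.
Qed.

(** Clamping the radius to [r1, r2] splits the kernel into a peak at the
    origin, a small tail, and a part to which the local Lipschitz condition
    applies. *)
Lemma kernel_split (r1 r2 u : R) : 0 < r1 -> r1 <= r2 -> 0 < u ->
  Phi u = Num.max (Phi u - Phi r1) 0 + Num.min (Phi u) (Phi r2) +
          (Phi (clamp r1 r2 u) - Phi r2).
Proof.
move=> r10 r12 u0.
have B12 : Phi r2 <= Phi r1 by exact: Phid.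
have [ur1|ur1] := lerP u r1.
  have B : Phi r1 <= Phi u by exact: Phid.
  have -> : clamp r1 r2 u = r1 by rewrite /clamp maxEle minEle; do ?case: ifP; lra.
  by rewrite maxEle minEle; do ?case: ifP; lra.
have B : Phi u <= Phi r1 by apply: Phid => //; exact: ltW.
have [ur2|ur2] := lerP u r2.
  have B2 : Phi r2 <= Phi u by exact: Phid.
  have -> : clamp r1 r2 u = u by rewrite /clamp maxEle minEle; do ?case: ifP; lra.
  by rewrite maxEle minEle; do ?case: ifP; lra.
have B2 : Phi u <= Phi r2 by apply: Phid; rewrite ?(ltW ur2)// (lt_le_trans r10).
rewrite clamp_gt//.
by rewrite maxEle minEle; do ?case: ifP; lra.
Qed.

(** The two unbounded parts are bounded by themselves and the clamped part by
    its Lipschitz constant; the result is a nonincreasing function K of nu, so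
    that Hardy-Littlewood applies to the convolution with it. *)
Lemma kernel_lipschitz (r1 r2 : R) : 0 < r1 -> r1 <= r2 -> exists2 L, 0 <= L &
  forall a b : 'rV[R]_n, a != 0 -> b != 0 ->
  `|Phi (enorm a) - Phi (enorm b)| <=
   let K s := Num.max (ph s - Phi r1) 0 + Num.min (ph s) (Phi r2) +
     L * enorm (a - b) * (if 0 < s <= ball_volume n * r2 ^+ n then 1 else 0) in
   K (nu a) + K (nu b).
Proof.
move=> r10 r12; have [L L0 HL] := Philip r2 r10; exists L => // a b a0 b0 /=.
have r20 : 0 < r2 by exact: lt_le_trans r12.
have na0 := enorm_gt0 a0; have nb0 := enorm_gt0 b0.
rewrite /ph !phi0_nu// !nu_gt0//= !nu_le_enorm ?(ltW r20)//.
rewrite {1}(kernel_split r10 r12 na0) {1}(kernel_split r10 r12 nb0).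
set Na := Num.max (Phi (enorm a) - _) 0; set Nb := Num.max (Phi (enorm b) - _) 0.
set Wa := Num.min (Phi (enorm a)) _; set Wb := Num.min (Phi (enorm b)) _.
have Na0 : 0 <= Na by rewrite /Na le_max lexx orbT.
have Nb0 : 0 <= Nb by rewrite /Nb le_max lexx orbT.
have Wa0 : 0 <= Wa by rewrite /Wa le_min !Phi0.
have Wb0 : 0 <= Wb by rewrite /Wb le_min !Phi0.
set ia := (if _ then 1 else 0 : R); set ib := (if _ then 1 else 0 : R).
have ia0 : 0 <= ia by rewrite /ia; case: ifP.
have ib0 : 0 <= ib by rewrite /ib; case: ifP.
set d := enorm (a - b).
have d0 : 0 <= d by exact: enorm_ge0.
have aux u v : u <= v -> v - u <= d ->
    0 <= Phi (clamp r1 r2 u) - Phi (clamp r1 r2 v) <= L * d.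
  move=> uv uvd; have /andP[c1 c2] := clamp_lip r12 uv.
  have /andP[u1 u2] := clamp_bounds u r12; have /andP[v1 v2] := clamp_bounds v r12.
  have uvc : clamp r1 r2 u <= clamp r1 r2 v by rewrite -subr_ge0.
  rewrite subr_ge0 Phid ?(lt_le_trans r10)//=.
  apply: le_trans (HL _ _ u1 uvc v2) _; apply: ler_wpM2l => //.
  exact: le_trans c2 uvd.
have dab : enorm a - enorm b <= d.
  by have := enorm_lb a (- b); rewrite enormN.
have dba : enorm b - enorm a <= d.
  by have := enorm_lb b (- a); rewrite enormN /d enormB.
have key : `|Phi (clamp r1 r2 (enorm a)) - Phi (clamp r1 r2 (enorm b))| <=
    L * d * ia + L * d * ib.
  have Ld : 0 <= L * d by exact: mulr_ge0.
  have [ar2|ar2] := leP (enorm a) r2.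
    have -> : ia = 1 by rewrite /ia ar2.
    rewrite mulr1; apply: (@le_trans _ _ (L * d)); last by rewrite lerDl mulr_ge0.
    case: (leP (enorm a) (enorm b)) => ab.
      by have /andP[? ?] := aux _ _ ab dba; rewrite ger0_norm.
    by have /andP[? ?] := aux _ _ (ltW ab) dab; rewrite distrC ger0_norm.
  have [br2|br2] := leP (enorm b) r2.
    have -> : ib = 1 by rewrite /ib br2.
    rewrite mulr1; apply: (@le_trans _ _ (L * d)); last by rewrite lerDr mulr_ge0.
    case: (leP (enorm a) (enorm b)) => ab.
      by have /andP[? ?] := aux _ _ ab dba; rewrite ger0_norm.
    by have /andP[? ?] := aux _ _ (ltW ab) dab; rewrite distrC ger0_norm.
  by rewrite !clamp_gt// subrr normr0 addr_ge0// mulr_ge0.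
move: key; rewrite !ler_norml; lra.
Qed.

(** The peak and the tail of the kernel contribute little uniformly in the
    point, by Hardy-Littlewood; the rest contributes at most a multiple of |x
    - y|, because the rearrangement is locally integrable. *)
Lemma pot_unif_cont (f : 'rV[R]_n -> R) (e : R) :
  measurable_fun setT f -> (forall x, `|f x| <= F x) -> 0 < e ->
  exists2 r : R, 0 < r &
    forall x y, enorm (x - y) < r -> `|pot ph f x - pot ph f y| < e.
Proof.
move=> mf fF e0.
(* three parts of the kernel at each of the two points *)
have e6 : 0 < e / 6 by rewrite divr_gt0.
have [m1 Hm1] := near_kernel_small e6.
have [m2 m12 Hm2] := far_kernel_small m1 e6.
pose r1 : R := m1.+1%:R^-1; pose r2 : R := m2.+1%:R.
have r10 : 0 < r1 by rewrite invr_gt0.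
have r12 : r1 <= r2.
  apply: (@le_trans _ _ 1); last by rewrite ler1n.
  by rewrite invf_le1// ler1n.
have r20 : 0 < r2 by exact: lt_le_trans r12.
have [L L0 HL] := kernel_lipschitz r10 r12.
pose tau := ball_volume n * r2 ^+ n.
have tau0 : 0 < tau by rewrite mulr_gt0 ?ball_volume_gt0// exprn_gt0.
pose chi (s : R) : R := if 0 < s <= tau then 1 else 0.
have chiD : decr0 chi by exact: decr0_upto.
have chiI := rearr_locally_integrable tau0.
have [p0 pN pd] := pD; have [s0 sN sd] := sD; have [c0 cN cd] := chiD.
pose N s := Num.max (ph s - Phi r1) 0.
pose W s := Num.min (ph s) (Phi r2).
have ND : decr0 N.
  split => [s|s sl|s t sp st]; rewrite /N.
  - by rewrite le_max lexx orbT.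
  - by rewrite pN// sub0r max_r// oppr_le0 Phi0.
  - by rewrite ge_max !le_max lerD2r pd// lexx orbT.
have WD : decr0 W.
  split => [s|s sl|s t sp st]; rewrite /W.
  - by rewrite le_min p0 Phi0.
  - by rewrite pN// min_l// Phi0.
  - by rewrite le_min !ge_min lexx pd// orbT.
pose I := fine (\int[leb]_s (chi s * sig s)%:E)%E.
have int0 (g : R -> R) : decr0 g -> (0 <= \int[leb]_s (g s * sig s)%:E)%E.
  by move=> [g0 _ _]; apply: integral_ge0 => s _; rewrite lee_fin mulr_ge0.
have IE : (\int[leb]_s (chi s * sig s)%:E = I%:E)%E.
  by rewrite fineK// ge0_fin_numE//; exact: int0.
have I0 : 0 <= I by rewrite fine_ge0//; exact: int0.
pose r := e / (6 * (L * I + 1)).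
have LI0 : 0 < L * I + 1 by rewrite ltr_wpDl// mulr_ge0.
have rr0 : 0 < r by rewrite divr_gt0// mulr_gt0.
exists r => // x y xyr.
have c1 : 0 <= L * enorm (x - y) by rewrite mulr_ge0// enorm_ge0.
pose K s := N s + W s + L * enorm (x - y) * chi s.
have KD : decr0 K by apply: decr0D; [exact: decr0D|exact: decr0Z].
have ms := decr0_measurable sD.
have KI : (\int[leb]_s (K s * sig s)%:E < (e / 2)%:E)%E.
  have -> : (\int[leb]_s (K s * sig s)%:E = \int[leb]_s (N s * sig s)%:E +
     \int[leb]_s (W s * sig s)%:E + (L * enorm (x - y) * I)%:E)%E.
    have mNs : measurable_fun setT (fun s : measurableTypeR R => N s * sig s).
      by apply: measurable_funM => //; exact: (decr0_measurable ND).
    have mWs : measurable_fun setT (fun s : measurableTypeR R => W s * sig s).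
      by apply: measurable_funM => //; exact: (decr0_measurable WD).
    have mCs : measurable_fun setT (fun s : measurableTypeR R => chi s * sig s).
      by apply: measurable_funM => //; exact: (decr0_measurable chiD).
    have [N0 _ _] := ND; have [W0 _ _] := WD.
    rewrite EFinM -IE -int_scale//; last by move=> s; rewrite mulr_ge0.
    rewrite -int_add//; last 2 first.
    - by move=> s; rewrite mulr_ge0.
    - by move=> s; rewrite mulr_ge0.
    rewrite -int_add//; last 4 first.
    - exact: measurable_funD.
    - by apply: measurable_funM.
    - by move=> s; rewrite addr_ge0// mulr_ge0.
    - by move=> s; rewrite mulr_ge0// mulr_ge0.
    by apply: eq_integral => s _; congr EFin; rewrite /K; ring.
  have -> : e / 2 = e / 6 + e / 6 + e / 6 by field.
  rewrite 2!EFinD; apply: lte_leD => //; first exact: lteD.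
  rewrite lee_fin; apply: (@le_trans _ _ (r * (L * I + 1))).
    rewrite (_ : L * enorm (x - y) * I = enorm (x - y) * (L * I)); last by ring.
    by apply: ler_pM; rewrite ?enorm_ge0 ?mulr_ge0 ?(ltW xyr)// lerDl.
  rewrite /r le_eqVlt; apply/orP; left; apply/eqP; field.
  by rewrite gt_eqF.
have [Hi He] := @pot_sum R n E Et rep n0 F mF F0 EF f ph mf fF pD psI bool
  [:: true; false] (fun b => if b then 1 else -1) (fun b => if b then x else y).
have -> : pot ph f x - pot ph f y = \sum_(b <- [:: true; false])
    (if b then 1 else -1) * pot ph f (if b then x else y).
  by rewrite big_cons big_cons big_nil /= mul1r mulN1r addr0.
rewrite He -lte_fin EFin_normr_Rintegral//.
have mK (b : 'rV[R]_n) : measurable_fun setT (fun w : 'rV[R]_n => K (nu (b - w)) * F w).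
  by apply: measurable_funM => //; exact: (measurable_comp_sub b (measurable_radial KD)).
have [K0 KN Kd] := KD.
apply: (@le_lt_trans _ _ (\int[lebesgue_rV n]_w (K (nu (x - w)) * F w + K (nu
  (y - w)) * F w)%:E)%E).
  apply: le_trans (le_abse_integral _ _ _) _ => //.
    by case/integrableP: Hi.
  apply: ae_ge0_le_integral => //.
  - by case/integrableP: Hi => mH _; exact: measurableT_comp.
  - by move=> w _; rewrite lee_fin addr_ge0// mulr_ge0.
  - by apply/measurable_EFinP; exact: measurable_funD.
  exists ([set x] `|` [set y]); split.
  - by apply: measurableU; exact: measurable_rV_point.
  - by rewrite null_set_setU//; try exact: measurable_rV_point; exact: lebesgue_rV_point.
  move=> w /= /not_implyP[_ Hw]; apply: contrapT => /not_orP[wx wy]; apply: Hw.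
  have xw : x - w != 0 by rewrite subr_eq0; apply/eqP => E1; apply: wx; rewrite E1.
  have yw : y - w != 0 by rewrite subr_eq0; apply/eqP => E1; apply: wy; rewrite E1.
  rewrite lee_fin big_cons big_cons big_nil /= mul1r mulN1r addr0 normrM -mulrDl.
  apply: ler_pM => //.
  rewrite /ph !phi0_nu//; apply: le_trans (HL _ _ xw yw) _.
  rewrite /= (_ : x - w - (y - w) = x - y); last by rewrite opprB addrA subrK.
  by rewrite lexx.
rewrite int_add//; last 2 first.
- by move=> w; rewrite mulr_ge0.
- by move=> w; rewrite mulr_ge0.
have -> : e%:E = ((e / 2)%:E + (e / 2)%:E)%E by rewrite -EFinD; congr EFin; field.
by apply: lteD; apply: le_lt_trans KI; exact: (conv_bound rep n0 mF F0 EF).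
Qed.

End UniformContinuityPotential.

(** * Upper bound for differences of the kernel *)

Section UpperEstimate.
Context {R : realType}.
Variables (n k : nat) (T a1 a2 : R) (Phi : R -> R).
Hypotheses (n0 : (0 < n)%N) (k0 : (0 < k)%N) (T0 : 0 < T).
Hypotheses (a10 : 0 <= a1) (a20 : 0 <= a2).
Hypothesis Phi0 : forall z, 0 < z -> 0 <= Phi z.
Hypothesis Phid : forall z w, 0 < z -> z <= w -> Phi w <= Phi z.
Hypothesis sm : forall j, (j < k)%N -> forall z : R, 0 < z ->
  derivable (derive1n j Phi) z 1.
Hypothesis HM : forall z j, 0 < z -> (0 < j <= k)%N ->
  z ^+ (2 * j) * `|Phi_iter Phi j z| <= (a1 + a2 * z ^+ k) * Phi z.

Let V : R := ball_volume n.
Let V0 : 0 < V := ball_volume_gt0 n.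
Let kn : R := k%:R / n%:R.
Let Vk : R := V `^ kn.
Let ph := phi0 Phi n.
Let pD : decr0 ph := phi0_decr0 n Phi0 Phid.
Implicit Types x y z w h : 'rV[R]_n.

(** The weight Omega of the cone, extended by 0 as the profile is. *)
Definition Om (t s : R) : R := phi0 Phi n s / (1 + (s / t) `^ (k%:R / n%:R)).

Lemma Om_decr0 t : 0 < t -> decr0 (Om t).
Proof.
move=> t0; have [p0 pN pd] := pD.
have den s : 0 < 1 + (s / t) `^ kn by rewrite ltr_pwDl// powR_ge0.
split => [s|s s0|s u s0 su]; rewrite /Om -/ph -/kn.
- by rewrite divr_ge0// ltW.
- by rewrite pN// mul0r.
- apply: ler_pM => //; first by rewrite invr_ge0 ltW.
    exact: pd.
  rewrite lef_pV2 ?posrE// lerD2l; apply: ge0_ler_powR.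
  + by rewrite divr_ge0.
  + by rewrite nnegrE divr_ge0// ltW.
  + by rewrite nnegrE divr_ge0 ?(ltW t0)// (le_trans (ltW s0)).
  + by rewrite ler_pM2r// invr_gt0.
Qed.

Lemma Om_Omega (t s : R) : 0 < s -> Om t s = Omega n k (profile Phi n) t s.
Proof. by move=> s0; rewrite /Om /Omega /phi0 extend0E. Qed.

Lemma powR_expn (x : R) : 0 <= x -> (x ^+ n) `^ kn = x ^+ k.
Proof.
move=> x0; rewrite -powR_mulrn// -powRrM /kn.
by rewrite mulrCA mulfV ?mulr1 ?powR_mulrn// pnatr_eq0 -lt0n.
Qed.

Lemma pow_ratio (t : R) w : 0 < t ->
  (nu w / t) `^ kn = Vk * (enorm w / t `^ n%:R^-1) ^+ k.
Proof.
move=> t0; have r0 : 0 < t `^ n%:R^-1 by rewrite powR_gt0.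
have q0 : 0 <= enorm w / t `^ n%:R^-1 by rewrite divr_ge0 ?enorm_ge0// ltW.
have -> : nu w / t = V * (enorm w / t `^ n%:R^-1) ^+ n.
  by rewrite /nu exprMn exprVn root_expn ?(ltW t0)// mulrA.
by rewrite powRM ?(ltW V0) ?exprn_ge0// powR_expn.
Qed.

Lemma root_pow (t : R) : 0 < t -> t `^ kn = (t `^ n%:R^-1) ^+ k.
Proof.
by move=> t0; rewrite -powR_mulrn ?powR_ge0// -powRrM /kn mulrC.
Qed.

Definition Om_cut (t s : R) : R := if s < T then Om t s else 0.

(** The first term is a member of the cone once paired; the second, of order
    t^(k/n), will be paid for by the sup-norm of potentials. *)
Definition kernel_majorant (t s : R) : R := Om_cut t s + (t `^ n%:R^-1) ^+ k * phi0 Phi n s.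

Let Tk : R := (T `^ kn)^-1.
Let Tk0 : 0 < Tk. Proof. by rewrite invr_gt0 powR_gt0. Qed.

Lemma Om_cut_decr0 t : 0 < t -> decr0 (Om_cut t).
Proof. by move=> t0; apply: decr0_cut; exact: Om_decr0. Qed.

Lemma kernel_majorant_decr0 t : 0 < t -> decr0 (kernel_majorant t).
Proof.
move=> t0; apply: decr0D; first exact: Om_cut_decr0.
by apply: decr0Z pD; rewrite exprn_ge0// powR_ge0.
Qed.

(** For s >= T the factor 1 / (1 + (s/t)^(k/n)) is at most (t/T)^(k/n). *)
Lemma Om_le_majorant (t s : R) : 0 < t -> Om t s <= (1 + Tk) * kernel_majorant t s.
Proof.
move=> t0; have [p0 _ _] := pD; have [Og _ _] := Om_decr0 t0.
have r0 : 0 <= (t `^ n%:R^-1) ^+ k by rewrite exprn_ge0// powR_ge0.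
have rp : 0 <= (t `^ n%:R^-1) ^+ k * ph s by exact: mulr_ge0.
rewrite /kernel_majorant /Om_cut -/ph; case: ltP => sT.
  rewrite mulrDl mul1r -addrA lerDl addr_ge0// mulr_ge0 ?(ltW Tk0)//.
  by rewrite addr_ge0.
rewrite add0r mulrDl mul1r.
apply: (@le_trans _ _ (Tk * ((t `^ n%:R^-1) ^+ k * ph s))); last by rewrite lerDr.
rewrite mulrA mulrC /Om -/ph -/kn; apply: ler_wpM2l => //.
have d0 : 0 < 1 + (s / t) `^ kn by rewrite ltr_pwDl// powR_ge0.
rewrite -root_pow// -[leLHS]mul1r ler_pdivrMr//.
have TE : (T / t) `^ kn * t `^ kn = T `^ kn.
  by rewrite -powRM ?divfK ?gt_eqF// ?divr_ge0// ltW.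
have TtE : (T / t) `^ kn * (t `^ kn * Tk) = 1.
  by rewrite mulrA TE /Tk mulfV// gt_eqF// powR_gt0.
rewrite -[leLHS]TtE mulrC (mulrC Tk); apply: ler_wpM2l.
  by rewrite mulr_ge0 ?powR_ge0// ltW.
apply: (@le_trans _ _ ((s / t) `^ kn)); last by rewrite lerDr.
apply: ge0_ler_powR; rewrite ?nnegrE ?divr_ge0 ?(ltW t0) ?(ltW T0)//.
  exact: le_trans (ltW T0) sT.
by rewrite ler_pM2r// invr_gt0.
Qed.

Definition upper_const : R :=
  2 ^+ k * (1 + Vk * (3 * k%:R) ^+ k) * (1 + Tk) +
  coef_sum k * (a1 * (1 + Vk) * (1 + Tk) + a2).

Lemma coef_sum_ge0 : 0 <= coef_sum k :> R.
Proof. exact: sumr_ge0. Qed.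

Lemma Vk_ge0 : 0 <= Vk. Proof. exact: powR_ge0. Qed.

Lemma upper_const_ge0 : 0 <= upper_const.
Proof.
have Vk0 := Vk_ge0; have Tk0' := ltW Tk0; have cs := coef_sum_ge0.
rewrite /upper_const.
by repeat first [done | apply: addr_ge0 | apply: mulr_ge0 | apply: exprn_ge0].
Qed.

Definition dcoef (j : nat) : R := 'C(k, j)%:R * (-1) ^+ (k - j).

Lemma dcoef_le (j : nat) : `|dcoef j| <= 2 ^+ k.
Proof.
rewrite /dcoef normrM normr_nat normrX normrN1 expr1n mulr1 -natrX ler_nat.
rewrite -[2%N]/(1 + 1)%N expnDn; case: (leqP j k) => jk.
  rewrite (bigD1 (Ordinal (jk : (j < k.+1)%N)))//= !exp1n !muln1; exact: leq_addr.
by rewrite bin_small.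
Qed.

(** Let r be the bound on |h|. If |z| <= 2 k r, all points z + j h are at
    distance at most 3 k r from the origin, where the profile and Omega are
    comparable, and each term is bounded on its own. If |z| > 2 k r, the
    segment stays at distance |z| / 2 from the origin; there the difference is
    a k-th derivative, bounded by (r / |z|)^k times the kernel near the origin
    and by r^k times it far away. *)
Lemma kernel_upper (t : R) z h : 0 < t -> enorm h <= t `^ n%:R^-1 ->
  `|\sum_(j < k.+1) dcoef j * ph (nu (z + j%:R *: h))| <=
  upper_const * (\sum_(j < k.+1) kernel_majorant t (nu (z + j%:R *: h)) +
                 kernel_majorant t (nu (2^-1 *: z))).
Proof.
move=> t0 hr; set r := t `^ n%:R^-1 in hr *.
have r0 : 0 < r by rewrite powR_gt0.
have [p0 pN pd] := pD; have [q0 qN qd] := kernel_majorant_decr0 t0.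
have Vk0 := Vk_ge0; have cs0 := coef_sum_ge0; have Tk0' := ltW Tk0.
have Om_inv w : Om t (nu w) * (1 + Vk * (enorm w / r) ^+ k) = ph (nu w).
  rewrite /Om -/ph -/kn pow_ratio// -/r divfK// gt_eqF// ltr_pwDl// mulr_ge0//.
  by rewrite exprn_ge0// divr_ge0 ?enorm_ge0 ?ltW.
have [Og _ _] := Om_decr0 t0.
pose Cn := 2 ^+ k * (1 + Vk * (3 * k%:R) ^+ k) * (1 + Tk).
pose Cf := coef_sum k * (a1 * (1 + Vk) * (1 + Tk) + a2).
have Cn0 : 0 <= Cn.
  by repeat first [done | apply: addr_ge0 | apply: mulr_ge0 | apply: exprn_ge0].
have Cf0 : 0 <= Cf.
  by repeat first [done | apply: addr_ge0 | apply: mulr_ge0 | apply: exprn_ge0].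
have S0 : 0 <= \sum_(j < k.+1) kernel_majorant t (nu (z + j%:R *: h)) by exact: sumr_ge0.
have [zr|zr] := lerP (enorm z) (2 * k%:R * r).
  (* close to the origin no cancellation is needed *)
  apply: (@le_trans _ _ (Cn * \sum_(j < k.+1) kernel_majorant t (nu (z + j%:R *: h)))); last first.
    rewrite /upper_const -/Cn -/Cf mulrDl mulrDr -addrA lerDl addr_ge0//.
      exact: mulr_ge0.
    by rewrite mulr_ge0// addr_ge0.
  apply: le_trans (ler_norm_sum _ _ _) _; rewrite mulr_sumr; apply: ler_sum => j _.
  set w := z + j%:R *: h.
  have wr : enorm w <= 3 * k%:R * r.
    apply: le_trans (enormD _ _) _; rewrite enormZ normr_nat.
    have jk : (j%:R : R) <= k%:R by rewrite ler_nat -ltnS.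
    have : j%:R * enorm h <= k%:R * r by apply: ler_pM => //; exact: enorm_ge0.
    lra.
  rewrite normrM (ger0_norm (p0 _)) /Cn -!mulrA; apply: ler_pM => //.
    exact: dcoef_le.
  rewrite -Om_inv mulrC; apply: ler_pM => //.
  - by rewrite addr_ge0// mulr_ge0// exprn_ge0// divr_ge0 ?enorm_ge0 ?ltW.
  - rewrite lerD2l; apply: ler_wpM2l => //; apply: lerXn2r.
    + by rewrite nnegrE divr_ge0 ?enorm_ge0 ?ltW.
    + by rewrite nnegrE mulr_ge0.
    + by rewrite ler_pdivrMr.
  exact: Om_le_majorant.
(* away from it the k-th derivative is controlled *)
have k1 : 1 <= k%:R :> R by rewrite ler1n.
have z0 : 0 < enorm z.
  by apply: le_lt_trans zr; rewrite mulr_ge0 ?mulr_ge0// ltW.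
have kr : k%:R * r < enorm z / 2 by rewrite ltr_pdivlMr// mulrC mulrA.
have away s : 0 <= s <= k%:R * 1 -> enorm z / 2 <= enorm (z + s *: h).
  move=> /andP[s0 sk]; have := enorm_lb z (s *: h); rewrite enormZ ger0_norm//.
  have : s * enorm h <= k%:R * r by rewrite mulr1 in sk; apply: ler_pM => //; exact: enorm_ge0.
  move: kr; lra.
have away0 s : 0 <= s <= k%:R * 1 -> z + s *: h != 0.
  move=> /away H; apply: contraTN isT => /eqP E0; move: H; rewrite E0 enorm0; lra.
have [xi xi1 E1] := @radial_fdiff_mean R Phi k sm n z h 1 ler01 away0.
have -> : \sum_(j < k.+1) dcoef j * ph (nu (z + j%:R *: h)) = line_chain Phi z h k xi.
  rewrite -[RHS]mul1r -[in RHS](expr1n R k) -E1 /fdiff; apply: eq_bigr => j _.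
  rewrite mulr1 add0r /ph phi0_nu//; apply: away0.
  by rewrite mulr1 ler0n ler_nat -ltnS /=.
set y := z + xi *: h; have y0 : y != 0 := away0 _ xi1.
have rho0 := enorm_gt0 y0.
have My : 0 <= (a1 + a2 * enorm y ^+ k) * Phi (enorm y).
  by rewrite mulr_ge0 ?Phi0// addr_ge0// mulr_ge0// exprn_ge0// ltW.
have := @line_chain_le R Phi k n k0 z h xi _ y0 My (fun j jk => HM rho0 jk).
rewrite -/y => H; apply: le_trans H _.
set w := 2^-1 *: z.
have wz : enorm w = enorm z / 2 by rewrite /w enormZ ger0_norm// mulrC.
have w0 : 0 < enorm w by rewrite wz divr_gt0.
have wN0 : w != 0 by apply/eqP => E0; move: w0; rewrite E0 enorm0 ltxx.
have wy : enorm w <= enorm y by rewrite wz; exact: away.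
have rw : r <= enorm w.
  rewrite wz; apply: le_trans (ltW kr); rewrite -[leLHS]mul1r ler_pM2r//.
have PHw : Phi (enorm y) <= ph (nu w) by rewrite /ph phi0_nu//; exact: Phid.
apply: (@le_trans _ _ (Cf * kernel_majorant t (nu w))); last first.
  rewrite /upper_const -/Cn -/Cf mulrDl.
  set S := \sum_(_ < _) _; set M := kernel_majorant t _.
  have S0' : 0 <= S by [].
  have M0 : 0 <= M by exact: q0.
  apply: (@le_trans _ _ (Cf * (S + M))); first by rewrite ler_wpM2l// lerDr.
  by rewrite lerDr mulr_ge0// addr_ge0.
set X := (enorm w / r) ^+ k.
have X1 : 1 <= X by rewrite /X exprn_ege1// ler_pdivlMr// mul1r.
have X0 : 0 < X by exact: lt_le_trans X1.
have hk : enorm h ^+ k <= r ^+ k by rewrite lerXn2r// nnegrE ?enorm_ge0 ?ltW.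
have yk0 : 0 < enorm y ^+ k by rewrite exprn_gt0.
have wk0 : 0 < enorm w ^+ k by rewrite exprn_gt0.
have rk0 : 0 < r ^+ k by rewrite exprn_gt0.
have Phy : 0 <= Phi (enorm y) by exact: Phi0.
apply: (@le_trans _ _ (coef_sum k * ((a1 * enorm w ^- k + a2) * ph (nu w) * r ^+ k))).
  have -> : coef_sum k * ((a1 + a2 * enorm y ^+ k) * Phi (enorm y)) * enorm y ^- k *
      enorm h ^+ k =
    coef_sum k * ((a1 * enorm y ^- k + a2) * (Phi (enorm y) * enorm h ^+ k)).
    move: (enorm y ^+ k) yk0 (coef_sum k) => Y Y0 cs; field; rewrite gt_eqF//.
  apply: ler_wpM2l => //; rewrite -[leRHS]mulrA.
  apply: ler_pM => //.
  - by rewrite addr_ge0// mulr_ge0// invr_ge0 ltW.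
  - by rewrite mulr_ge0// exprn_ge0// enorm_ge0.
  - rewrite lerD2r; apply: ler_wpM2l => //; rewrite lef_pV2 ?posrE//.
    by rewrite lerXn2r// nnegrE ltW.
  - by apply: ler_pM => //; rewrite exprn_ge0// enorm_ge0.
rewrite /Cf -[leRHS]mulrA; apply: ler_wpM2l => //; rewrite !mulrDl; apply: lerD; last first.
  rewrite -[leLHS]mulrA; apply: ler_wpM2l => //; rewrite mulrC /kernel_majorant -/r -/ph.
  by rewrite lerDr; have [oc _ _] := Om_cut_decr0 t0.
rewrite -!mulrA; apply: ler_wpM2l => //; rewrite mulrA mulrA -mulrA.
have -> : enorm w ^- k * (ph (nu w) * r ^+ k) = (X^-1 + Vk) * Om t (nu w).
  rewrite -(Om_inv w) -/X mulrCA -[RHS]mulrC -mulrA; congr (_ * _).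
  rewrite /X expr_div_n invf_div; field.
  by rewrite !gt_eqF.
rewrite -[leRHS]mulrA; apply: ler_pM => //.
- by rewrite addr_ge0// invr_ge0 ltW.
- by rewrite lerD2r invf_le1.
- exact: Om_le_majorant.
Qed.

End UpperEstimate.

(** * Upper bound for differences of potentials *)

Section DifferencesOfPotentials.
Context {R : realType}.
Variables (n k : nat) (T a1 a2 : R) (Phi : R -> R).
Hypotheses (n0 : (0 < n)%N) (k0 : (0 < k)%N) (T0 : 0 < T).
Hypotheses (a10 : 0 <= a1) (a20 : 0 <= a2).
Hypothesis Phi0 : forall z, 0 < z -> 0 <= Phi z.
Hypothesis Phid : forall z w, 0 < z -> z <= w -> Phi w <= Phi z.
Hypothesis sm : forall j, (j < k)%N -> forall z : R, 0 < z ->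
  derivable (derive1n j Phi) z 1.
Hypothesis HM : forall z j, 0 < z -> (0 < j <= k)%N ->
  z ^+ (2 * j) * `|Phi_iter Phi j z| <= (a1 + a2 * z ^+ k) * Phi z.
Variables (E : ri_space_Rn R n) (Et : ri_space_Rplus R).
Hypothesis rep : representation_space E Et.
Variable F : 'rV[R]_n -> R.
Hypotheses (mF : measurable_fun setT F) (F0 : forall x, (0 <= F x)%R).
Hypothesis EF : (E (EFin \o F) < +oo)%E.
Let sig := rearr_fun F.
Let sD : decr0 sig := rearr_fun_decr0 rep mF F0 EF.
Let ph := phi0 Phi n.
Let pD : decr0 ph := phi0_decr0 n Phi0 Phid.
Hypothesis psI : (\int[leb]_s (ph s * sig s)%:E < +oo)%E.
Notation lam := (@lebesgue_rV R n).

(** Hardy-Littlewood is applied to the Omega part of the majorant only: that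
    part is integrable against any rearrangement over (0, T), while the
    remaining part is bounded by hypothesis. *)
Lemma kernel_majorant_bound (t B a : R) (b : 'rV[R]_n) : 0 < t -> 1 <= `|a| ->
  (\int[lam]_w (ph (nu w) * F (a *: w + b))%:E <= B%:E)%E ->
  (\int[lam]_w (kernel_majorant n k T Phi t (nu w) * F (a *: w + b))%:E <=
   \int[leb]_s (Om_cut n k T Phi t s * sig s)%:E + ((t `^ n%:R^-1) ^+ k * B)%:E)%E.
Proof.
move=> t0 aa HB; have OD := Om_cut_decr0 n k T Phi0 Phid t0.
have mFab := measurable_comp_affine a b mF.
have mp := measurable_radial pD; have mO := measurable_radial OD.
have r0 : 0 <= (t `^ n%:R^-1) ^+ k by rewrite exprn_ge0// powR_ge0.
have [p0 _ _] := pD; have [Og _ _] := OD.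
rewrite (_ : (\int[lam]_w _ = \int[lam]_w (Om_cut n k T Phi t (nu w) * F (a *: w + b) +
    (t `^ n%:R^-1) ^+ k * (ph (nu w) * F (a *: w + b)))%:E)%E); last first.
  by apply: eq_integral => w _; congr EFin; rewrite /kernel_majorant -/ph mulrDl mulrA.
rewrite int_add; last 4 first.
- by apply: measurable_funM; [exact: mO|exact: mFab].
- by apply: measurable_funM => //; apply: measurable_funM; [exact: mp|exact: mFab].
- by move=> w; rewrite mulr_ge0.
- by move=> w; rewrite mulr_ge0// mulr_ge0.
apply: leeD; first exact: (radial_bound rep n0 mF F0 EF).
rewrite int_scale//; last 2 first.
- by apply: measurable_funM; [exact: mp|exact: mFab].
- by move=> w; rewrite mulr_ge0.
by rewrite EFinM; apply: lee_wpmul2l.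
Qed.

(** Integrating the pointwise bound of the kernel: the k + 1 translates are
    moved onto the density, and so is the dilation by 1/2, at the cost 2^n. *)
Lemma pot_difference_upper (f : 'rV[R]_n -> R) (t B : R) (x h : 'rV[R]_n) :
  measurable_fun setT f -> (forall x, `|f x| <= F x) ->
  0 < t -> enorm h <= t `^ n%:R^-1 ->
  (forall b, \int[lam]_w (ph (nu w) * F (-1 *: w + b))%:E <= B%:E)%E ->
  (forall b, \int[lam]_w (ph (nu w) * F (-2 *: w + b))%:E <= B%:E)%E ->
  ((`|\sum_(j < k.+1) dcoef k j * pot ph f (x + j%:R *: h)|)%:E <=
   (upper_const n k T a1 a2 * (k.+1%:R + 2 ^+ n))%:E *
   (\int[leb]_s (Om_cut n k T Phi t s * sig s)%:E + ((t `^ n%:R^-1) ^+ k * B)%:E))%E.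
Proof.
move=> mf fF t0 hr B1 B2.
have UC0 := upper_const_ge0 n k T0 a10 a20.
set UC := upper_const n k T a1 a2.
set J := (X in (_ <= _ * X)%E).
have QD := kernel_majorant_decr0 n k T Phi0 Phid t0.
have [q0 _ _] := QD; have mQ := measurable_radial QD.
set Q := kernel_majorant n k T Phi t in QD q0 mQ.
apply: le_trans (@pot_sum_le R n E Et rep n0 F mF F0 EF f ph mf fF pD psI _
  (index_enum 'I_k.+1) (fun j => dcoef k j) (fun j : 'I_k.+1 => j%:R *: h) x) _.
have mFx : measurable_fun setT (fun z : 'rV[R]_n => F (x - z)).
  exact: measurable_comp_sub.
have mQj (j : 'I_k.+1) : measurable_fun setT (fun z : 'rV[R]_n => Q (nu (z + j%:R *: h)) * F
  (x - z)).
  by apply: measurable_funM => //; exact: (measurable_radial_add _ QD).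
have mQ2 : measurable_fun setT (fun z : 'rV[R]_n => Q (nu (2^-1 *: z)) * F (x - z)).
  apply: measurable_funM => //; have := measurable_radial_affine 2^-1 (0 : 'rV[R]_n) QD.
  by apply: eq_measurable_fun => z _; rewrite addr0.
apply: (@le_trans _ _ (\int[lam]_z (UC * (\sum_(j < k.+1) Q (nu (z + j%:R *: h)) * F (x - z) +
    Q (nu (2^-1 *: z)) * F (x - z)))%:E)%E).
  apply: int_le.
  - apply: measurable_funM => //; apply: measurableT_comp => //.
    apply: measurable_sum => j; apply: measurable_funM => //.
    exact: (measurable_radial_add _ pD).
  - apply: measurable_funM => //; apply: measurable_funD => //.
    exact: measurable_sum.
  - by move=> z; rewrite mulr_ge0.
  move=> z; rewrite -mulr_suml -mulrDl mulrA; apply: ler_wpM2r => //.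
  exact: (kernel_upper n0 k0 T0 a10 a20 Phi0 Phid sm HM z t0 hr).
rewrite int_scale//; last 2 first.
- by apply: measurable_funD => //; exact: measurable_sum.
- by move=> z; rewrite addr_ge0 ?mulr_ge0// sumr_ge0// => j _; rewrite mulr_ge0.
rewrite EFinM -muleA; apply: lee_wpmul2l => //.
have J0 : (0 <= J)%E.
  apply: le_trans (kernel_majorant_bound (a := -1) t0 _ (B1 0)); last first.
    by rewrite normrN1.
  by apply: int_ge0 => w; rewrite mulr_ge0.
rewrite int_add//; last 3 first.
- exact: measurable_sum.
- by move=> z; rewrite sumr_ge0// => j _; rewrite mulr_ge0.
- by move=> z; rewrite mulr_ge0.
rewrite int_sum//; last by move=> j z; rewrite mulr_ge0.
rewrite EFinD ge0_muleDl//; apply: leeD.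
  apply: (@le_trans _ _ (\sum_(j < k.+1) J)%E); last first.
    by rewrite sumr_const card_ord mule_natl.
  apply: lee_sum => j _.
  have mQj' : measurable_fun setT
      (fun z : 'rV[R]_n => (Q (nu (z + j%:R *: h)) * F (x - z))%:E).
    by apply/measurable_EFinP; exact: mQj.
  have Qj0 z : (0 <= (Q (nu (z + j%:R *: h)) * F (x - z))%:E)%E.
    by rewrite lee_fin mulr_ge0.
  rewrite -(rV_translate (- (j%:R *: h)) mQj' Qj0).
  apply: le_trans (kernel_majorant_bound (a := -1) t0 _ (B1 (x + j%:R *: h))); last first.
    by rewrite normrN1.
  rewrite le_eqVlt; apply/orP; left; apply/eqP; apply: eq_integral => z _.
  rewrite subrK; congr (EFin (_ * F _)).
  by rewrite opprB scaleN1r addrC addrA [RHS]addrC addrA.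
have mQ2' : measurable_fun setT (fun z : 'rV[R]_n => (Q (nu (2^-1 *: z)) * F (x - z))%:E).
  by apply/measurable_EFinP; exact: mQ2.
have Q20 z : (0 <= (Q (nu (2^-1 *: z)) * F (x - z))%:E)%E by rewrite lee_fin mulr_ge0.
have n2 : 2 != 0 :> R by rewrite pnatr_eq0.
rewrite -(ge0_integral_affine 0 n2 mQ2' Q20).
rewrite ger0_norm//; apply: lee_wpmul2l => //.
apply: le_trans (kernel_majorant_bound (a := -2) t0 _ (B2 x)); last first.
  by rewrite normrN ger0_norm// ler1n.
rewrite le_eqVlt; apply/orP; left; apply/eqP; apply: eq_integral => z _.
rewrite addr0 scalerA mulVf ?pnatr_eq0// scale1r; congr (EFin (_ * F _)).
by rewrite scaleNr addrC.
Qed.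

End DifferencesOfPotentials.

(** * Complex-valued functions *)

Section ComplexFunctions.
Context {R : realType}.
Implicit Types z w : R[i].

Lemma cmod_ge0 z : 0 <= cmod z.
Proof. by case: z => a b; exact: sqrtr_ge0. Qed.

Lemma cmodD z w : cmod (z + w) <= cmod z + cmod w.
Proof. exact: le_normcD. Qed.

Lemma Re_le_cmod z : `|complex.Re z| <= cmod z.
Proof.
case: z => a b; rewrite /cmod/= -sqrtr_sqr; apply: ler_wsqrtr.
by rewrite lerDl sqr_ge0.
Qed.

Lemma Im_le_cmod z : `|complex.Im z| <= cmod z.
Proof.
case: z => a b; rewrite /cmod/= -sqrtr_sqr; apply: ler_wsqrtr.
by rewrite lerDr sqr_ge0.
Qed.

Lemma cmod_le z : cmod z <= `|complex.Re z| + `|complex.Im z|.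
Proof.
case: z => a b; rewrite /cmod/= -(@ler_pXn2r _ 2) ?nnegrE ?sqrtr_ge0 ?addr_ge0//.
rewrite sqr_sqrtr ?addr_ge0 ?sqr_ge0// sqrrD !real_normK ?num_real//.
by rewrite [leRHS]addrAC lerDl mulrn_wge0// mulr_ge0.
Qed.

Lemma cmod_real (a : R) : cmod (Complex a 0) = `|a|.
Proof. by rewrite /cmod/= expr0n addr0 sqrtr_sqr. Qed.

Variable n : nat.
Implicit Types (f u : 'rV[R]_n -> R[i]).

Lemma measurable_cmod f :
  measurable_fun setT (fun x => complex.Re (f x)) ->
  measurable_fun setT (fun x => complex.Im (f x)) ->
  measurable_fun setT (fun x => cmod (f x)).
Proof.
move=> mr mi.
apply: (eq_measurable_fun (fun x =>
    Num.sqrt (complex.Re (f x) ^+ 2 + complex.Im (f x) ^+ 2))).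
  by move=> x _; case: (f x).
apply: measurableT_comp; first exact: (continuous_measurable_fun (@sqrt_continuous R)).
by apply: measurable_funD; exact: measurable_funX.
Qed.

Lemma finite_differenceE k (h : 'rV[R]_n) (ur ui : 'rV[R]_n -> R) x :
  finite_difference k h (fun x => Complex (ur x) (ui x)) x =
  Complex (\sum_(j < k.+1) dcoef k j * ur (x + j%:R *: h))
          (\sum_(j < k.+1) dcoef k j * ui (x + j%:R *: h)).
Proof.
rewrite /finite_difference.
have E (j : 'I_k.+1) : 'C(k, j)%:R * (-1) ^+ (k - j) * Complex (ur (x + j%:R *: h)) (ui
  (x + j%:R *: h))
   = Complex (dcoef k j * ur (x + j%:R *: h)) (dcoef k j * ui (x + j%:R *: h)) :> R[i].
  have -> : 'C(k, j)%:R * (-1) ^+ (k - j) = Complex (dcoef k j) 0 :> R[i].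
    by rewrite /dcoef complexr0 rmorphM rmorphXn rmorphN1 rmorph_nat.
  by rewrite {1}/GRing.mul/= !mul0r subr0 addr0.
under eq_bigr => j _ do rewrite E.
elim/big_ind3: _ => //.
by move=> a1 b1 c1 a2 b2 c2 -> ->.
Qed.

End ComplexFunctions.

(** * Lower bound for differences of the kernel in a cone *)

Section LowerKernel.
Context {R : realType}.
Variables (n k : nat) (a1 z1 d1 : R) (Phi : R -> R).
Hypotheses (n0 : (0 < n)%N) (k0 : (0 < k)%N).
Hypotheses (a10 : 0 < a1) (d10 : 0 < d1).
Hypothesis Phi0 : forall z, 0 < z -> 0 <= Phi z.
Hypothesis Phid : forall z w, 0 < z -> z <= w -> Phi w <= Phi z.
Hypothesis sm : forall j, (j < k)%N -> forall z : R, 0 < z ->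
  derivable (derive1n j Phi) z 1.
Hypothesis HMn : forall z j, 0 < z <= z1 -> (0 < j <= k)%N ->
  z ^+ (2 * j) * `|Phi_iter Phi j z| <= a1 * Phi z.
Hypothesis Hd : forall z, 0 < z <= z1 ->
  d1 * Phi z <= (-1) ^+ k * z ^+ k * derive1n k Phi z.
Variable q : R.
Hypotheses (q0 : 0 < q) (q1 : q <= 1).
Hypothesis Hq : coef_sum k * a1 * (1 - q ^+ k) <= d1 / 2.
Variable e : 'rV[R]_n.
Hypothesis e1 : enorm e = 1.
Implicit Types z : 'rV[R]_n.

Let ee : dotp e e = 1. Proof. by rewrite -sqr_enorm e1 expr1n. Qed.

(** The cone of all z with q |z| <= <z, e> is stable under adding nonnegative
    multiples of its axis e. *)
Lemma cone_line z (s : R) : z != 0 -> q * enorm z <= dotp z e -> 0 <= s ->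
  [/\ z + s *: e != 0, q * enorm (z + s *: e) <= dotp (z + s *: e) e &
      enorm (z + s *: e) <= enorm z + s].
Proof.
move=> z0 zq s0; have nz := enorm_gt0 z0.
have up : enorm (z + s *: e) <= enorm z + s.
  by apply: le_trans (enormD _ _) _; rewrite enormZ e1 mulr1 ger0_norm.
have lo : q * enorm (z + s *: e) <= dotp (z + s *: e) e.
  rewrite dotpDl dotpZl ee mulr1; apply: le_trans (_ : q * enorm z + q * s <= _).
    by rewrite -mulrDr ler_pM2l.
  by apply: lerD => //; rewrite ler_piMl.
split => //; apply: contraTN isT => /eqP E0.
have : 0 < dotp (z + s *: e) e.
  rewrite dotpDl dotpZl ee mulr1 ltr_wpDr//; apply: lt_le_trans zq.
  exact: mulr_gt0.
by rewrite E0 dotpC dotp0r ltxx.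
Qed.

(** By the narrowness of the cone the directional derivative deviates from the
    radial one by at most half of the latter's lower bound. *)
Lemma cone_derivative z (s : R) : z != 0 -> q * enorm z <= dotp z e -> 0 <= s ->
  enorm z + s <= z1 ->
  d1 / 2 * enorm (z + s *: e) ^- k * Phi (enorm (z + s *: e)) <=
    (-1) ^+ k * line_chain Phi z e k s.
Proof.
move=> z0 zq s0 zs; have [zs0 lo up] := cone_line z0 zq s0.
have rho0 := enorm_gt0 zs0; set rho := enorm (z + s *: e) in lo up rho0 *.
have rz1 : 0 < rho <= z1 by rewrite rho0 (le_trans up zs).
have P0 := Phi0 rho0.
have M0 : 0 <= a1 * Phi rho by rewrite mulr_ge0// ltW.
have q01 : 0 <= q <= 1 by rewrite (ltW q0).
have rk : 0 < rho ^+ k by rewrite exprn_gt0.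
have := @line_chain_cone R Phi k sm n k0 z e s _ q zs0 M0 q01 e1 lo (fun j jk => HMn rz1 jk).
rewrite -/rho => cone.
have Hk := Hd rz1.
have H1 : d1 * Phi rho * rho ^- k <= (-1) ^+ k * derive1n k Phi rho.
  by rewrite ler_pdivrMr// mulrAC.
have H2 : coef_sum k * (a1 * Phi rho) * rho ^- k * (1 - q ^+ k) <= d1 / 2 * (Phi rho * rho ^- k).
  rewrite (_ : _ * (1 - q ^+ k) = coef_sum k * a1 * (1 - q ^+ k) * (Phi rho * rho ^- k));
    last by ring.
  by apply: ler_wpM2r => //; rewrite mulr_ge0// invr_ge0 ltW.
have H3 : `|(-1) ^+ k * line_chain Phi z e k s - (-1) ^+ k * derive1n k Phi rho| <=
    d1 / 2 * (Phi rho * rho ^- k).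
  rewrite -mulrBr normrM normrX normrN1 expr1n mul1r.
  exact: le_trans cone H2.
move: H3 H1; rewrite ler_norml => /andP[H3 _] H1.
rewrite (_ : d1 / 2 * rho ^- k * Phi rho = d1 * Phi rho * rho ^- k - d1 / 2 * (Phi rho * rho ^- k)).
  move: H3 H1; lra.
by field; rewrite gt_eqF.
Qed.

(** Differences grow with the step. For steps longer than the distance to the
    origin one may therefore pass to the difference with that distance as
    step, for which the mean value theorem gives a bound of the order of the
    kernel itself. *)
Lemma cone_difference z (r : R) : z != 0 -> q * enorm z <= dotp z e -> 0 < r ->
  enorm z + k%:R * r <= z1 ->
  d1 / 2 * (Num.min r (enorm z) / ((1 + k%:R) * enorm z)) ^+ k * Phi ((1 + k%:R) * enorm z) <=
    (-1) ^+ k * fdiff k r (fun s => Phi (enorm (z + s *: e))) 0.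
Proof.
move=> z0 zq r0 zr; have nz := enorm_gt0 z0.
set eta := Num.min r (enorm z).
have eta0 : 0 < eta by rewrite lt_min r0.
have etar : eta <= r by rewrite ge_min lexx.
have etaz : eta <= enorm z by rewrite ge_min lexx orbT.
have k1 : 0 <= k%:R :> R by [].
have ker : k%:R * eta <= k%:R * r by rewrite ler_wpM2l.
have fE : (fun s => Phi (enorm (z + s *: e))) = line_chain Phi z e 0.
  by apply/funext => s; rewrite line_chain0.
have mono : (-1) ^+ k * fdiff k eta (line_chain Phi z e 0) 0 <=
    (-1) ^+ k * fdiff k r (line_chain Phi z e 0) 0.
  apply: (@fdiff_step_mono R k (line_chain Phi z e)) => //; first exact: ltW.
    move=> m x mk; rewrite add0r => /andP[x0 _].
    by apply: (line_derive sm) => //; have [] := cone_line z0 zq x0.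
  move=> x; rewrite add0r => /andP[x0 xr].
  apply: le_trans (cone_derivative z0 zq x0 _); last first.
    by apply: le_trans zr; rewrite lerD2l.
  have [zs0 _ _] := cone_line z0 zq x0.
  by rewrite !mulr_ge0 ?Phi0 ?enorm_gt0 ?invr_ge0 ?exprn_ge0 ?enorm_ge0 ?(ltW d10).
rewrite fE; apply: le_trans mono; rewrite -fE.
have [|xi /andP[xi0 xi1] ->] := @radial_fdiff_mean R Phi k sm n z e eta (ltW eta0).
  by move=> s /andP[s0 _]; have [] := cone_line z0 zq s0.
rewrite mulrCA.
have [zs0 _ up] := cone_line z0 zq xi0.
have rho0 := enorm_gt0 zs0.
have xiz : enorm z + xi <= (1 + k%:R) * enorm z.
  rewrite mulrDl mul1r lerD2l; apply: le_trans xi1 _.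
  by rewrite ler_wpM2l.
apply: (@le_trans _ _ (eta ^+ k * (d1 / 2 * enorm (z + xi *: e) ^- k * Phi (enorm (z + xi *: e))))).
  rewrite expr_div_n.
  have L0 : 0 < (1 + k%:R) * enorm z by rewrite mulr_gt0// ltr_pwDl.
  have upL := le_trans up xiz.
  have H1 : ((1 + k%:R) * enorm z) ^- k <= enorm (z + xi *: e) ^- k.
    rewrite lef_pV2 ?posrE ?exprn_gt0//; apply: lerXn2r => //; rewrite nnegrE ltW//.
  have H2 : Phi ((1 + k%:R) * enorm z) <= Phi (enorm (z + xi *: e)) by exact: Phid.
  rewrite (_ : _ * _ * _ = eta ^+ k * (d1 / 2 * ((1 + k%:R) * enorm z) ^- k * Phi
    ((1 + k%:R) * enorm z))); last by ring.
  apply: ler_wpM2l; first by rewrite exprn_ge0// ltW.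
  rewrite -!mulrA; apply: ler_wpM2l; first exact: ltW.
  apply: ler_wpM2l; first by rewrite invr_ge0.
  apply: ler_pM => //; last exact: Phi0.
  by rewrite invr_ge0 exprn_ge0// ltW.
apply: ler_wpM2l; first by rewrite exprn_ge0// ltW.
apply: cone_derivative => //.
by apply: le_trans zr; rewrite lerD2l (le_trans xi1).
Qed.

(** The quantity min (r, |z|)^k / |z|^k is, up to constants, the reciprocal of
    the denominator of Omega when r is a multiple of t^(1/n); the dilation by
    1 + k reaches the far end of the segment. *)
Lemma cone_difference_Om z (t c0 : R) : z != 0 -> q * enorm z <= dotp z e ->
  0 < t -> 0 < c0 -> enorm z + k%:R * (c0 * t `^ n%:R^-1) <= z1 ->
  d1 / 2 / (1 + k%:R) ^+ k *
    (1 + (ball_volume n `^ (k%:R / n%:R) * ((1 + k%:R) * c0) ^+ k)^-1)^-1 *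
    Om n k Phi t ((1 + k%:R) ^+ n * nu z) <=
  (-1) ^+ k * fdiff k (c0 * t `^ n%:R^-1) (fun s => Phi (enorm (z + s *: e))) 0.
Proof.
move=> z0 zq t0 c00 zr; have nz := enorm_gt0 z0.
set r := c0 * t `^ n%:R^-1 in zr *.
have rt0 : 0 < t `^ n%:R^-1 by rewrite powR_gt0.
have r0 : 0 < r by rewrite mulr_gt0.
apply: le_trans (cone_difference z0 zq r0 zr).
have k1 : 0 < 1 + k%:R :> R by rewrite ltr_pwDl.
pose y := (1 + k%:R : R) *: z.
have ny : enorm y = (1 + k%:R) * enorm z by rewrite enormZ gtr0_norm.
have y0 : y != 0 by rewrite scaler_eq0 negb_or gt_eqF.
have -> : (1 + k%:R) ^+ n * nu z = nu y by rewrite nuZ gtr0_norm.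
rewrite /Om phi0_nu// (pow_ratio k n0 y t0) ny.
set Vk := _ `^ _; have Vk0 : 0 < Vk by rewrite powR_gt0// ball_volume_gt0.
set B := Vk * ((1 + k%:R) * c0) ^+ k.
have B0 : 0 < B by rewrite mulr_gt0// exprn_gt0// mulr_gt0.
set X := (enorm z / r) ^+ k.
have X0 : 0 < X by rewrite exprn_gt0// divr_gt0.
have -> : Vk * ((1 + k%:R) * enorm z / t `^ n%:R^-1) ^+ k = B * X.
  rewrite /B /X -[RHS]mulrA -exprMn; congr (_ * _ ^+ k).
  by rewrite /r; field; rewrite !gt_eqF.
set P := Phi _; have P0 : 0 <= P by apply: Phi0; rewrite mulr_gt0.
set m := Num.min r (enorm z).
have mX : (1 + X)^-1 <= (m / enorm z) ^+ k.
  have [rz|zr'] := lerP r (enorm z).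
    rewrite /m min_l//.
    have -> : (r / enorm z) ^+ k = X^-1 by rewrite /X -exprVn invf_div.
    by rewrite lef_pV2 ?posrE ?addr_gt0// lerDr.
  rewrite /m min_r ?(ltW zr')// mulfV ?gt_eqF// expr1n invf_le1 ?addr_gt0//.
  by rewrite lerDl ltW.
have mE : (m / ((1 + k%:R) * enorm z)) ^+ k = ((1 + k%:R) ^+ k)^-1 * (m / enorm z) ^+ k.
  by rewrite -exprVn -exprMn; congr (_ ^+ k); field; rewrite !gt_eqF.
rewrite mE.
have key : (1 + B^-1)^-1 * (P / (1 + B * X)) <= (m / enorm z) ^+ k * P.
  rewrite mulrA mulrAC; apply: ler_wpM2r => //; apply: le_trans mX.
  have B1 : 0 < B^-1 by rewrite invr_gt0.
  have BX : 0 < B * X by rewrite mulr_gt0.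
  have BXB : B^-1 * (B * X) = X by rewrite mulrA mulVf ?mul1r// gt_eqF.
  have D1 : 0 < 1 + B^-1 by rewrite addr_gt0.
  have D2 : 0 < 1 + B * X by rewrite addr_gt0.
  rewrite -invfM lef_pV2 ?posrE ?addr_gt0 ?mulr_gt0//.
  rewrite mulrDl !mul1r mulrDr mulr1 BXB; lra.
have c1 : 0 <= d1 / 2 / (1 + k%:R) ^+ k.
  by rewrite !divr_ge0 ?exprn_ge0 ?(ltW k1) ?(ltW d10).
rewrite -[leLHS]mulrA; apply: le_trans (ler_wpM2l c1 key) _.
by rewrite le_eqVlt; apply/orP; left; apply/eqP; rewrite !mulrA.
Qed.

End LowerKernel.

(** * Densities supported in a cone *)

Section ConeMeasure.
Context {R : realType}.
Variables (n : nat) (i0 : 'I_n) (q : R).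
Hypotheses (q0 : 0 < q) (q1 : q < 1).
Let n0 : (0 < n)%N. Proof. by case: n i0 => // -[]. Qed.
Implicit Types y : 'rV[R]_n.

Definition axis : 'rV[R]_n := delta_mx ord0 i0.

Lemma dotp_axis y : dotp y axis = y ord0 i0.
Proof.
rewrite /dotp (bigD1 i0)//= mxE !eqxx mulr1 big1 ?addr0// => j ji.
by rewrite mxE (negbTE ji) andbF mulr0.
Qed.

Lemma enorm_axis : enorm axis = 1.
Proof. by rewrite enormE dotp_axis mxE !eqxx sqrtr1. Qed.

(** The cone opposite to the axis: for a density supported here, the kernel is
    evaluated at minus a point of the sector, in the cone around the axis. *)
Definition sector : set 'rV[R]_n := [set y | q * enorm y <= - y ord0 i0].

Lemma measurable_sector : measurable sector.
Proof.
rewrite (_ : sector = (fun y => - y ord0 i0 - q * enorm y) @^-1` [set` `[0, +oo[%R]).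
  rewrite -[X in measurable X]setTI; apply: measurable_funB => //.
    by apply: measurableT_comp => //; exact: measurable_rv_coord.
  by apply: measurable_funM => //; exact: measurable_enorm.
by apply/seteqP; split => y /=; rewrite in_itv/= andbT subr_ge0.
Qed.

Lemma sectorZ (a : R) y : 0 < a -> sector (a *: y) <-> sector y.
Proof.
move=> a0; rewrite /sector /= enormZ gtr0_norm// !mxE mulrCA -mulrN.
by rewrite ler_pM2l.
Qed.

(** The sector contains a small box around a point on the negative axis. *)
Lemma sector_measure : exists2 kap : R, 0 < kap &
  lebesgue_rV n (sector `&` [set y | nu y <= 1]) = kap%:E.
Proof.
set mu1 := lebesgue_rV n _.
have mS : measurable (sector `&` [set y | nu y <= 1]).
  by apply: measurableI; [exact: measurable_sector|exact: measurable_nu_le].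
have fin : (mu1 < +oo)%E.
  apply: (@le_lt_trans _ _ (lebesgue_rV n [set y : 'rV[R]_n | nu y <= 1])).
    by apply: le_measure; rewrite ?inE//; exact: measurable_nu_le.
  by rewrite lebesgue_rV_nu// ltry.
suff pos : (0 < mu1)%E.
  exists (fine mu1); first by rewrite fine_gt0// pos.
  by rewrite fineK// ge0_fin_numE// ltW.
pose V : R := ball_volume n; have V0 : 0 < V by exact: ball_volume_gt0.
pose r := (1 / V) `^ n%:R^-1; have r0 : 0 < r by rewrite powR_gt0// divr_gt0.
have rn : V * r ^+ n = 1.
  by rewrite root_expn ?divr_ge0 ?(ltW V0)// mulrC divfK// gt_eqF.
pose eps := (1 - q) * r / (2 * n.+1%:R).
have n1 : 0 < n.+1%:R :> R by [].
have eps0 : 0 < eps by rewrite divr_gt0 ?mulr_gt0// subr_gt0.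
have epsE : eps * n.+1%:R = (1 - q) * r / 2 by rewrite /eps; field; rewrite gt_eqF.
have epsn : eps * n.+1%:R = n%:R * eps + eps by rewrite -natr1; ring.
have ne0 : 0 <= n%:R * eps by rewrite mulr_ge0// ltW.
pose c : 'rV[R]_n := - ((r / 2) *: axis).
apply: (@lebesgue_rV_gt0 R n _ c eps) => // y yb.
have yc := enorm_box yb.
have yi : r / 2 - eps <= - y ord0 i0.
  have := yb i0; rewrite /c !mxE !eqxx mulr1 opprK ler_norml => /andP[_]; lra.
have ny : enorm y <= r / 2 + n%:R * eps.
  rewrite -[y](subrK c) addrC; apply: le_trans (enormD _ _) _.
  apply: lerD => //; rewrite /c enormN enormZ enorm_axis mulr1.
  by rewrite ger0_norm// divr_ge0// ltW.
have qr : 0 < q * r by rewrite mulr_gt0.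
split => /=.
  apply: le_trans yi; apply: (@le_trans _ _ (q * (r / 2 + n%:R * eps))).
    by rewrite ler_pM2l.
  have : q * (n%:R * eps) <= n%:R * eps by rewrite ler_piMl// ltW.
  move: epsE epsn; lra.
rewrite -rn nu_le_enorm ?(ltW r0)//; apply: le_trans ny _.
move: epsE epsn eps0 qr; lra.
Qed.

(** Radially, the sector takes up the fraction kap of the volume of every
    ball. *)
Lemma sector_integral (kap c : R) (g : R -> R) : 0 < kap -> 0 < c ->
  lebesgue_rV n (sector `&` [set y | nu y <= 1]) = kap%:E -> decr0 g ->
  (\int[leb]_s (g s)%:E <=
   (c / kap)%:E * \int[lebesgue_rV n]_y (g (c * nu y) * \1_sector y)%:E)%E.
Proof.
move=> k0 c0 kE gD; have [g0 gN gd] := gD.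
have mS := measurable_sector.
have mgc : measurable_fun setT (fun y : 'rV[R]_n => g (c * nu y)).
  apply: (measurableT_comp (decr0_measurable gD)).
  exact: (measurableT_comp (mulrl_measurable c) (@measurable_nu R n)).
under [X in (_ <= _ * X)%E]eq_integral do rewrite EFinM.
apply: layer_cake_ge => //.
- by apply/measurable_EFinP; exact: measurable_indic.
- by rewrite divr_ge0// ltW.
move=> s l s0 lgs.
have mL := measurable_level l mgc.
set L := level (fun y : 'rV[R]_n => g (c * nu y)) l in mL *.
rewrite (_ : (\int[_]_x _ = lebesgue_rV n (L `&` sector))%E); last first.
  under eq_integral do rewrite -EFinM indicMx.
  by rewrite integral_indic ?setIT//; exact: measurableI.
have sc : 0 < s / c by rewrite divr_gt0.
have H : ((s / c * kap)%:E <= lebesgue_rV n (L `&` sector))%E.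
  rewrite EFinM -kE -(lebesgue_rV_cone n0 mS sectorZ sc).
  rewrite -[leRHS]adde0 -(lebesgue_rV_point n0 (0 : 'rV[R]_n)).
  apply: le_trans (measureU2 _ _ _); last 2 first.
  - exact: measurableI.
  - exact: measurable_rV_point.
  apply: le_measure; rewrite ?inE.
  - by apply: measurableI => //; exact: measurable_nu_le.
  - by apply: measurableU; [exact: measurableI|exact: measurable_rV_point].
  move=> y [Sy] /= ys; have [->|y0] := eqVneq y 0; [by right|left; split => //].
  have ny : 0 < nu y by exact: nu_gt0.
  case/andP: lgs => l0 ls; rewrite /L /level/= l0; apply: le_trans ls (gd _ _ _ _).
    by rewrite mulr_gt0.
  by rewrite mulrC -ler_pdivlMr.
apply: le_trans (_ : ((c / kap)%:E * (s / c * kap)%:E <= _)%E).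
  rewrite -EFinM lee_fin le_eqVlt; apply/orP; left; apply/eqP; field.
  by rewrite !gt_eqF.
apply: lee_wpmul2l H.
by rewrite lee_fin divr_ge0// ltW.
Qed.

(** The dilation of (0, T0) onto (0, T) increases a nonincreasing function. *)
Lemma decr0_shrink (g : R -> R) (T T0 : R) : decr0 g -> 0 < T0 -> T0 <= T ->
  (forall s, T <= s -> g s = 0) ->
  (\int[leb]_s (g s)%:E <= (T / T0)%:E * \int[leb]_s (if (s < T0)%R then g s else 0%R)%:E)%E.
Proof.
move=> gD T00 T0T gT; have [g0 gN gd] := gD; have mg := decr0_measurable gD.
have T0' : 0 < T by exact: lt_le_trans T0T.
have a0 : T / T0 != 0 by rewrite gt_eqF// divr_gt0.
have mEg : measurable_fun setT (fun s : measurableTypeR R => (g s)%:E).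
  exact/measurable_EFinP.
have Eg0 s : (0 <= (g s)%:E)%E by rewrite lee_fin.
rewrite -(ge0_integral_affine1 0 a0 mEg Eg0) gtr0_norm ?divr_gt0//.
apply: lee_wpmul2l; first by rewrite lee_fin divr_ge0// ltW.
have cD := decr0_cut T0 gD.
apply: int_le.
- exact: (measurableT_comp mg (measurable_affine1 (T / T0) 0)).
- exact: (decr0_measurable cD).
- by move=> s.
move=> s; rewrite addr0; case: ltP => sT.
  have [sp|sn] := ltP 0 s; last first.
    by rewrite gN// pmulr_rle0// divr_gt0.
  by apply: gd => //; rewrite ler_peMl ?(ltW sp)// ler_pdivlMr// mul1r.
rewrite gT// mulrAC ler_pdivlMr//.
by rewrite ler_pM2l.
Qed.

End ConeMeasure.

Section LowerEstimate.
Context {R : realType}.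
Variables (n k : nat) (T a1 z1 d1 : R) (Phi : R -> R).
Hypotheses (n0 : (0 < n)%N) (k0 : (0 < k)%N) (T0 : 0 < T).
Hypotheses (a10 : 0 < a1) (z10 : 0 < z1) (d10 : 0 < d1).
Hypothesis Phi0 : forall z, 0 < z -> 0 <= Phi z.
Hypothesis Phid : forall z w, 0 < z -> z <= w -> Phi w <= Phi z.
Hypothesis sm : forall j, (j < k)%N -> forall z : R, 0 < z ->
  derivable (derive1n j Phi) z 1.
Hypothesis HMn : forall z j, 0 < z <= z1 -> (0 < j <= k)%N ->
  z ^+ (2 * j) * `|Phi_iter Phi j z| <= a1 * Phi z.
Hypothesis Hd : forall z, 0 < z <= z1 ->
  d1 * Phi z <= (-1) ^+ k * z ^+ k * derive1n k Phi z.
Let ph := phi0 Phi n.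
Let pD : decr0 ph := phi0_decr0 n Phi0 Phid.

(** Bernoulli's inequality: 1 - (1 - x)^k <= k x. *)
Lemma narrow_cone : exists2 q : R, 0 < q < 1 & coef_sum k * a1 * (1 - q ^+ k) <= d1 / 2.
Proof.
pose S : R := coef_sum k * a1 + 1.
have S0 : 0 <= coef_sum k * a1 by rewrite mulr_ge0 ?(ltW a10)// coef_sum_ge0.
have kR : 0 < k%:R :> R by rewrite ltr0n.
have Sp : 0 < S by rewrite /S ltr_wpDl.
pose x : R := Num.min (1 / 2) (d1 / 2 / (S * k%:R)).
have x0 : 0 < x by rewrite lt_min !divr_gt0// mulr_gt0.
have x1 : x <= 1 / 2 by rewrite ge_min lexx.
have x2 : x <= d1 / 2 / (S * k%:R) by rewrite ge_min lexx orbT.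
have qx : 0 < 1 - x < 1 by lra.
exists (1 - x) => //.
have B m : 1 - (1 - x) ^+ m <= m%:R * x.
  elim: m => [|m IH]; first by rewrite expr0 mul0r subrr.
  have p1 : 0 <= (1 - x) ^+ m by rewrite exprn_ge0//; lra.
  have p2 : (1 - x) ^+ m <= 1 by rewrite exprn_ile1//; lra.
  have : x * (1 - x) ^+ m <= x by rewrite ler_piMr// ltW.
  rewrite exprS mulrBl mul1r -natr1 mulrDl mul1r; lra.
apply: (@le_trans _ _ (S * (k%:R * x))).
  apply: ler_pM => //; last by rewrite /S lerDl.
  by rewrite subr_ge0 exprn_ile1//; lra.
by rewrite mulrA -ler_pdivlMl ?mulr_gt0// mulrC.
Qed.

Variables (E : ri_space_Rn R n) (Et : ri_space_Rplus R).
Hypothesis rep : representation_space E Et.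

(** With the density supported in the sector and close to the origin, all
    differences of the kernel along the axis have the sign (-1)^k: nothing
    cancels, and the pointwise lower bound in the cone integrates to the
    pairing of Omega with sig. *)
Lemma difference_lower : exists2 c4 : R, 0 < c4 & exists A : set 'rV[R]_n, measurable A /\
  forall sig, decr0 sig -> (forall s, T <= s -> sig s = 0) ->
  let f := transplant sig ((1 + k%:R) ^+ n) A in
  (E (EFin \o f) < +oo)%E ->
  (\int[leb]_s (ph s * rearr_fun f s)%:E < +oo)%E ->
  forall t, 0 < t < T -> exists2 h : 'rV[R]_n, enorm h <= t `^ n%:R^-1 &
  ((c4)%:E * \int[leb]_s (Om n k Phi t s * sig s)%:E <=
   (`|\sum_(j < k.+1) dcoef k j * pot ph f (0 + j%:R *: h)|)%:E)%E.
Proof.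
have [q /andP[q0 q1] Hq] := narrow_cone.
pose i0 : 'I_n := Ordinal n0.
have [kap kap0 kE] := sector_measure i0 q0 q1.
pose V : R := ball_volume n; have V0 : 0 < V by exact: ball_volume_gt0.
have k1 : 0 < 1 + k%:R :> R by rewrite ltr_pwDl.
have kR : 0 < k%:R :> R by rewrite ltr0n.
pose c : R := (1 + k%:R) ^+ n; have c_gt0 : 0 < c by rewrite exprn_gt0.
have c_ge1 : 1 <= c by rewrite exprn_ege1// lerDl.
pose rT := T `^ n%:R^-1; have rT0 : 0 < rT by rewrite powR_gt0.
(* c0 shortens the step so that k steps stay below z1 / 2, uniformly in t < T;
   rho keeps the support of the density within the remaining z1 / 2 *)
pose c0 := Num.min 1 (z1 / (2 * (k%:R * rT))).
have c00 : 0 < c0 by rewrite lt_min ltr01/= divr_gt0// !mulr_gt0.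
have c01 : c0 <= 1 by rewrite ge_min lexx.
have c0z : c0 <= z1 / (2 * (k%:R * rT)) by rewrite ge_min lexx orbT.
pose rho := z1 / 2; have rho0 : 0 < rho by rewrite divr_gt0.
pose s0 := V * rho ^+ n; have s00 : 0 < s0 by rewrite mulr_gt0// exprn_gt0.
(* the density lives on c nu <= c s0 only, so the pairing is first cut there *)
pose Tc := Num.min T (c * s0); have Tc0 : 0 < Tc by rewrite lt_min T0 mulr_gt0.
have TcT : Tc <= T by rewrite ge_min lexx.
have Tcs : Tc <= c * s0 by rewrite ge_min lexx orbT.
pose A := sector i0 q `&` [set y | nu y <= s0].
have mA : measurable A by apply: measurableI; [exact: measurable_sector|exact: measurable_nu_le].
pose c3 : R := d1 / 2 / (1 + k%:R) ^+ k *
    (1 + (ball_volume n `^ (k%:R / n%:R) * ((1 + k%:R) * c0) ^+ k)^-1)^-1.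
have c30 : 0 < c3.
  rewrite mulr_gt0// ?divr_gt0 ?exprn_gt0// invr_gt0 ltr_pwDl// invr_ge0.
  by rewrite mulr_ge0 ?powR_ge0// exprn_ge0// mulr_ge0 ?ltW.
pose c4 := c3 * (T / Tc * (c / kap))^-1.
have c40 : 0 < c4 by rewrite mulr_gt0// invr_gt0 !mulr_gt0 ?invr_gt0.
exists c4 => //; exists A; split => // sig sD sT f Ef psI t /andP[t0 tT].
have mf : measurable_fun setT f by exact: measurable_transplant.
have f0 x : 0 <= f x by exact: transplant_ge0.
pose r := c0 * t `^ n%:R^-1.
have rt0 : 0 < t `^ n%:R^-1 by rewrite powR_gt0.
have r0 : 0 < r by rewrite mulr_gt0.
have rtT : t `^ n%:R^-1 <= rT.
  by apply: ge0_ler_powR; rewrite ?invr_ge0 ?nnegrE// ltW.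
have kr : k%:R * r <= z1 / 2.
  apply: (@le_trans _ _ (k%:R * (z1 / (2 * (k%:R * rT)) * rT))).
    apply: ler_wpM2l; first exact: ltW.
    by apply: ler_pM => //; exact: ltW.
  rewrite le_eqVlt; apply/orP; left; apply/eqP; field.
  by rewrite !gt_eqF.
exists (r *: axis i0).
  by rewrite enormZ enorm_axis mulr1 gtr0_norm// /r ler_piMl// ltW.
have OD := Om_decr0 n k Phi0 Phid t0.
have [Og _ _] := OD; have [sg _ _] := sD.
have fF x : `|f x| <= f x by rewrite ger0_norm.
have [Hi He] := @pot_sum R n E Et rep n0 f mf f0 Ef f ph mf fF pD psI _
  (index_enum 'I_k.+1) (fun j => (-1) ^+ k * dcoef k j)
  (fun j : 'I_k.+1 => 0 + j%:R *: (r *: axis i0)).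
have -> : `|\sum_(j < k.+1) dcoef k j * pot ph f (0 + j%:R *: (r *: axis i0))| =
    `|\sum_(j < k.+1) (-1) ^+ k * dcoef k j * pot ph f (0 + j%:R *: (r *: axis i0))|.
  under [in RHS]eq_bigr => j _ do rewrite -mulrA.
  by rewrite -mulr_sumr normrM normrX normrN1 expr1n mul1r.
rewrite He; set H := (X in `|\int[_]_y X y|).
have pt (y : 'rV[R]_n) : c3 * (Om n k Phi t (c * nu y) * sig (c * nu y) * \1_A y) <= H y.
  rewrite /H /f /transplant -/c.
  have [yA|yA] := pselect (A y); last first.
    by rewrite indicE memNset// !mulr0.
  rewrite indicE mem_set// !mulr1 mulrA.
  have [->|y0] := eqVneq y 0.
    by rewrite /nu enorm0 expr0n gtn_eqF// !mulr0; case: sD => _ -> //; rewrite !mulr0.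
  apply: ler_wpM2r => //.
  have [Sy ys] := yA.
  pose z := - y; have z0 : z != 0 by rewrite oppr_eq0.
  have zq : q * enorm z <= dotp z (axis i0) by rewrite dotp_axis /z enormN mxE.
  have nz : enorm z <= rho by rewrite -nu_le_enorm ?(ltW rho0)// /z nuN.
  have zr : enorm z + k%:R * (c0 * t `^ n%:R^-1) <= z1.
    by move: nz kr; rewrite /rho -/r; lra.
  have := @cone_difference_Om R n k a1 z1 d1 Phi n0 k0 a10 d10 Phi0 Phid sm HMn Hd
    q q0 (ltW q1) Hq (axis i0) (enorm_axis i0) z t c0 z0 zq t0 c00 zr.
  rewrite -/c -/c3 /z nuN => /le_trans; apply.
  rewrite /fdiff mulr_sumr le_eqVlt; apply/orP; left; apply/eqP.
  apply: eq_bigr => j _; rewrite -/r add0r mulrA; congr (_ * _).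
  have js : 0 <= j%:R * r by rewrite mulr_ge0// ltW.
  have [zs0 _ _] := @cone_line R n q q0 (ltW q1) (axis i0) (enorm_axis i0) z (j%:R * r) z0 zq js.
  rewrite add0r scalerA [in RHS]addrC -/z /ph phi0_nu//.
have H0 y : 0 <= H y.
  apply: le_trans (pt y); apply: mulr_ge0; first exact: ltW.
  by apply: mulr_ge0 => //; exact: mulr_ge0.
have HE : (`|\int[lebesgue_rV n]_y H y|%:E = \int[lebesgue_rV n]_y (H y)%:E)%E.
  rewrite ger0_norm; last by apply: Rintegral_ge0 => w _; exact: H0.
  by rewrite /Rintegral fineK//; apply: integrable_fin_num => //; exact: Hi.
rewrite HE.
pose G s := Om n k Phi t s * sig s.
have GD : decr0 G by exact: decr0M.
pose g s := if s < Tc then G s else 0.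
have gD : decr0 g by exact: decr0_cut.
have GT s : T <= s -> G s = 0 by move=> Ts; rewrite /G sT// mulr0.
have I1 := decr0_shrink GD Tc0 TcT GT.
have I2 := sector_integral kap0 c_gt0 kE gD.
set I := (\int[leb]_s (G s)%:E)%E in I1 *.
have [g_ge0 gN _] := gD.
have mgc : measurable_fun setT (fun y : 'rV[R]_n => g (c * nu y) * \1_(sector i0 q) y).
  apply: measurable_funM; last by apply: measurable_indic; exact: measurable_sector.
  apply: (measurableT_comp (decr0_measurable gD)).
  exact: (measurableT_comp (mulrl_measurable c) (@measurable_nu R n)).
have gc0 y : 0 <= g (c * nu y) * \1_(sector i0 q) y by rewrite mulr_ge0.
have I3 : (c3%:E * \int[lebesgue_rV n]_y (g (c * nu y) * \1_(sector i0 q) y)%:E <=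
    \int[lebesgue_rV n]_y (H y)%:E)%E.
  rewrite -int_scale ?(ltW c30)//; apply: int_le.
  - exact: measurable_funM.
  - by apply/measurable_EFinP; case/integrableP: Hi.
  - by move=> y; rewrite mulr_ge0// ltW.
  move=> y; apply: le_trans (pt y); apply: ler_wpM2l; first exact: ltW.
  rewrite /g /G; case: ltP => [yT|_]; last first.
    by rewrite mul0r; apply: mulr_ge0 => //; exact: mulr_ge0.
  apply: ler_wpM2l; first exact: mulr_ge0.
  rewrite !indicE; case: (boolP (y \in sector i0 q)) => // yS.
  rewrite mem_set//; split; first by rewrite inE in yS.
  rewrite /=; rewrite -(ler_pM2l c_gt0); apply: ltW; exact: lt_le_trans yT Tcs.
apply: le_trans I3.
rewrite /c4 EFinM -muleA; apply: lee_wpmul2l; first by rewrite lee_fin ltW.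
set D := T / Tc * (c / kap).
have D0 : 0 < D by rewrite /D mulr_gt0// divr_gt0.
apply: (@le_trans _ _ ((D^-1)%:E * (D%:E * \int[lebesgue_rV n]_y (g
  (c * nu y) * \1_(sector i0 q) y)%:E))%E).
  apply: lee_wpmul2l; first by rewrite lee_fin invr_ge0 ltW.
  apply: le_trans I1 _; rewrite /D [X in (_ <= X * _)%E]EFinM -muleA.
  by apply: lee_wpmul2l => //; rewrite lee_fin divr_ge0// ltW.
by rewrite muleA -EFinM mulVf ?mul1e// gt_eqF.
Qed.

End LowerEstimate.

(** * Best constants and quotient norms *)

Section BestConstants.
Context {R : realType}.

Lemma le_mul_inf (A : set R) (c v : R) : A !=set0 -> 0 <= c ->
  (forall a, A a -> v <= c * a) -> v <= c * inf A.
Proof.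
move=> A0; rewrite le0r => /orP[/eqP -> {c}|c0] H.
  by have [a Aa] := A0; have := H _ Aa; rewrite !mul0r.
rewrite -ler_pdivrMl//; apply: lb_le_inf => // a Aa.
by rewrite ler_pdivrMl// H.
Qed.

Variables (V : Type) (Y : set V) (nY nZ : V -> R).
Hypothesis nY0 : forall u, Y u -> 0 <= nY u.
Let C := [set c : R | 0 <= c /\ forall u, Y u -> nZ u <= c * nY u].

Let C_lb : has_lbound C. Proof. by exists 0 => c -[]. Qed.

Lemma embedding_norm_le (c : R) : 0 <= c ->
  (forall u, Y u -> nZ u <= c * nY u) -> embedding_norm Y nY nZ <= c.
Proof. by move=> c0 H; apply: ge_inf => //; split. Qed.

Lemma embedding_norm_ge0 : 0 <= embedding_norm Y nY nZ.
Proof.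
change (0 <= inf C); have [->|/set0P C0] := eqVneq C set0; first by rewrite inf0.
by apply: lb_le_inf => // c -[].
Qed.

Lemma embedding_norm_attained (c : R) : 0 <= c ->
  (forall u, Y u -> nZ u <= c * nY u) ->
  forall u, Y u -> nZ u <= embedding_norm Y nY nZ * nY u.
Proof.
move=> c0 H u Yu; rewrite mulrC; apply: le_mul_inf; [by exists c; split|exact: nY0|].
by move=> a [_ Ha]; rewrite mulrC; exact: Ha.
Qed.

End BestConstants.

Section Potentials.
Context {R : realType}.
Variables (n : nat) (E : ri_space_Rn R n) (G : 'rV[R]_n -> R).

Lemma ri_normc_ge0 f : ri_mem E f -> 0 <= ri_normc E f.
Proof.
move=> [mr mi _]; rewrite fine_ge0// fnorm_ge0//.
by apply: Mplus_EFin => [|x]; [exact: measurable_cmod|exact: cmod_ge0].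
Qed.

Lemma ri_normcE f : ri_mem E f -> E (EFin \o (fun x => cmod (f x))) = (ri_normc E f)%:E.
Proof.
move=> [mr mi fin]; rewrite /ri_normc fineK// ge0_fin_numE// fnorm_ge0//.
by apply: Mplus_EFin => [|x]; [exact: measurable_cmod|exact: cmod_ge0].
Qed.

Lemma potential_norm_ge0 u : 0 <= potential_norm E G u.
Proof.
rewrite /potential_norm; set A := [set _ | _ in _].
have [->|/set0P A0] := eqVneq A set0; first by rewrite inf0.
by apply: lb_le_inf => // _ [f [Ef _] <-]; exact: ri_normc_ge0.
Qed.

Lemma potential_norm_le f : ri_mem E f ->
  potential_norm E G (convolution G f) <= ri_normc E f.
Proof.
move=> Ef; apply: ge_inf; last by exists f.
by exists 0 => _ [g [Eg _] <-]; exact: ri_normc_ge0.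
Qed.

Lemma potential_normP (c : R) (p : ('rV[R]_n -> R[i]) -> R) : 0 <= c ->
  (forall f, ri_mem E f -> p (convolution G f) <= c * ri_normc E f) ->
  forall u, potentials E G u -> p u <= c * potential_norm E G u.
Proof.
move=> c0 H u [f Ef fu]; apply: le_mul_inf => //.
  by exists (ri_normc E f), f.
by move=> _ [g [Eg <-] <-]; exact: H.
Qed.

Lemma ri_memB f g : ri_mem E f -> ri_mem E g -> ri_mem E (f - g).
Proof.
move=> Ef Eg; have [mfr mfi fin] := Ef; have [mgr mgi gin] := Eg.
have mr : measurable_fun setT (fun x => complex.Re ((f - g) x)).
  apply: (eq_measurable_fun (fun x => complex.Re (f x) - complex.Re (g x))).
    by move=> x _; rewrite !fctE; case: (f x); case: (g x).
  exact: measurable_funB.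
have mi : measurable_fun setT (fun x => complex.Im ((f - g) x)).
  apply: (eq_measurable_fun (fun x => complex.Im (f x) - complex.Im (g x))).
    by move=> x _; rewrite !fctE; case: (f x); case: (g x).
  exact: measurable_funB.
split => //.
have Mf : Mplus setT (EFin \o (fun x => cmod (f x))).
  by apply: Mplus_EFin => [|x]; [exact: measurable_cmod|exact: cmod_ge0].
have Mg : Mplus setT (EFin \o (fun x => cmod (g x))).
  by apply: Mplus_EFin => [|x]; [exact: measurable_cmod|exact: cmod_ge0].
have Mfg : Mplus setT (EFin \o (fun x => cmod ((f - g) x))).
  by apply: Mplus_EFin => [|x]; [exact: measurable_cmod|exact: cmod_ge0].
have Ms : Mplus setT (fun x => (cmod (f x))%:E + (cmod (g x))%:E)%E.
  split => [|x _]; last by rewrite -EFinD lee_fin addr_ge0 ?cmod_ge0.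
  apply: (eq_measurable_fun (EFin \o (fun x => cmod (f x) + cmod (g x)))) => //.
  apply/measurable_EFinP; apply: measurable_funD; exact: measurable_cmod.
apply: (@le_lt_trans _ _ (E (fun x => (cmod (f x))%:E + (cmod (g x))%:E)%E)).
  apply: fnorm_mono => // x _; rewrite -EFinD lee_fin.
  have -> : cmod (g x) = cmod (- g x) by case: (g x) => a b; rewrite /cmod/= !sqrrN.
  exact: cmodD.
by apply: le_lt_trans (fnormD _ Mf Mg) _; rewrite lte_add_pinfty.
Qed.

Lemma ri_mem_real (F : 'rV[R]_n -> R) : measurable_fun setT F -> (forall x, 0 <= F x) ->
  (E (EFin \o F) < +oo)%E -> ri_mem E (fun x => Complex (F x) 0).
Proof.
move=> mF F0 EF; split => //.
rewrite (_ : (fun x => _) = EFin \o F)//.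
by apply/funext => x; rewrite cmod_real ger0_norm.
Qed.

Lemma ri_normc_real (F : 'rV[R]_n -> R) : (forall x, 0 <= F x) ->
  ri_normc E (fun x => Complex (F x) 0) = fine (E (EFin \o F)).
Proof.
move=> F0; rewrite /ri_normc (_ : (fun x => _) = EFin \o F)//.
by apply/funext => x; rewrite cmod_real ger0_norm.
Qed.

End Potentials.

(** * Suprema and moduli of continuity *)

Section SupNorms.
Context {R : realType}.
Variables (n : nat).
Implicit Types (u : 'rV[R]_n -> R[i]).

Lemma norm_C_le u (M : R) : (forall x, cmod (u x) <= M) -> norm_C u <= M.
Proof.
by move=> H; apply: ge_sup => [|_ [x _ <-]//]; exists (cmod (u 0)), 0.
Qed.

Lemma le_norm_C u (M : R) x : (forall x, cmod (u x) <= M) -> cmod (u x) <= norm_C u.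
Proof.
by move=> H; apply: ub_le_sup; [exists M => _ [y _ <-]|exists x].
Qed.

Lemma norm_C_ge0 u (M : R) : (forall x, cmod (u x) <= M) -> 0 <= norm_C u.
Proof. by move=> H; exact: le_trans (cmod_ge0 (u 0)) (le_norm_C 0 H). Qed.

Variables (k : nat) (u : 'rV[R]_n -> R[i]) (M : R -> R).
Hypothesis HM : forall t h x, 0 < t -> enorm h <= t `^ n%:R^-1 ->
  cmod (finite_difference k h u x) <= M t.

Lemma modulus_root_le t : 0 < t -> modulus_root k u t <= M t.
Proof.
move=> t0; apply: ge_sup.
  by exists (norm_C (finite_difference k 0 u)), 0 => //=; rewrite enorm0 powR_ge0.
by move=> _ [h /= ht <-]; apply: norm_C_le => x; exact: HM.
Qed.

Lemma le_modulus_root t h : 0 < t -> enorm h <= t `^ n%:R^-1 ->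
  norm_C (finite_difference k h u) <= modulus_root k u t.
Proof.
move=> t0 ht; apply: ub_le_sup; last by exists h.
by exists (M t) => _ [h' /= ht' <-]; apply: norm_C_le => x; exact: HM.
Qed.

Lemma cmod_le_modulus_root t h x : 0 < t -> enorm h <= t `^ n%:R^-1 ->
  cmod (finite_difference k h u x) <= modulus_root k u t.
Proof.
move=> t0 ht; apply: le_trans (le_modulus_root t0 ht).
by apply: (@le_norm_C _ (M t)) => y; exact: HM.
Qed.

Lemma modulus_root_ge0 t : 0 < t -> 0 <= modulus_root k u t.
Proof.
move=> t0; have h0 : enorm (0 : 'rV[R]_n) <= t `^ n%:R^-1 by rewrite enorm0 powR_ge0.
exact: le_trans (cmod_ge0 _) (cmod_le_modulus_root 0 t0 h0).
Qed.

Lemma modulus_root_homo s t : 0 < s -> s <= t -> modulus_root k u s <= modulus_root k u t.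
Proof.
move=> s0 st; have t0 := lt_le_trans s0 st; apply: ge_sup.
  by exists (norm_C (finite_difference k 0 u)), 0 => //=; rewrite enorm0 powR_ge0.
move=> _ [h /= hs <-]; apply: le_modulus_root => //; apply: le_trans hs _.
by apply: ge0_ler_powR => //; rewrite ?invr_ge0 ?nnegrE ?(ltW s0) ?(ltW t0).
Qed.

End SupNorms.

Section NondecreasingMeasurable.
Context {R : realType}.

Lemma nondecreasing_itv0_measurable (T : R) (g : R -> R) :
  (forall t, 0 < t -> 0 <= g t) ->
  (forall s t, 0 < s -> s <= t -> g s <= g t) ->
  measurable_fun (itv0 T) g.
Proof.
move=> g0 gm.
apply: (eq_measurable_fun (extend0 g)).
  by move=> t; rewrite inE /itv0/= in_itv/= => /andP[t0 _]; rewrite extend0E.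
apply: nondecreasing_measurable; first exact: measurable_itv.
move=> s t st; rewrite /extend0; case: ifPn => [s0|_].
  by rewrite (lt_le_trans s0 st); exact: gm.
by case: ifPn => // /g0.
Qed.

End NondecreasingMeasurable.

(** * Consequences of the derivative bounds *)

Section DerivativeBounds.
Context {R : realType}.
Variables (k : nat) (Phi : R -> R) (a1 a2 z1 : R).
Hypotheses (k0 : (0 < k)%N) (a10 : 0 < a1) (a20 : 0 < a2) (z10 : 0 < z1).
Hypothesis Phi0 : forall z, 0 < z -> 0 <= Phi z.
Hypothesis Phid : forall z w, 0 < z -> z <= w -> Phi w <= Phi z.
Hypothesis sm : forall j, (j < k)%N -> forall z : R, 0 < z ->
  derivable (derive1n j Phi) z 1.

Lemma bigmax_bound (z c : R) (j : nat) :
  \big[Num.max/0]_(1 <= j < k.+1) (z ^+ (2 * j) * `|Phi_iter Phi j z|) <= c ->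
  (0 < j <= k)%N -> z ^+ (2 * j) * `|Phi_iter Phi j z| <= c.
Proof.
move=> H /andP[j0 jk]; apply: le_trans H.
by apply: (@le_bigmax_seq _ _ _ _ 0 j xpredT) => //; rewrite mem_index_iota j0 ltnS.
Qed.

Hypothesis near : forall z, 0 < z <= z1 ->
  \big[Num.max/0]_(1 <= j < k.+1) (z ^+ (2 * j) * `|Phi_iter Phi j z|) <= a1 * Phi z.
Hypothesis far : forall z, z1 < z ->
  \big[Num.max/0]_(1 <= j < k.+1) (z ^+ (2 * j) * `|Phi_iter Phi j z|)
    <= a2 * z ^+ k * Phi z.

Lemma derivative_bound z j : 0 < z -> (0 < j <= k)%N ->
  z ^+ (2 * j) * `|Phi_iter Phi j z| <= (a1 + a2 * z ^+ k) * Phi z.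
Proof.
move=> z0 jk; have zk : 0 <= a2 * z ^+ k by rewrite mulr_ge0 ?exprn_ge0 ?ltW.
have Pz := Phi0 z0; rewrite mulrDl; have [zz1|zz1] := leP z z1.
  apply: le_trans (_ : a1 * Phi z <= _); last by rewrite lerDl mulr_ge0.
  by apply: bigmax_bound => //; apply: near; rewrite z0.
apply: le_trans (_ : a2 * z ^+ k * Phi z <= _); last by rewrite lerDr mulr_ge0// ltW.
by apply: bigmax_bound => //; apply: far.
Qed.

(** The case j = 1 of the derivative bounds, and the mean value theorem. *)
Lemma locally_lipschitz (r1 r2 : R) : 0 < r1 -> exists2 L, 0 <= L &
  forall u v, r1 <= u -> u <= v -> v <= r2 -> Phi u - Phi v <= L * (v - u).
Proof.
move=> r10; exists ((a1 + a2 * `|r2| ^+ k) * Phi r1 / r1).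
  rewrite divr_ge0 ?(ltW r10)// mulr_ge0 ?Phi0// addr_ge0 ?(ltW a10)//.
  by rewrite mulr_ge0 ?exprn_ge0 ?(ltW a20).
move=> u v r1u uv vr2.
have [|c /andP[uc cv] E] := @MVT_diff R Phi (derive1 Phi) u v uv.
  move=> x /andP[ux _]; have x0 : 0 < x by exact: lt_le_trans (le_trans r1u ux).
  by apply: DeriveDef; [exact: (sm k0 x0)|rewrite derive1E].
have c0 : 0 < c by exact: lt_le_trans (le_trans r1u uc).
have r20 : 0 <= r2 by apply: le_trans (ltW c0) _; exact: le_trans cv vr2.
rewrite -opprB E -mulNr; apply: ler_wpM2r; first by rewrite subr_ge0.
have := derivative_bound c0 (_ : (0 < 1 <= k)%N); rewrite k0 => /(_ isT).
rewrite muln1 /Phi_iter/= normrM normfV (gtr0_norm c0).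
rewrite (_ : c ^+ 2 * _ = c * `|derive1 Phi c|); last first.
  by rewrite expr2 -mulrA [X in _ * X]mulrA mulfV ?mul1r// gt_eqF.
move=> H; apply: le_trans (ler_norm _) _; rewrite normrN ler_pdivlMr//.
apply: le_trans (_ : c * `|derive1 Phi c| <= _).
  by rewrite mulrC ler_wpM2r// (le_trans r1u uc).
apply: le_trans H _; apply: ler_pM.
- by rewrite addr_ge0 ?(ltW a10)// mulr_ge0 ?exprn_ge0 ?(ltW a20)// ltW.
- exact: Phi0.
- rewrite lerD2l ler_wpM2l ?(ltW a20)// ger0_norm//; apply: lerXn2r; rewrite ?nnegrE ?(ltW c0)//.
  exact: le_trans cv vr2.
- by apply: Phid => //; exact: le_trans r1u uc.
Qed.

End DerivativeBounds.

(** * The kernel at the origin *)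

Section KernelAtOrigin.
Context {R : realType}.
Variables (n : nat) (Phi : R -> R).
Hypothesis n0 : (0 < n)%N.
Hypothesis Phi0 : forall z, 0 < z -> 0 <= Phi z.
Hypothesis Phid : forall z w, 0 < z -> z <= w -> Phi w <= Phi z.
Let ph := phi0 Phi n.
Let pD : decr0 ph. Proof. exact: phi0_decr0. Qed.

Lemma radial_kernelE (z : 'rV[R]_n) :
  radial_kernel Phi z = ph (nu z) + Phi 0 * \1_[set 0] z.
Proof.
rewrite /radial_kernel indicE; have [->|z0] := eqVneq z 0.
  have [_ pN _] := pD; have -> : (0 : 'rV[R]_n) \in [set 0] by rewrite inE.
  by rewrite enorm0 mulr1 pN ?add0r// /nu enorm0 expr0n gtn_eqF// mulr0.
rewrite memNset; last by move=> /= zz; rewrite zz eqxx in z0.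
by rewrite mulr0 addr0 [ph _]phi0_nu.
Qed.

(** The two kernels differ at the origin only, and points have measure zero. *)
Lemma Rintegral_radial_kernel (f : 'rV[R]_n -> R) x : measurable_fun setT f ->
  \int[lebesgue_rV n]_y (radial_kernel Phi (x - y) * f y) = pot ph f x.
Proof.
move=> mf; rewrite /pot /Rintegral; congr fine.
have mg := measurable_comp_sub x (@measurable_radial R n ph pD).
have mi : measurable_fun setT (fun y : 'rV[R]_n => \1_[set x] y : R).
  by apply: measurable_indic; exact: measurable_rV_point.
have m1 : measurable_fun setT (fun y : 'rV[R]_n => ph (nu (x - y)) * f y) by exact: measurable_funM.
have m2 : measurable_fun setT (fun y : 'rV[R]_n => radial_kernel Phi (x - y) * f y).
  apply: (eq_measurable_fun (fun y : 'rV[R]_n => (ph (nu (x - y)) + Phi 0 * \1_[set x] y) * f y)).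
    move=> y _; rewrite radial_kernelE !indicE.
    have -> // : (x - y \in [set 0]) = (y \in [set x]).
    apply/idP/idP; rewrite !inE/=; last by move=> ->; rewrite subrr.
    by move=> /eqP; rewrite subr_eq0 => /eqP.
  apply: measurable_funM => //; apply: measurable_funD => //.
  by apply: measurable_funM => //; exact: measurable_cst.
have e1 : measurable_fun setT (fun y : 'rV[R]_n => (radial_kernel Phi
  (x - y) * f y)%:E) by exact/measurable_EFinP.
have e2 : measurable_fun setT (fun y : 'rV[R]_n => (ph (nu
  (x - y)) * f y)%:E) by exact/measurable_EFinP.
apply: (ae_eq_integral _ _ _ e1 e2) => //.
exists [set x]; split; [exact: measurable_rV_point|exact: lebesgue_rV_point|].
move=> y /= H; apply/eqP; apply/negPn/negP => yx; apply: H => _.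
rewrite radial_kernelE indicE memNset ?mulr0 ?addr0//= => /eqP.
by rewrite subr_eq0 eq_sym (negbTE yx).
Qed.

Lemma convolution_radial_kernel (f : 'rV[R]_n -> R[i]) :
  measurable_fun setT (fun x => complex.Re (f x)) ->
  measurable_fun setT (fun x => complex.Im (f x)) ->
  convolution (radial_kernel Phi) f =
  fun x => Complex (pot ph (fun x => complex.Re (f x)) x) (pot ph (fun x => complex.Im (f x)) x).
Proof.
by move=> mr mi; apply/funext => x; rewrite /convolution !Rintegral_radial_kernel.
Qed.

End KernelAtOrigin.

(** * Pairing with the profile *)

Definition tail_consts {R : realType} (Phi : R -> R) (n : nat) (T : R) : set R :=
  [set C | 0 < C /\ forall sig, decr0 sig ->
    (\int[leb]_s (phi0 Phi n s * sig s)%:E <=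
     C%:E * \int[leb]_s ((if s < T then phi0 Phi n s else 0) * sig s)%R%:E)%E].

(** Some constant for the tail bound, chosen as a function of the profile, the
    dimension and T, so that the second estimate of the embedding norm may
    depend on it. *)
Definition tail_const {R : realType} (Phi : R -> R) (n : nat) (T : R) : R :=
  xget 1 (tail_consts Phi n T).

Section Pairing.
Context {R : realType}.
Variables (n : nat) (T : R) (Et : ri_space_Rplus R) (Phi : R -> R).
Hypotheses (n0 : (0 < n)%N) (T0 : 0 < T).
Hypothesis Phi0 : forall z, 0 < z -> 0 <= Phi z.
Hypothesis Phid : forall z w, 0 < z -> z <= w -> Phi w <= Phi z.
Hypothesis PhiI : (0 < \int[leb]_(z in Rplus) (Phi z * z ^+ n.-1)%:E < +oo)%E.
Hypothesis Nfin : (associate_norm Et (zero_ext T (profile Phi n)) < +oo)%E.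

Let ph := phi0 Phi n.
Let phT s := if s < T then ph s else 0.
Let C := tail_const Phi n T.
Let N := fine (associate_norm Et (zero_ext T (profile Phi n))).
Let pD : decr0 ph. Proof. exact: phi0_decr0. Qed.
Let pTD : decr0 phT. Proof. exact: decr0_cut. Qed.

Lemma tail_constP : tail_consts Phi n T C.
Proof.
have [c c0 Hc] := profile_tail n0 Phi0 Phid PhiI T0.
by apply: xgetPex; exists c; split.
Qed.

Lemma zero_ext_profile : zero_ext T (profile Phi n) = EFin \o phT.
Proof. by rewrite /zero_ext restrict_cut. Qed.

Lemma decr0_0 : decr0 (fun=> 0 : R). Proof. by []. Qed.

Lemma associate_norm_fin : associate_norm Et (EFin \o phT) = N%:E.
Proof.
rewrite /N; move: Nfin; rewrite zero_ext_profile => Nf.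
have E0 : (Et (EFin \o (fun=> 0%R : R)) <= 1%:E)%E.
  have -> : Et (EFin \o (fun=> 0%R : R)) = 0%E; last by [].
  by apply/fnorm_eq0; [exact/Mplus_decr0/decr0_0|apply: aeW].
have := associate_norm_ge pTD decr0_0 ltr01 E0.
under eq_integral do rewrite mulr0; rewrite integral0.
case: associate_norm Nf => //= _.
by rewrite mulr1 gt0_muleNy.
Qed.

Lemma pairing_le (sig : R -> R) (M : R) : decr0 sig -> 0 < M ->
  (Et (EFin \o sig) <= M%:E)%E ->
  (\int[leb]_s (phT s * sig s)%:E <= (2 * M * N)%:E)%E.
Proof.
by move=> sD M0 sM; rewrite EFinM -associate_norm_fin; exact: associate_norm_ge.
Qed.

Lemma pairing_tail_le (sig : R -> R) (M : R) : decr0 sig -> 0 < M ->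
  (Et (EFin \o sig) <= M%:E)%E ->
  (\int[leb]_s (ph s * sig s)%:E <= (C * (2 * M * N))%:E)%E.
Proof.
move=> sD M0 sM; have [C0 H] := tail_constP; apply: le_trans (H _ sD) _.
by rewrite EFinM; apply: lee_wpmul2l; [rewrite lee_fin ltW|exact: pairing_le].
Qed.

(** The profile is positive near the origin, so it pairs nontrivially with the
    indicator of a short interval. *)
Lemma associate_norm_gt0 : 0 < N.
Proof.
have [T' [/andP[T'0 T'T] pT']] := phi0_gt0 n0 Phi0 Phid PhiI T0.
have [_ pN pd] := pD.
pose sig (s : R) : R := if 0 < s <= T' then 1 else 0.
have sD : decr0 sig by exact: decr0_upto.
have mI : measurable ([set` `]0%R, T']%R] : set (measurableTypeR R)) by exact: measurable_itv.
have sE s : sig s = \1_[set` `]0%R, T']%R] s.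
  rewrite /sig indicE; have -> : (s \in [set` `]0%R, T']%R]) = (0 < s <= T').
    by apply/idP/idP; rewrite inE/= in_itv.
  by case: ifP.
have LE : leb [set` `]0%R, T']%R] = T'%:E by exact: lebesgue_0itv (ltW T'0).
have sfin : (Et (EFin \o sig) < +oo)%E.
  rewrite (_ : EFin \o sig = fun s => (\1_[set` `]0%R, T']%R] s)%:E); last first.
    by apply/funext => s; rewrite /= sE.
  apply: fnorm_indic => //; last by change (leb [set` `]0%R, T']%R] < +oo)%E; rewrite LE ltry.
  by move=> s; rewrite /Rplus/= !in_itv/= => /andP[-> _].
have sM := fnorm_fin (Mplus_decr0 sD) sfin.
have s0 : (0 <= Et (EFin \o sig))%E by apply: fnorm_ge0; exact: Mplus_decr0.
pose M := fine (Et (EFin \o sig)) + 1.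
have M0 : 0 < M by rewrite ltr_wpDl// fine_ge0.
have H : (Et (EFin \o sig) <= M%:E)%E.
  by rewrite -(fineK sM) lee_fin lerDl.
have := pairing_le sD M0 H => P.
have L : ((ph T' * T')%:E <= \int[leb]_s (phT s * sig s)%:E)%E.
  apply: (@le_trans _ _ (\int[leb]_s (ph T' * sig s)%:E)%E).
    have [sg0 _ _] := sD; rewrite (int_scale _ (decr0_measurable sD) (ltW pT') sg0).
    have -> : (\int[leb]_s (sig s)%:E)%E = T'%:E.
      under eq_integral do rewrite sE.
      by rewrite integral_indic// setIT.
    by rewrite EFinM.
  apply: int_le.
  - by apply: measurable_funM; [exact: measurable_cst|exact: decr0_measurable].
  - by apply: measurable_funM; exact: decr0_measurable.
  - by move=> s; rewrite mulr_ge0 ?(ltW pT')//; case: sD.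
  move=> s; rewrite /sig; case: ifP => [/andP[s_gt0 sT']|_]; last by rewrite !mulr0.
  by rewrite !mulr1 /phT (le_lt_trans sT' T'T); exact: pd.
have := le_trans L P; rewrite lee_fin => Q.
have : 0 < 2 * M * N by apply: lt_le_trans Q; rewrite mulr_gt0.
by rewrite pmulr_rgt0// mulr_gt0.
Qed.

Lemma pairing_witness : exists sig : R -> R,
  [/\ decr0 sig, (Et (EFin \o sig) <= 1)%E &
      ((N / 2)%:E <= \int[leb]_s (phT s * sig s)%:E)%E].
Proof.
have N0 := associate_norm_gt0.
have [|sig [sD s1 /ltW H]] := @associate_norm_approx _ Et phT (N / 2) pTD.
  by rewrite associate_norm_fin lte_fin ltr_pdivrMr// mulr_natr mulr2n ltrDl.
by exists sig.
Qed.

End Pairing.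

(** * Members of the cone *)

Section ConeIntegrals.
Context {R : realType}.
Variables (n k : nat) (T : R) (Et : ri_space_Rplus R) (Phi : R -> R).
Hypotheses (n0 : (0 < n)%N) (k0 : (0 < k)%N) (T0 : 0 < T).
Hypothesis Phi0 : forall z, 0 < z -> 0 <= Phi z.
Hypothesis Phid : forall z w, 0 < z -> z <= w -> Phi w <= Phi z.
Hypothesis PhiI : (0 < \int[leb]_(z in Rplus) (Phi z * z ^+ n.-1)%:E < +oo)%E.
Hypothesis Nfin : (associate_norm Et (zero_ext T (profile Phi n)) < +oo)%E.

Let ph := phi0 Phi n.
Let phT s := if s < T then ph s else 0.
Let phi := profile Phi n.
Let kn : R := k%:R / n%:R.
Let N := fine (associate_norm Et (zero_ext T (profile Phi n))).
Let pD : decr0 ph. Proof. exact: phi0_decr0. Qed.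
Let pTD : decr0 phT. Proof. exact: decr0_cut. Qed.

(** The member of the cone generated by sig. *)
Definition cone_fun (sig : R -> R) (t : R) : R :=
  fine (\int[leb]_s (Om_cut n k T Phi t s * sig s)%:E)%E.

Lemma Om_le t s : 0 < t -> Om n k Phi t s <= ph s.
Proof.
move=> t0; have [p0 _ _] := pD; rewrite /Om -/ph ler_pdivrMr.
  by rewrite ler_peMr// lerDl powR_ge0.
by rewrite ltr_pwDl// powR_ge0.
Qed.

Lemma Om_cut_le t s : 0 < t -> Om_cut n k T Phi t s <= phT s.
Proof. by move=> t0; rewrite /Om_cut /phT; case: ifP => // _; exact: Om_le. Qed.

Lemma Om_cut_homo s t u : 0 < s -> s <= t -> Om_cut n k T Phi s u <= Om_cut n k T Phi t u.
Proof.
move=> s0 st; have t0 := lt_le_trans s0 st; have [p0 pN _] := pD.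
rewrite /Om_cut; case: ifP => // _; rewrite /Om -/ph; have [u0|u0] := leP u 0.
  by rewrite pN// !mul0r.
have den r : 0 < 1 + (u / r) `^ (k%:R / n%:R) by rewrite ltr_pwDl// powR_ge0.
apply: ler_wpM2l => //; rewrite lef_pV2 ?posrE// lerD2l; apply: ge0_ler_powR.
- exact: divr_ge0.
- by rewrite nnegrE divr_ge0// ltW.
- by rewrite nnegrE divr_ge0// ltW.
- by rewrite ler_pM2l// lef_pV2// posrE.
Qed.

Lemma cone_integral_cut (sig : R -> R) (t : R) : decr0 sig -> 0 < t ->
  (\int[leb]_(tau in itv0 T) (Omega n k phi t tau * sig tau)%:E)%E =
  (\int[leb]_s (Om_cut n k T Phi t s * sig s)%:E)%E.
Proof.
move=> [_ sN _] t0; rewrite integral_mkcond; apply: eq_integral => s _.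
rewrite patchE in_itv0.
rewrite /Om_cut; have [s0|s0] := leP s 0; first by rewrite /= sN// mulr0.
by rewrite /=; case: ltP => _; rewrite ?mul0r// Om_Omega.
Qed.

Lemma cone_fun_pairing (sig : R -> R) t : decr0 sig -> 0 < t ->
  (\int[leb]_s (Om_cut n k T Phi t s * sig s)%:E <= \int[leb]_s (phT s * sig s)%:E)%E.
Proof.
move=> sD t0; have OD := Om_cut_decr0 n k T Phi0 Phid t0.
have [Og _ _] := OD; have [s0 _ _] := sD; apply: int_le.
- by apply: measurable_funM; exact: decr0_measurable.
- by apply: measurable_funM; exact: decr0_measurable.
- by move=> s; rewrite mulr_ge0.
by move=> s; rewrite ler_wpM2r// Om_cut_le.
Qed.

Lemma finite_bound (sig : R -> R) : decr0 sig -> (Et (EFin \o sig) < +oo)%E ->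
  exists M, [/\ 0 < M & (Et (EFin \o sig) <= M%:E)%E].
Proof.
move=> sD sfin; have sM := fnorm_fin (Mplus_decr0 sD) sfin.
exists (fine (Et (EFin \o sig)) + 1); split.
  by rewrite ltr_wpDl// fine_ge0// fnorm_ge0//; exact: Mplus_decr0.
by rewrite -[X in (X <= _)%E](fineK sM) lee_fin lerDl.
Qed.

Lemma cone_funE (sig : R -> R) t : decr0 sig -> (Et (EFin \o sig) < +oo)%E -> 0 < t ->
  (cone_fun sig t)%:E = (\int[leb]_s (Om_cut n k T Phi t s * sig s)%:E)%E.
Proof.
move=> sD sfin t0; have [M [M0 sM]] := finite_bound sD sfin.
have [Og _ _] := Om_cut_decr0 n k T Phi0 Phid t0; have [s0 _ _] := sD.
rewrite /cone_fun fineK// ge0_fin_numE; last by apply: int_ge0 => s; exact: mulr_ge0.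
apply: le_lt_trans (cone_fun_pairing sD t0) _.
exact: le_lt_trans (pairing_le Phi0 Phid Nfin sD M0 sM) (ltry _).
Qed.

Lemma cone_fun_ge0 (sig : R -> R) t : decr0 sig -> 0 < t -> 0 <= cone_fun sig t.
Proof.
move=> [s0 _ _] t0; have [Og _ _] := Om_cut_decr0 n k T Phi0 Phid t0.
by rewrite fine_ge0//; apply: int_ge0 => s; exact: mulr_ge0.
Qed.

Lemma zero_ext_le (sig : R -> R) : decr0 sig ->
  (Et (zero_ext T sig) <= Et (EFin \o sig))%E.
Proof.
move=> sD; have [s0 sN sd] := sD.
have rD : decr0 (sig \_ (itv0 T)).
  by apply: decr0_restrict => // t1 t2 ? ? _; exact: sd.
apply: fnorm_mono; [exact: Mplus_decr0|exact: (Mplus_decr0 rD)|].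
by move=> s _; rewrite /zero_ext lee_fin patchE; case: ifP.
Qed.

Lemma cone_fun_represents (sig : R -> R) : decr0 sig -> (Et (EFin \o sig) < +oo)%E ->
  cone_represents n k T Et phi sig (cone_fun sig).
Proof.
move=> sD sfin; have [s0 sN sd] := sD; split.
  split => //; first by move=> t1 t2 ? ? _; exact: sd.
  exact: le_lt_trans (zero_ext_le sD) sfin.
by move=> t /andP[t0 _]; rewrite cone_integral_cut// cone_funE.
Qed.

Lemma cone_fun_cone (sig : R -> R) : decr0 sig -> (Et (EFin \o sig) < +oo)%E ->
  cone n k T Et phi (cone_fun sig).
Proof.
move=> sD sfin; split; first by move=> t /andP[t0 _]; exact: cone_fun_ge0.
by exists sig; exact: cone_fun_represents.
Qed.

Lemma Etilde0_decr0 (s : R -> R) : Etilde0 T Et s -> decr0 (s \_ (itv0 T)).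
Proof. by move=> [s0 sd _]; exact: decr0_restrict. Qed.

Lemma cone_rho_ge0 h : 0 <= cone_rho n k T Et phi h.
Proof.
rewrite /cone_rho; set A := [set _ | _ in _].
have [->|/set0P A0] := eqVneq A set0; first by rewrite inf0.
apply: lb_le_inf => // _ [s [/Etilde0_decr0 sD _] <-].
by rewrite fine_ge0// fnorm_ge0//; exact: (Mplus_decr0 sD).
Qed.

Lemma cone_rho_le (sig : R -> R) (M : R) : decr0 sig -> (Et (EFin \o sig) <= M%:E)%E ->
  cone_rho n k T Et phi (cone_fun sig) <= M.
Proof.
move=> sD sM; have sfin := le_lt_trans sM (ltry M).
have zM : (Et (zero_ext T sig) <= M%:E)%E := le_trans (zero_ext_le sD) sM.
apply: (@le_trans _ _ (fine (Et (zero_ext T sig)))).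
  apply: ge_inf; last by exists sig => //; exact: cone_fun_represents.
  exists 0 => _ [s [/Etilde0_decr0 rD _] <-].
  by rewrite fine_ge0// fnorm_ge0//; exact: (Mplus_decr0 rD).
rewrite -lee_fin fineK// ge0_fin_numE; first exact: le_lt_trans zM (ltry _).
by apply: fnorm_ge0; exact: (Mplus_decr0 (Etilde0_decr0 (cone_fun_represents sD sfin).1)).
Qed.

Lemma cone_represents_fun (s h : R -> R) t : cone_represents n k T Et phi s h ->
  0 < t < T -> h t = cone_fun (s \_ (itv0 T)) t.
Proof.
move=> [sE hE] tT; have t0 : 0 < t by case/andP: tT.
have sD := Etilde0_decr0 sE; have [_ _ sfin] := sE.
apply: EFin_inj; rewrite (hE t tT) (cone_funE sD sfin t0) -(cone_integral_cut sD t0).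
by apply: eq_integral => u uT; rewrite patchE uT.
Qed.

Lemma cone_fun_homo (sig : R -> R) s t : decr0 sig -> (Et (EFin \o sig) < +oo)%E ->
  0 < s -> s <= t -> cone_fun sig s <= cone_fun sig t.
Proof.
move=> sD sfin s0 st; have t0 := lt_le_trans s0 st; have [sig0 _ _] := sD.
rewrite -lee_fin; have := cone_funE sD sfin s0; have := cone_funE sD sfin t0.
generalize (cone_fun sig s) (cone_fun sig t) => a b -> ->.
have [Ogs _ _] := Om_cut_decr0 n k T Phi0 Phid s0.
apply: int_le.
- by apply: measurable_funM; apply: decr0_measurable => //; exact: Om_cut_decr0.
- by apply: measurable_funM; apply: decr0_measurable => //; exact: Om_cut_decr0.
- by move=> u; exact: mulr_ge0.
by move=> u; rewrite ler_wpM2r// Om_cut_homo.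
Qed.

(** On (0, T) the weight Omega is at least (t/T)^(k/n) / 2 times the profile,
    so a function that attains half of the associate norm of the profile
    generates a member of the cone of size at least t^(k/n), up to a constant.
    This is what turns the power of t in the upper bound of the modulus into a
    member of the cone. *)
Lemma pow_le_cone_fun : exists sig : R -> R,
  [/\ decr0 sig, (Et (EFin \o sig) <= 1)%E &
    forall t, 0 < t < T -> t `^ kn <= 4 * T `^ kn / N * cone_fun sig t].
Proof.
have N0 := associate_norm_gt0 n0 T0 Phi0 Phid PhiI Nfin.
have [sig [sD s1 H]] := pairing_witness n0 T0 Phi0 Phid PhiI Nfin.
have sfin := le_lt_trans s1 (ltry 1).
exists sig; split => // t /andP[t0 tT].
have OD := Om_cut_decr0 n k T Phi0 Phid t0.
have [Og _ _] := OD; have [s0 _ _] := sD; have [p0 _ _] := pD.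
have TK : 0 < T `^ kn by exact: powR_gt0.
have tK : 0 < t `^ kn by exact: powR_gt0.
pose q := t `^ kn / (2 * T `^ kn).
have q0 : 0 <= q by rewrite divr_ge0 ?mulr_ge0// ltW.
have L : (q%:E * \int[leb]_s (phT s * sig s)%:E <=
    \int[leb]_s (Om_cut n k T Phi t s * sig s)%:E)%E.
  have [pT0 _ _] := pTD.
  have mp : measurable_fun setT (fun s => phT s * sig s).
    by apply: measurable_funM; exact: decr0_measurable.
  rewrite -int_scale//; last by move=> s; exact: mulr_ge0.
  apply: int_le.
  - by apply: measurable_funM; [exact: measurable_cst|exact: mp].
  - by apply: measurable_funM; exact: decr0_measurable.
  - by move=> s; apply: mulr_ge0 => //; exact: mulr_ge0.
  move=> s; rewrite mulrA; apply: ler_wpM2r => //.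
  rewrite /Om_cut /phT; case: ltP => sT; last by rewrite mulr0.
  have [s_le0|s_gt0] := leP s 0.
    by rewrite /Om -/ph; have [_ -> //] := pD; rewrite mulr0 mul0r.
  rewrite /Om -/ph mulrC; apply: ler_wpM2l => //.
  have st : s / t <= T / t by rewrite ler_pM2r ?invr_gt0// ltW.
  have pw : (s / t) `^ kn <= (T / t) `^ kn.
    by apply: ge0_ler_powR => //; rewrite ?nnegrE divr_ge0// ltW.
  have pE : (T / t) `^ kn = T `^ kn / t `^ kn.
    apply: (mulIf (lt0r_neq0 tK)); rewrite divfK ?gt_eqF// -powRM ?divfK ?gt_eqF ?(ltW t0)//.
    by rewrite divr_ge0// ltW.
  have den : 0 < 1 + (s / t) `^ kn by rewrite ltr_pwDl// powR_ge0.
  rewrite -[leRHS]mul1r ler_pdivlMr//.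
  apply: le_trans (_ : q * (1 + (T / t) `^ kn) <= _); first by rewrite ler_wpM2l// lerD2l.
  rewrite pE (_ : q * _ = (t `^ kn + T `^ kn) / (2 * T `^ kn)); last first.
    by rewrite /q; field; rewrite ?gt_eqF.
  rewrite ler_pdivrMr ?mulr_gt0// mul1r mulr_natl mulr2n lerD2r.
  by apply: ge0_ler_powR; rewrite ?nnegrE ?(ltW t0) ?(ltW tT) ?(ltW T0)// divr_ge0.
have Q : q * (N / 2) <= cone_fun sig t.
  rewrite -lee_fin cone_funE//; apply: le_trans L.
  by rewrite EFinM; apply: lee_wpmul2l.
apply: le_trans (_ : 4 * T `^ kn / N * (q * (N / 2)) <= _); last first.
  by rewrite ler_wpM2l// divr_ge0 ?mulr_ge0// ltW.
by rewrite le_eqVlt (_ : 4 * _ / _ * _ = t `^ kn) ?eqxx// /q; field; rewrite ?gt_eqF.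
Qed.

End ConeIntegrals.

(** * The space of potentials *)

Section PotentialSpace.
Context {R : realType}.
Variables (n : nat) (T : R) (E : ri_space_Rn R n) (Et : ri_space_Rplus R) (Phi : R -> R).
Hypotheses (n0 : (0 < n)%N) (T0 : 0 < T).
Hypothesis rep : representation_space E Et.
Hypothesis Phi0 : forall z, 0 < z -> 0 <= Phi z.
Hypothesis Phid : forall z w, 0 < z -> z <= w -> Phi w <= Phi z.
Hypothesis PhiI : (0 < \int[leb]_(z in Rplus) (Phi z * z ^+ n.-1)%:E < +oo)%E.
Hypothesis Nfin : (associate_norm Et (zero_ext T (profile Phi n)) < +oo)%E.

Let ph := phi0 Phi n.
Let lam := @lebesgue_rV R n.
Let C := tail_const Phi n T.
Let N := fine (associate_norm Et (zero_ext T (profile Phi n))).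
Let G := @radial_kernel R n Phi.
Let pD : decr0 ph. Proof. exact: phi0_decr0. Qed.
Let C0 : 0 < C. Proof. by have [] := tail_constP n0 T0 Phi0 Phid PhiI. Qed.
Let N0 : 0 < N. Proof. exact: (associate_norm_gt0 n0 T0 Phi0 Phid PhiI Nfin). Qed.
Let cC := embedding_norm (potentials E G) (potential_norm E G) (@norm_C R n).

Lemma rearr_pairing_le (F : 'rV[R]_n -> R) (M : R) :
  measurable_fun setT F -> (forall x, 0 <= F x) -> 0 < M ->
  (E (EFin \o F) <= M%:E)%E ->
  (\int[leb]_s (ph s * rearr_fun F s)%:E <= (C * (2 * M * N))%:E)%E.
Proof.
move=> mF F0 M0 EM; have EF := le_lt_trans EM (ltry M).
apply: (pairing_tail_le n0 T0 Phi0 Phid PhiI Nfin) => //.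
  exact: (rearr_fun_decr0 rep).
by rewrite (fnorm_rearr_fun rep).
Qed.

Section Density.
Variable f : 'rV[R]_n -> R[i].
Hypothesis Ef : ri_mem E f.
Let F x := cmod (f x).
Let fr x := complex.Re (f x).
Let fi x := complex.Im (f x).
Let mr : measurable_fun setT fr. Proof. by have [] := Ef. Qed.
Let mi : measurable_fun setT fi. Proof. by have [] := Ef. Qed.
Let frF x : `|fr x| <= F x. Proof. exact: Re_le_cmod. Qed.
Let fiF x : `|fi x| <= F x. Proof. exact: Im_le_cmod. Qed.

Lemma density_measurable : measurable_fun setT F.
Proof. exact: measurable_cmod. Qed.

Lemma density_fin : (E (EFin \o F) < +oo)%E.
Proof. by have [] := Ef. Qed.

Lemma density_pairing : (\int[leb]_s (ph s * rearr_fun F s)%:E < +oo)%E.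
Proof.
have M0 : 0 < ri_normc E f + 1 by rewrite ltr_wpDl// ri_normc_ge0.
have := rearr_pairing_le density_measurable (fun x => cmod_ge0 (f x)) M0.
rewrite [X in (X <= _)%E -> _](ri_normcE Ef) lee_fin lerDl => /(_ ler01) H.
exact: le_lt_trans H (ltry _).
Qed.

Let F0 x : 0 <= F x. Proof. exact: cmod_ge0. Qed.

Lemma convolutionE : convolution G f = fun x => Complex (pot ph fr x) (pot ph fi x).
Proof. exact: convolution_radial_kernel. Qed.

(** Both the real and the imaginary part are bounded by the pairing of the
    profile with the rearrangement of the modulus. *)
Lemma convolution_bound x : cmod (convolution G f x) <= 4 * C * N * ri_normc E f.
Proof.
have K0 : 0 < 4 * C * N by rewrite !mulr_gt0.
apply/ler_addgt0Pr => e e0.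
pose M := ri_normc E f + e / (4 * C * N).
have M0 : 0 < M by rewrite ltr_wpDl ?ri_normc_ge0// divr_gt0.
have ME : 4 * C * N * M = 4 * C * N * ri_normc E f + e.
  by rewrite mulrDr; congr (_ + _); rewrite mulrC divfK// gt_eqF.
have EM : (E (EFin \o F) <= M%:E)%E.
  by rewrite [leLHS](ri_normcE Ef) lee_fin lerDl divr_ge0// ltW.
have P := rearr_pairing_le density_measurable F0 M0 EM.
have Pr := le_trans (pot_le rep n0 density_measurable F0 density_fin mr frF pD density_pairing x) P.
have Pi := le_trans (pot_le rep n0 density_measurable F0 density_fin mi fiF pD density_pairing x) P.
rewrite convolutionE -ME; apply: le_trans (cmod_le _) _ => /=.
have -> : 4 * C * N * M = C * (2 * M * N) + C * (2 * M * N) by ring.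
by rewrite !lee_fin in Pr Pi; exact: lerD.
Qed.

Hypothesis Philip : forall r1 r2 : R, 0 < r1 -> exists2 L, 0 <= L &
  forall u v, r1 <= u -> u <= v -> v <= r2 -> Phi u - Phi v <= L * (v - u).

Lemma convolution_space_C : space_C (convolution G f).
Proof.
split; first by exists (4 * C * N * ri_normc E f); exact: convolution_bound.
move=> e e0; have e20 : 0 < e / 2 by rewrite divr_gt0.
have uc := pot_unif_cont rep n0 Phi0 Phid PhiI Philip density_measurable F0 density_fin
  density_pairing.
have [r1 r10 H1] := uc _ _ mr frF e20; have [r2 r20 H2] := uc _ _ mi fiF e20.
exists (Num.min r1 r2); first by rewrite lt_min r10.
move=> x y; rewrite lt_min => /andP[xy1 xy2].
rewrite convolutionE; apply: le_lt_trans (cmod_le _) _ => /=.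
by rewrite [ltRHS](splitr e); apply: ltrD; [exact: H1|exact: H2].
Qed.

End Density.

Lemma norm_C_convolution f : ri_mem E f ->
  norm_C (convolution G f) <= 4 * C * N * ri_normc E f.
Proof. by move=> Ef; apply: norm_C_le => x; exact: convolution_bound. Qed.

Let K0 : 0 <= 4 * C * N.
Proof. by rewrite !mulr_ge0// ltW. Qed.

Lemma norm_C_embedding u : potentials E G u -> norm_C u <= 4 * C * N * potential_norm E G u.
Proof. by apply: potential_normP => // f; exact: norm_C_convolution. Qed.

Lemma embedding_C_le : cC <= 4 * C * N.
Proof. by apply: embedding_norm_le => //; exact: norm_C_embedding. Qed.

Lemma embedding_C_ge0 : 0 <= cC.
Proof. exact: embedding_norm_ge0. Qed.

Lemma norm_C_le_embedding f : ri_mem E f -> norm_C (convolution G f) <= cC * ri_normc E f.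
Proof.
move=> Ef; apply: (@le_trans _ _ (cC * potential_norm E G (convolution G f))).
  apply: (embedding_norm_attained _ K0 norm_C_embedding) => //; last by exists f.
  by move=> u _; exact: potential_norm_ge0.
by apply: ler_wpM2l; [exact: embedding_C_ge0|exact: potential_norm_le].
Qed.

(** For a nonnegative density the convolution integral is the value of a
    potential, hence bounded through the embedding into C. This makes the
    constants depend on the norm of that embedding only. *)
Lemma nonneg_conv_le (F : 'rV[R]_n -> R) : measurable_fun setT F -> (forall x, 0 <= F x) ->
  (E (EFin \o F) < +oo)%E ->
  forall b, (\int[lam]_w (ph (nu w) * F (-1 *: w + b))%:E <= (cC * fine (E (EFin \o F)))%:E)%E.
Proof.
move=> mF F0 EF b; have Ef := ri_mem_real mF F0 EF.
have := norm_C_le_embedding Ef; rewrite (ri_normc_real _ F0) => H.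
have := le_trans (le_norm_C b (convolution_bound Ef)) H.
rewrite (convolutionE Ef) => {}H.
have {}H := le_trans (le_trans (ler_norm _) (Re_le_cmod _)) H.
have [p0 _ _] := pD; have mg := measurable_comp_sub b (@measurable_radial R n ph pD).
have psI : (\int[leb]_s (ph s * rearr_fun F s)%:E < +oo)%E.
  have := density_pairing Ef; rewrite (_ : (fun x => cmod _) = F)//.
  by apply/funext => x; rewrite cmod_real ger0_norm.
have fF x : `|F x| <= F x by rewrite ger0_norm.
have I := pot_integrable rep n0 mF F0 EF mF fF pD psI b.
have m1 : measurable_fun setT (fun y : 'rV[R]_n => (ph (nu
  (b - y)) * F y)%:E) by case/integrableP: I.
rewrite (_ : (\int[lam]_w _)%E = (\int[lam]_y (ph (nu (b - y)) * F y)%:E)%E); last first.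
  rewrite -[RHS](rV_reflect b m1); last by move=> x; rewrite lee_fin mulr_ge0.
  by apply: eq_integral => w _; rewrite subKr scaleN1r addrC.
have <- : (pot ph F b)%:E = (\int[lam]_y (ph (nu (b - y)) * F y)%:E)%E.
  by rewrite /pot /Rintegral fineK//; exact: integrable_fin_num.
by rewrite lee_fin.
Qed.

Section Differences.
Variables (k : nat) (a1 a2 : R).
Hypotheses (k0 : (0 < k)%N) (a10 : 0 < a1) (a20 : 0 < a2).
Hypothesis sm : forall j, (j < k)%N -> forall z : R, 0 < z ->
  derivable (derive1n j Phi) z 1.
Hypothesis HM : forall z j, 0 < z -> (0 < j <= k)%N ->
  z ^+ (2 * j) * `|Phi_iter Phi j z| <= (a1 + a2 * z ^+ k) * Phi z.

Definition modulus_const : R := 2 * (upper_const n k T a1 a2 * (k.+1%:R + 2 ^+ n)).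

Lemma modulus_const_ge0 : 0 <= modulus_const.
Proof.
rewrite /modulus_const; apply: mulr_ge0 => //; apply: mulr_ge0.
  by apply: upper_const_ge0 => //; exact: ltW.
by rewrite addr_ge0 ?exprn_ge0.
Qed.

Definition modulus_bound (f : 'rV[R]_n -> R[i]) (t : R) : R :=
  modulus_const * (cone_fun n k T Phi (rearr_fun (fun x => cmod (f x))) t +
                   t `^ (k%:R / n%:R) * (cC * ri_normc E f)).

(** The bounds B1 and B2 on the part of order t^(k/n) come from the embedding
    into C, applied to the modulus of the density and to its dilation by 2. *)
Lemma difference_le f t h x : ri_mem E f -> 0 < t -> enorm h <= t `^ n%:R^-1 ->
  cmod (finite_difference k h (convolution G f) x) <= modulus_bound f t.
Proof.
move=> Ef t0 ht; have [mr mi _] := Ef.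
pose F x := cmod (f x).
have mF := density_measurable Ef; have EF := density_fin Ef; have psI := density_pairing Ef.
have F0 x' : 0 <= F x' by exact: cmod_ge0.
have sD : decr0 (rearr_fun F) by exact: (rearr_fun_decr0 rep).
have sfin : (Et (EFin \o rearr_fun F) < +oo)%E by rewrite (fnorm_rearr_fun rep).
pose B := cC * ri_normc E f.
have cC0 := embedding_C_ge0.
have B1 b : (\int[lam]_w (ph (nu w) * F (-1 *: w + b))%:E <= B%:E)%E.
  exact: nonneg_conv_le.
have B2 b : (\int[lam]_w (ph (nu w) * F (-2 *: w + b))%:E <= B%:E)%E.
  pose F2 y := F (2 *: y).
  have mF2 : measurable_fun setT F2.
    have := measurableT_comp mF (measurable_affine 2 (0%R : 'rV[R]_n)).
    by apply: eq_measurable_fun => y _; rewrite /= addr0.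
  have le2 : (E (EFin \o F2) <= E (EFin \o F))%E.
    by apply: (fnorm_dilation rep) => //; rewrite ger0_norm// ler1n.
  have F20 y : 0 <= F2 y by exact: F0.
  have EF2 := le_lt_trans le2 EF.
  have := nonneg_conv_le mF2 F20 EF2 (2^-1 *: b).
  rewrite (_ : (\int[lam]_w _)%E = (\int[lam]_w (ph (nu w) * F (-2 *: w + b))%:E)%E); last first.
    apply: eq_integral => w _; rewrite /F2 scalerDr !scalerA mulfV// scale1r.
    by rewrite mulrN1.
  move=> H; apply: le_trans H _; rewrite lee_fin; apply: ler_wpM2l => //.
  have f2 : E (EFin \o F2) \is a fin_num.
    exact: (fnorm_fin (Mplus_EFin mF2 F20) EF2).
  have f1 : E (EFin \o F) \is a fin_num.
    exact: (fnorm_fin (Mplus_EFin mF F0) EF).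
  exact: fine_le.
have bound (g : 'rV[R]_n -> R) : measurable_fun setT g -> (forall y, `|g y| <= F y) ->
    `|\sum_(j < k.+1) dcoef k j * pot ph g (x + j%:R *: h)| <= modulus_bound f t / 2.
  move=> mg gF.
  have := pot_difference_upper n0 k0 T0 (ltW a10)
    (ltW a20) Phi0 Phid sm HM rep mF F0 EF psI x mg gF t0 ht B1 B2.
  rewrite -(cone_funE k Phi0 Phid Nfin sD sfin t0) -EFinD -EFinM lee_fin.
  rewrite /modulus_bound root_pow// /modulus_const => H; apply: le_trans H _.
  have half (a z : R) : 2 * a * z / 2 = a * z by field.
  by rewrite -/F -/B half.
rewrite (convolutionE Ef) finite_differenceE; apply: le_trans (cmod_le _) _ => /=.
rewrite [leRHS](splitr (modulus_bound f t)); apply: lerD; apply: bound => //.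
- by move=> y; exact: Re_le_cmod.
- by move=> y; exact: Im_le_cmod.
Qed.

End Differences.

End PotentialSpace.

(** * Equivalence of the two embeddings *)

Section Equivalence.
Context {R : realType}.
Variables (n k : nat) (T : R) (E : ri_space_Rn R n) (Et : ri_space_Rplus R) (Phi : R -> R).
Variables (X : gbfs T) (a1 a2 : R).
Hypotheses (n0 : (0 < n)%N) (k0 : (0 < k)%N) (T0 : 0 < T).
Hypothesis rep : representation_space E Et.
Hypothesis Phi0 : forall z, 0 < z -> 0 <= Phi z.
Hypothesis Phid : forall z w, 0 < z -> z <= w -> Phi w <= Phi z.
Hypothesis PhiI : (0 < \int[leb]_(z in Rplus) (Phi z * z ^+ n.-1)%:E < +oo)%E.
Hypothesis Nfin : (associate_norm Et (zero_ext T (profile Phi n)) < +oo)%E.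
Hypotheses (a10 : 0 < a1) (a20 : 0 < a2).
Hypothesis sm : forall j, (j < k)%N -> forall z : R, 0 < z ->
  derivable (derive1n j Phi) z 1.
Hypothesis HM : forall z j, 0 < z -> (0 < j <= k)%N ->
  z ^+ (2 * j) * `|Phi_iter Phi j z| <= (a1 + a2 * z ^+ k) * Phi z.
Hypothesis Philip : forall r1 r2 : R, 0 < r1 -> exists2 L, 0 <= L &
  forall u v, r1 <= u -> u <= v -> v <= r2 -> Phi u - Phi v <= L * (v - u).

Let ph := phi0 Phi n.
Let phi := profile Phi n.
Let kn : R := k%:R / n%:R.
Let C := tail_const Phi n T.
Let N := fine (associate_norm Et (zero_ext T (profile Phi n))).
Let G := @radial_kernel R n Phi.
Let H := potentials E G.
Let nH := potential_norm E G.
Let K := cone n k T Et phi.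
Let rhoK := cone_rho n k T Et phi.
Let cC := embedding_norm H nH (@norm_C R n).
Let cK := embedding_norm K rhoK (gbfs_norm X).
Let A := modulus_const n T k a1 a2.
Let C0 : 0 < C. Proof. by have [] := tail_constP n0 T0 Phi0 Phid PhiI. Qed.
Let N0 : 0 < N. Proof. exact: (associate_norm_gt0 n0 T0 Phi0 Phid PhiI Nfin). Qed.
Let cC0 : 0 <= cC. Proof. exact: embedding_C_ge0. Qed.
Let cK0 : 0 <= cK. Proof. exact: embedding_norm_ge0. Qed.
Let A0 : 0 <= A. Proof. exact: modulus_const_ge0. Qed.
Let TK : 0 < T `^ kn. Proof. exact: powR_gt0. Qed.

Let diff_le f t h x : ri_mem E f -> 0 < t -> enorm h <= t `^ n%:R^-1 ->
  cmod (finite_difference k h (convolution G f) x) <=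
  modulus_bound T E Phi k a1 a2 f t.
Proof. exact: (difference_le n0 T0 rep Phi0 Phid PhiI Nfin k0 a10 a20 sm HM). Qed.

Lemma modulus_measurable f : ri_mem E f ->
  measurable_fun (itv0 T) (modulus_root k (convolution G f)).
Proof.
move=> Ef; apply: nondecreasing_itv0_measurable.
  move=> t t0; exact: (modulus_root_ge0 (fun t h x => @diff_le f t h x Ef) t0).
move=> s t s0 st; exact: (modulus_root_homo (fun t h x => @diff_le f t h x Ef) s0 st).
Qed.

Lemma le_embedding_cone h : cone_embedded n k Et phi X -> K h ->
  gbfs_norm X h <= cK * rhoK h.
Proof.
move=> [_ [c c0 Hc]] Kh; apply: (embedding_norm_attained _ (ltW c0) Hc) => // u _.
exact: cone_rho_ge0.
Qed.

(** The bound of the modulus is a combination of two members of the cone: one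
    is generated by the rearrangement of the density, the other dominates the
    power of t. Monotonicity of X then transfers the bound of the cone. *)
Lemma modulus_le_cone f : cone_embedded n k Et phi X -> ri_mem E f ->
  gbfs_mem X (modulus_root k (convolution G f)) /\
  gbfs_norm X (modulus_root k (convolution G f)) <=
  A * cK * (1 + 4 * T `^ kn * (cC / N)) * ri_normc E f.
Proof.
move=> emb Ef; have [KX _] := emb.
pose F x := cmod (f x); pose sig := rearr_fun F.
have F0 x : 0 <= F x by exact: cmod_ge0.
have mF := density_measurable Ef; have EF := density_fin Ef.
have sD : decr0 sig by exact: (rearr_fun_decr0 rep).
have sE : Et (EFin \o sig) = (ri_normc E f)%:E.
  by rewrite (fnorm_rearr_fun rep)//; exact: ri_normcE.
have sle : (Et (EFin \o sig) <= (ri_normc E f)%:E)%E by rewrite sE.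
have sfin : (Et (EFin \o sig) < +oo)%E by rewrite sE ltry.
have [sig0 [sD0 s01 pow]] := pow_le_cone_fun k n0 T0 Phi0 Phid PhiI Nfin.
have sfin0 := le_lt_trans s01 (ltry 1).
set M := ri_normc E f in sE sle *; have M0 : 0 <= M by exact: ri_normc_ge0.
pose h1 := cone_fun n k T Phi sig; pose h0 := cone_fun n k T Phi sig0.
have K1 : K h1 by exact: (cone_fun_cone k Phi0 Phid Nfin sD sfin).
have K2 : K h0 by exact: (cone_fun_cone k Phi0 Phid Nfin sD0 sfin0).
have n1 : gbfs_norm X h1 <= cK * M.
  apply: le_trans (le_embedding_cone emb K1) _; apply: ler_wpM2l => //.
  exact: (cone_rho_le k Phi0 Phid Nfin sD sle).
have n2 : gbfs_norm X h0 <= cK.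
  apply: le_trans (le_embedding_cone emb K2) _; rewrite -[leRHS]mulr1; apply: ler_wpM2l => //.
  exact: (cone_rho_le k Phi0 Phid Nfin sD0 s01).
pose b := A * (4 * T `^ kn * (cC / N)) * M.
have b0 : 0 <= b.
  by rewrite /b; apply: mulr_ge0 => //; apply: mulr_ge0 => //;
    rewrite mulr_ge0 ?divr_ge0 ?mulr_ge0// ltW.
pose g := (fun t => A * h1 t) \+ (fun t => b * h0 t).
have X1 := gbfs_memZ A (KX _ K1); have X2 := gbfs_memZ b (KX _ K2).
have Xg : gbfs_mem X g by exact: gbfs_memD.
have ng : gbfs_norm X g <= A * cK * (1 + 4 * T `^ kn * (cC / N)) * M.
  apply: le_trans (gbfs_normD X1 X2) _.
  rewrite (gbfs_normZ _ (KX _ K1)) (gbfs_normZ _ (KX _ K2)) !ger0_norm//.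
  apply: le_trans (lerD (ler_wpM2l A0 n1) (ler_wpM2l b0 n2)) _.
  by rewrite le_eqVlt (_ : A * _ + _ = A * cK * (1 + 4 * T `^ kn * (cC / N)) * M) ?eqxx// /b; ring.
have [] := gbfs_P2 (modulus_measurable Ef) Xg.
  apply: aeW => t t0T; have t0 : 0 < t by case/andP: t0T.
  have Hd t' h x := @diff_le f t' h x Ef.
  rewrite ger0_norm; last exact: (modulus_root_ge0 Hd t0).
  apply: le_trans (modulus_root_le Hd t0) _.
  rewrite /modulus_bound -/A -/F -/sig -/h1 -/M /g/= mulrDr lerD2l /b.
  have := pow t t0T; rewrite -/h0 -/N => pt.
  have cM : 0 <= A * (cC * M) by apply: mulr_ge0 => //; exact: mulr_ge0.
  have := ler_wpM2l cM pt.
  have -> : A * (cC * M) * t `^ kn = A * (t `^ kn * (cC * M)) by ring.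
  by have -> : A * (cC * M) * (4 * T `^ kn / N * h0 t) =
    A * (4 * T `^ kn * (cC / N)) * M * h0 t by ring.
by move=> Xm nm; split => //; exact: le_trans nm ng.
Qed.

Definition embedding_const : R := cC + A * cK * (1 + 4 * T `^ kn * (cC / N)).

Lemma embedding_const_ge0 : 0 <= embedding_const.
Proof.
rewrite /embedding_const; apply: addr_ge0 => //; apply: mulr_ge0; first exact: mulr_ge0.
by apply: addr_ge0 => //; rewrite mulr_ge0 ?divr_ge0 ?mulr_ge0// ltW.
Qed.

(** The norm of the embedding into C is at most a multiple of the associate
    norm of the profile, which removes that norm from the constant and leaves
    one depending on Phi, n and T. *)
Lemma embedding_const_le :
  embedding_const <= cC + A * cK * (1 + 16 * T `^ kn * C).
Proof.
rewrite /embedding_const lerD2l; apply: ler_wpM2l; first exact: mulr_ge0.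
rewrite lerD2l (_ : 16 * T `^ kn * C = 4 * T `^ kn * (4 * C)); last by ring.
apply: ler_wpM2l; first by rewrite mulr_ge0// ltW.
by rewrite ler_pdivrMr//; exact: (embedding_C_le n0 T0 rep Phi0 Phid PhiI Nfin).
Qed.

Lemma calderon_convolution f : cone_embedded n k Et phi X -> ri_mem E f ->
  calderon k X (convolution G f) /\
  calderon_norm k X (convolution G f) <= embedding_const * ri_normc E f.
Proof.
move=> emb Ef; have [Xm nm] := modulus_le_cone emb Ef; split.
  by split => //; exact: (convolution_space_C n0 T0 rep Phi0 Phid PhiI Nfin Ef Philip).
rewrite /embedding_const mulrDl; apply: lerD => //.
exact: (norm_C_le_embedding n0 T0 rep Phi0 Phid PhiI Nfin Ef).
Qed.

Lemma calderon_norm_le_const u : cone_embedded n k Et phi X -> H u ->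
  calderon_norm k X u <= embedding_const * nH u.
Proof.
move=> emb; apply: potential_normP; first exact: embedding_const_ge0.
by move=> f Ef; have [] := calderon_convolution emb Ef.
Qed.

Lemma convolutionB f g : ri_mem E f -> ri_mem E g ->
  convolution G (f - g) = convolution G f - convolution G g.
Proof.
move=> Ef Eg; have Efg := ri_memB Ef Eg.
have pD : decr0 ph by exact: phi0_decr0.
have [mfr mfi _] := Ef; have [mgr mgi _] := Eg.
have PI := fun q (Eq : ri_mem E q) (r : 'rV[R]_n -> R) (mr : measurable_fun setT r) rq x =>
  pot_integrable rep n0 (density_measurable Eq) (fun y => cmod_ge0 (q y)) (density_fin Eq)
    (f := r) mr rq pD (density_pairing n0 T0 rep Phi0 Phid PhiI Nfin Eq) x.
rewrite (convolutionE n0 Phi0 Phid Ef) (convolutionE n0 Phi0 Phid Eg)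
  (convolutionE n0 Phi0 Phid Efg).
apply/funext => x.
have potB (a b c : 'rV[R]_n -> R) : (forall y, c y = a y - b y) ->
   (lebesgue_rV n).-integrable setT (EFin \o (fun y => ph (nu (x - y)) * a y)) ->
   (lebesgue_rV n).-integrable setT (EFin \o (fun y => ph (nu (x - y)) * b y)) ->
   pot ph c x = pot ph a x - pot ph b x.
  move=> cE Ia Ib; rewrite /pot -RintegralB//; apply: eq_Rintegral => y _.
  by rewrite cE mulrBr.
have hr : pot ph (fun y => complex.Re ((f - g) y)) x =
    pot ph (fun y => complex.Re (f y)) x - pot ph (fun y => complex.Re (g y)) x.
  apply: potB; [|apply: (PI f) => // y; exact: Re_le_cmod|apply: (PI g) => // y; exact: Re_le_cmod].
  by move=> y; rewrite !fctE; case: (f y); case: (g y).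
have hi : pot ph (fun y => complex.Im ((f - g) y)) x =
    pot ph (fun y => complex.Im (f y)) x - pot ph (fun y => complex.Im (g y)) x.
  apply: potB; [|apply: (PI f) => // y; exact: Im_le_cmod|apply: (PI g) => // y; exact: Im_le_cmod].
  by move=> y; rewrite !fctE; case: (f y); case: (g y).
exact: (congr2 (@Complex R) hr hi).
Qed.

Lemma potentialsB u v : H u -> H v -> H (u - v).
Proof.
move=> [f Ef <-] [g Eg <-]; exists (f - g); first exact: ri_memB.
exact: convolutionB.
Qed.

Lemma continuously_embedded_of_cone : cone_embedded n k Et phi X ->
  continuously_embedded H (calderon k X) nH (calderon_norm k X).
Proof.
move=> emb; split; first by move=> _ [f Ef <-]; have [] := calderon_convolution emb Ef.
move=> u Hu e e0; have c0 := embedding_const_ge0.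
have c1 : 0 < embedding_const + 1 by rewrite ltr_wpDl.
exists (e / (embedding_const + 1)); first by rewrite divr_gt0.
move=> v Hv; rewrite ltr_pdivlMr// mulrC => vu.
apply: le_lt_trans (calderon_norm_le_const emb (potentialsB Hv Hu)) _.
apply: le_lt_trans vu; apply: ler_wpM2r; first exact: potential_norm_ge0.
by rewrite lerDl.
Qed.

Lemma potentials0 : H 0.
Proof.
have E0 : ri_mem E (fun=> Complex 0 0).
  apply: ri_mem_real => //.
  rewrite (_ : E _ = 0%E) ?ltry//; apply/fnorm_eq0; last by apply: aeW.
  by apply: Mplus_EFin.
exists 0; last by rewrite -[X in convolution G X](subrr (fun=> Complex 0 0)) convolutionB// subrr.
by rewrite -[X in ri_mem E X](subrr (fun=> Complex 0 0)); exact: ri_memB.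
Qed.

Section Necessity.
Variables (z1 d1 : R).
Hypotheses (z10 : 0 < z1) (d10 : 0 < d1).
Hypothesis HMn : forall z j, 0 < z <= z1 -> (0 < j <= k)%N ->
  z ^+ (2 * j) * `|Phi_iter Phi j z| <= a1 * Phi z.
Hypothesis Hd : forall z, 0 < z <= z1 ->
  d1 * Phi z <= (-1) ^+ k * z ^+ k * derive1n k Phi z.

Lemma modulus_lower : exists2 c4 : R, 0 < c4 &
  forall sig, decr0 sig -> (forall s, T <= s -> sig s = 0) ->
  (Et (EFin \o sig) < +oo)%E ->
  exists u, [/\ H u, ((nH u)%:E <= Et (EFin \o sig))%E, 0 <= norm_C u &
    forall t, 0 < t < T -> c4 * cone_fun n k T Phi sig t <= modulus_root k u t].
Proof.
have [c4 c40 [S [mS low]]] := difference_lower n0 k0 T0 a10 z10 d10 Phi0 Phid sm HMn Hd rep.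
exists c4 => // sig sD sT sfin; have [sg0 _ _] := sD.
pose c : R := (1 + k%:R) ^+ n.
have c1 : 1 <= c by rewrite exprn_ege1// lerDl.
pose f := transplant sig c S.
have f0 x : 0 <= f x by exact: transplant_ge0.
have mf : measurable_fun setT f by exact: measurable_transplant.
have Ef : (E (EFin \o f) <= Et (EFin \o sig))%E by exact: (fnorm_transplant rep n0 sD mS c1).
have Efin := le_lt_trans Ef sfin.
have Df := ri_mem_real mf f0 Efin.
exists (convolution G (fun x => Complex (f x) 0)); split.
- by exists (fun x => Complex (f x) 0).
- apply: le_trans Ef; have nf : E (EFin \o f) \is a fin_num.
    exact: (fnorm_fin (Mplus_EFin mf f0) Efin).
  by rewrite -(fineK nf) lee_fin -ri_normc_real//; exact: potential_norm_le.
- exact: (norm_C_ge0 (convolution_bound n0 T0 rep Phi0 Phid PhiI Nfin Df)).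
move=> t tT; have t0 : 0 < t by case/andP: tT.
have fE : (fun x => cmod (Complex (f x) 0)) = f.
  by apply/funext => x; rewrite cmod_real ger0_norm.
have psI : (\int[leb]_s (ph s * rearr_fun f s)%:E < +oo)%E.
  by have := density_pairing n0 T0 rep Phi0 Phid PhiI Nfin Df; rewrite fE.
have [h hr L] := low sig sD sT Efin psI t tT.
have Hd' t' h' x := @diff_le _ t' h' x Df.
apply: le_trans (cmod_le_modulus_root Hd' 0 t0 hr).
rewrite (convolutionE n0 Phi0 Phid Df) finite_differenceE.
apply: le_trans (Re_le_cmod _) => /=.
rewrite -lee_fin EFinM (cone_funE k Phi0 Phid Nfin sD sfin t0).
apply: le_trans L; rewrite lee_wpmul2l ?lee_fin ?(ltW c40)//.
rewrite le_eqVlt; apply/orP; left; apply/eqP; apply: eq_integral => s _.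
by rewrite /Om_cut; case: ltP => // Ts; rewrite sT// !mulr0.
Qed.

(** Continuity at 0 bounds the modulus of the potentials of small densities. A
    function representing a member of the cone is scaled into that range and
    transplanted to R^n; its potential has a modulus that dominates the scaled
    member. *)
Lemma cone_of_continuously_embedded :
  continuously_embedded H (calderon k X) nH (calderon_norm k X) ->
  cone_embedded n k Et phi X.
Proof.
move=> [HZ cont]; have [r r0 Hr] := cont 0 potentials0 1 ltr01.
have [c4 c40 low] := modulus_lower.
have key s h M : cone_represents n k T Et phi s h -> 0 < M ->
    (Et (zero_ext T s) < M%:E)%E -> (forall t, 0 < t < T -> 0 <= h t) ->
    gbfs_mem X h /\ gbfs_norm X h <= (r * c4)^-1 * M.
  move=> rh M0 sM h0; have [sE _] := rh; have sD := Etilde0_decr0 sE.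
  have [_ _ sfin] := sE.
  pose sig t := r / M * (s \_ (itv0 T)) t.
  have rM0 : 0 < r / M by rewrite divr_gt0.
  have sigD : decr0 sig by apply: decr0Z sD; exact: ltW.
  have sigT t : T <= t -> sig t = 0.
    by move=> Tt; rewrite /sig restrict_cut ltNge Tt/= mulr0.
  have sigE : Et (EFin \o sig) = ((r / M)%:E * Et (zero_ext T s))%E.
    by rewrite -fnormZ ?(ltW rM0)//; exact: (Mplus_decr0 sD).
  have sn := fnorm_fin (Mplus_decr0 sD) sfin.
  have sigr : (Et (EFin \o sig) < r%:E)%E.
    move: sM; rewrite sigE -(fineK sn) -EFinM !lte_fin => sM.
    by rewrite mulrAC -mulrA -[ltRHS]mulr1 ltr_pM2l// ltr_pdivrMr// mul1r.
  have [u [Hu nu_ u0 lowu]] := low sig sigD sigT (lt_trans sigr (ltry r)).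
  have [_ Xu] := HZ _ Hu.
  have := Hr u Hu; rewrite !subr0 -lte_fin => /(_ (le_lt_trans nu_ sigr)).
  rewrite /calderon_norm => nu1.
  have {}nu1 : gbfs_norm X (modulus_root k u) <= 1.
    by apply: ltW; apply: le_lt_trans nu1; rewrite lerDr.
  have hE t : 0 < t < T -> cone_fun n k T Phi sig t = r / M * h t.
    move=> tT; have t0 : 0 < t by case/andP: tT.
    rewrite (cone_represents_fun Phi0 Phid Nfin rh tT); apply: EFin_inj.
    rewrite EFinM (cone_funE k Phi0 Phid Nfin sD sfin t0).
    rewrite (cone_funE k Phi0 Phid Nfin sigD (lt_trans sigr (ltry r)) t0).
    have [Og _ _] := Om_cut_decr0 n k T Phi0 Phid t0; have [s0 _ _] := sD.
    rewrite -int_scale ?(ltW rM0)//.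
    - by apply: eq_integral => v _; rewrite /sig mulrCA.
    - by apply: measurable_funM; apply: decr0_measurable => //; exact: Om_cut_decr0.
    - by move=> v; exact: mulr_ge0.
  have mh : measurable_fun (itv0 T) h.
    apply: (eq_measurable_fun (cone_fun n k T Phi (s \_ (itv0 T)))).
      move=> t; rewrite inE /itv0/= in_itv/= => tT.
      by rewrite (cone_represents_fun Phi0 Phid Nfin rh tT).
    apply: nondecreasing_itv0_measurable.
      by move=> t t0; exact: cone_fun_ge0.
    by move=> t v t0 tv; exact: (cone_fun_homo k Phi0 Phid Nfin sD sfin).
  have [] := gbfs_P2 mh (gbfs_memZ ((r * c4)^-1 * M) Xu).
    apply: aeW => t tT; rewrite ger0_norm ?h0//.
    have := lowu t tT; rewrite hE// => L.
    have -> : h t = (r * c4)^-1 * M * (c4 * (r / M * h t)).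
      by field; rewrite ?gt_eqF.
    by apply: ler_wpM2l => //; rewrite mulr_ge0 ?invr_ge0 ?mulr_ge0// ltW.
  move=> Xh nh; split => //; apply: le_trans nh _; rewrite gbfs_normZ//.
  have p0 : 0 <= (r * c4)^-1 * M by rewrite mulr_ge0 ?invr_ge0 ?mulr_ge0// ltW.
  by rewrite ger0_norm// -[leRHS]mulr1 ler_wpM2l.
have rc0 : 0 < r * c4 by exact: mulr_gt0.
(* the bound for a given s is reached through M slightly above its norm *)
have finE s h e : cone_represents n k T Et phi s h -> 0 < e ->
    0 < fine (Et (zero_ext T s)) + e /\ (Et (zero_ext T s) < (fine (Et (zero_ext T s)) + e)%:E)%E.
  move=> [sE _] e0; have sD := Etilde0_decr0 sE; have [_ _ sfin] := sE.
  have sn := fnorm_fin (Mplus_decr0 sD) sfin; split.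
    by rewrite ltr_wpDl// fine_ge0// fnorm_ge0//; exact: (Mplus_decr0 sD).
  by rewrite -[X in (X < _)%E](fineK sn) lte_fin ltrDl.
split.
  move=> h [h0 [s rh]]; have [M0 sM] := finE s h 1 rh ltr01.
  by have [] := key s h _ rh M0 sM h0.
exists (r * c4)^-1; first by rewrite invr_gt0.
move=> h [h0 hs]; have [s0 rh0] := hs; apply: le_mul_inf.
- by exists (fine (Et (zero_ext T s0))), s0.
- by rewrite invr_ge0 ltW.
move=> _ [s rh <-]; apply/ler_addgt0Pr => e e0.
have e1 : 0 < e * (r * c4) by exact: mulr_gt0.
have [M0 sM] := finE s h _ rh e1.
have [_ H1] := key s h _ rh M0 sM h0; apply: le_trans H1 _.
by rewrite mulrDr [X in _ + X]mulrC mulfK// gt_eqF.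
Qed.

End Necessity.

End Equivalence.

Theorem theorem3p5 (R : realType) :
  exists (F : forall (k n : nat) (T a1 a2 z1 d1 : R) (cC cK : R) (Nphi : R), R)
         (F_Phi : forall (Phi : R -> R)
            (k n : nat) (T a1 a2 z1 d1 : R) (cC cK : R), R),
  forall (n k : nat) (T : R) (E : ri_space_Rn R n) (Et : ri_space_Rplus R)
    (Phi : R -> R) (X : gbfs T) (a1 a2 z1 d1 : R),
  let phi := profile Phi n in
  let G := @radial_kernel R n Phi in
  let H := potentials E G in
  let nH := potential_norm E G in
  let K := cone n k T Et phi in
  let rhoK := cone_rho n k T Et phi in
  let cC := embedding_norm H nH (@norm_C R n) in
  let cK := embedding_norm K rhoK (gbfs_norm X) in
  let Nphi := fine (associate_norm Et (zero_ext T phi)) in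
  (0 < n)%N -> (0 < k)%N -> 0 < T ->
  representation_space E Et ->
  (forall z, 0 < z -> 0 <= Phi z) ->
  (forall z, 0 < z -> {for z, continuous Phi}) ->
  (forall z w, 0 < z -> z <= w -> Phi w <= Phi z) ->
  (0 < \int[leb]_(z in Rplus) (Phi z * z ^+ n.-1)%:E < +oo)%E ->
  (associate_norm Et (zero_ext T phi) < +oo)%E ->
  Ck_pos k Phi ->
  0 < a1 -> 0 < a2 -> 0 < z1 -> 0 < d1 ->
  (forall z, 0 < z <= z1 ->
     \big[Num.max/0]_(1 <= j < k.+1) (z ^+ (2 * j) * `|Phi_iter Phi j z|)
       <= a1 * Phi z
     /\ d1 * Phi z <= (-1) ^+ k * z ^+ k * derive1n k Phi z) ->
  (forall z, z1 < z ->
     \big[Num.max/0]_(1 <= j < k.+1) (z ^+ (2 * j) * `|Phi_iter Phi j z|)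
       <= a2 * z ^+ k * Phi z) ->
  (continuously_embedded H (calderon k X) nH (calderon_norm k X)
     <-> cone_embedded n k Et phi X)
  /\
  (cone_embedded n k Et phi X ->
     embedding_norm H nH (calderon_norm k X) <= F k n T a1 a2 z1 d1 cC cK Nphi
     /\
     embedding_norm H nH (calderon_norm k X)
       <= F_Phi Phi k n T a1 a2 z1 d1 cC cK).
Proof.
exists (fun k n T a1 a2 _ _ cC cK N => cC + modulus_const n T k a1 a2 * cK *
          (1 + 4 * T `^ (k%:R / n%:R) * (cC / N))).
exists (fun Phi k n T a1 a2 _ _ cC cK => cC + modulus_const n T k a1 a2 * cK *
          (1 + 16 * T `^ (k%:R / n%:R) * tail_const Phi n T)).
move=> n k T E Et Phi X a1 a2 z1 d1 phi G H nH K rhoK cC cK Nphi.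
move=> n0 k0 T0 rep Phi0 _ Phid PhiI Nfin [sm _] a10 a20 z10 d10 near far.
have near1 (z : R) (zz : 0 < z <= z1) := (near z zz).1.
have HM := derivative_bound a10 a20 Phi0 near1 far.
have Philip := locally_lipschitz k0 a10 a20 Phi0 Phid sm near1 far.
have HMn (z : R) j (zz : 0 < z <= z1) (jk : (0 < j <= k)%N) := bigmax_bound (near1 z zz) jk.
have Hd (z : R) (zz : 0 < z <= z1) := (near z zz).2.
split.
  split; last exact: (continuously_embedded_of_cone n0 k0 T0 rep Phi0 Phid PhiI Nfin
    a10 a20 sm HM Philip).
  exact: (cone_of_continuously_embedded n0 k0 T0 rep Phi0 Phid PhiI Nfin
    a10 a20 sm HM z10 d10 HMn Hd).
move=> emb.
have le1 : embedding_norm H nH (calderon_norm k X) <= embedding_const k E Et Phi X a1 a2.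
  apply: embedding_norm_le.
    exact: (embedding_const_ge0 k E X n0 T0 Phi0 Phid PhiI Nfin a10 a20).
  move=> u Hu.
  exact: (calderon_norm_le_const n0 k0 T0 rep Phi0 Phid PhiI Nfin a10 a20 sm HM Philip emb Hu).
split; first exact: le1.
apply: le_trans le1 _.
exact: (embedding_const_le k X n0 T0 rep Phi0 Phid PhiI Nfin a10 a20).
Qed.
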